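(* The value function $$V(t_0,\xi_0,\mu_0):=\inf_{(\xi(\cdot),\boldsymbol\mu)\in\mathscr A_{[t_0,T]}(\xi_0,\mu_0)}\left\{\int_{t_0}^T\mathscr L(\xi(s),\mu_s)\,ds+\mathscr G(\xi(T),\mu_T)\right\}$$ is a subsolution of $$\partial_tw(t,\xi,\mu)+H(t,\xi,\mu,D_xw,D_\mu w)=0$$ with Hamiltonian function $$H(t,\xi,\mu,p_x,p_\mu(\cdot)):=\inf\left\{\mathscr L(\xi,\mu)+\langle v,p_x\rangle+\langle p_\mu,w\rangle_{L^2_\mu}:\ v\in F(t,\xi,\mu),\ w(x)\in G(t,\xi,x,\mu)\text{ for }\mu\text{-a.e. }x\right\}.$$
   Context: $\mathbb T^d$ is the $d$-dimensional torus; Euclidean notation is used on it ($|x-y|$ distance, $y-x\in\mathbb R^d$ displacement). $\mathscr P_2(\mathbb T^d)$ is the space of Borel probability measures with the Wasserstein distance $W_2$. $f\sharp\mu$ is the pushforward, $\mathrm{pr}_i$ the $i$-th projection, $\rightharpoonup$ narrow convergence. Assumptions on the data. Let $I=[0,T]$ and $k\in L^1(I)$, $k\ge0$. $F:I\times\mathbb T^d\times\mathscr P_2(\mathbb T^d)\rightrightarrows\mathbb R^d$ and $G:I\times\mathbb T^d\times\mathbb T^d\times\mathscr P_2(\mathbb T^d)\rightrightarrows\mathbb R^d$ are Borel measurable set-valued maps with nonempty compact convex images satisfying, with $d_H$ the Hausdorff distance, $d_H(F(t,x_1,\theta_1),F(s,x_2,\theta_2))\le k(t)(|t-s|+|x_1-x_2|+W_2(\theta_1,\theta_2))$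 and $d_H(G(t,x_1,y_1,\theta_1),G(s,x_2,y_2,\theta_2))\le k(t)(|t-s|+|x_1-x_2|+|y_1-y_2|+W_2(\theta_1,\theta_2))$ for all $t,s\in I$, $x_i,y_i\in\mathbb T^d$, $\theta_i\in\mathscr P_2(\mathbb T^d)$. $\mathscr L,\mathscr G:\mathbb T^d\times\mathscr P_2(\mathbb T^d)\to[0,+\infty[$ are bounded and Lipschitz continuous. Trajectories. $\mathscr A_{[t_0,T]}(\xi_0,\mu_0)$ is the set of pairs $(\xi(\cdot),\boldsymbol\mu=\{\mu_t\}_{t\in[t_0,T]})\in C^0([t_0,T];\mathbb T^d)\times C^0([t_0,T];\mathscr P_2(\mathbb T^d))$ with $\xi(t_0)=\xi_0$, $\mu_{t_0}=\mu_0$, $\dot\xi(t)\in F(t,\xi(t),\mu_t)$ for a.e. $t$, and $\partial_t\mu_t+\mathrm{div}(v_t\mu_t)=0$ in the sense of distributions for some Borel selection $v_t(y)$ of $(t,y)\mapsto G(t,\xi(t),y,\mu_t)$. Admissible variations. A Borel family $\{\pi_h\}_{h\in[0,1]}\subseteq\mathscr P(\mathbb T^d\times\mathbb T^d)$ is a family of admissible ($2$-)variations from $\mu_0$ if $\mathrm{pr}_1\sharp\pi_h=\mu_0$ for all $h$; $\pi_h\rightharpoonup(\mathrm{Id},\mathrm{Id})\sharp\mu_0$ as $h\to0^+$; and there is $C>0$ with $\limsup_{h\to0^+}\frac1h\left(\iint|x-y|^2\,d\pi_h(x,y)\right)^{1/2}\le C$. Superdifferential and subsolutions. For $U:[0,T]\times\mathbb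 T^d\times\mathscr P_2(\mathbb T^d)\to\mathbb R$, $\partial^+U(t_0,x_0,\mu_0)$ is the set of all $(p_{t_0},p_{x_0},p_{\mu_0}(\cdot))\in\mathbb R\times\mathbb R^d\times L^2_{\mu_0}$ such that for every family $\{\pi_h\}_{h\in[0,1]}$ of admissible variations from $\mu_0$ $$\limsup_{h\to0^+,\,|y|\to0}\frac{U(t_0+h,x_0+y,\mathrm{pr}_2\sharp\pi_h)-U(t_0,x_0,\mu_0)-p_{t_0}h-\langle p_{x_0},y\rangle-\iint\langle p_{\mu_0}(x),\zeta-x\rangle\,d\pi_h(x,\zeta)}{h+|y|}\le0.$$ $U$ is a subsolution of $\partial_tw+H(t,\xi,\mu,D_xw,D_\mu w)=0$ iff $p_t+H(t,x,\mu,p_x,p_\mu)\ge0$ for all $(t,x,\mu)\in[0,T[\times\mathbb T^d\times\mathscr P_2(\mathbb T^d)$ and all $(p_t,p_x,p_\mu)\in\partial^+U(t,x,\mu)$. *)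

(* Defs.v *)
From HB Require Import structures.
From mathcomp Require Import all_boot all_order all_algebra archimedean.
From mathcomp Require Import all_classical all_reals all_analysis.
From mathcomp Require Import measurable_realfun.

Set Implicit Arguments.
Unset Strict Implicit.
Unset Printing Implicit Defensive.

Import Order.TTheory GRing.Theory Num.Theory.
Import numFieldNormedType.Exports.

Local Open Scope classical_set_scope.
Local Open Scope ring_scope.

(** ** Euclidean structure of R^d (the library norm on 'rV[R]_d is the
    sup norm, which induces the same topology) *)

Section Euclid.
Context {R : realType} {d : nat}.

Definition dotv (u v : 'rV[R]_d) : R := \sum_(i < d) u 0 i * v 0 i.

Definition enorm (u : 'rV[R]_d) : R := Num.sqrt (dotv u u).

(* extended real-valued, so that it is meaningful for every pair of sets *)
Definition hausdorff_dist (A B : set 'rV[R]_d) : \bar R :=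
  maxe
    (ereal_sup [set ereal_inf [set (enorm (a - b))%:E | b in B] | a in A])
    (ereal_sup [set ereal_inf [set (enorm (a - b))%:E | a in A] | b in B]).

(* The Borel sigma-algebra of R^d is the product one: a map into R^d is Borel
   iff its coordinates are. *)
Definition vmeasurable {dX} {X : measurableType dX} (D : set X)
    (f : X -> 'rV[R]_d) : Prop :=
  forall i, measurable_fun D (fun x => f x 0 i).

(* On I x T^d x P_2(T^d) this is used with the product sigma-algebra, which is
   the Borel one since the factors are separable metric spaces. *)
Definition setvalued_measurable {dX} {X : measurableType dX} (D : set X)
    (Phi : X -> set 'rV[R]_d) : Prop :=
  forall O : set 'rV[R]_d, open O ->
    measurable (D `&` [set x | Phi x `&` O !=set0]).

Definition nonempty_compact_convex (A : set 'rV[R]_d) : Prop :=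
  [/\ A !=set0, compact A & convex_set (A : set (convex_lmodType 'rV[R]_d))].

End Euclid.

(** ** The torus R^d / Z^d *)

Section TorusDef.
Variables (R : realType) (d : nat).

Definition zcongr (x y : 'rV[R]_d) : bool :=
  [forall i, x 0 i - y 0 i \is a Num.int].

Lemma zcongr_refl : reflexive zcongr.
Proof. by move=> x; apply/forallP => i; rewrite subrr rpred0. Qed.

Lemma zcongr_sym : symmetric zcongr.
Proof.
by move=> x y; apply: eq_forallb => i; rewrite -opprB rpredN.
Qed.

Lemma zcongr_trans : transitive zcongr.
Proof.
move=> y x z /forallP xy /forallP yz; apply/forallP => i.
by have := rpredD (xy i) (yz i); rewrite addrA subrK.
Qed.

Canonical zcongr_equiv := EquivRel zcongr zcongr_refl zcongr_sym zcongr_trans.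

Definition torus : Type := quotient_topology {eq_quot zcongr_equiv}%qT.

HB.instance Definition _ := PointedTopological.on torus.
HB.instance Definition _ := Quotient.on torus.
HB.instance Definition _ :=
  @isMeasurable.Build (sigma_display (@open torus)) torus
    <<s @open torus >> (@sigma_algebra0 _ setT _) (@sigma_algebraC torus _)
    (@sigma_algebra_bigcup _ setT _).

End TorusDef.

Section Torus.
Context {R : realType} {d : nat}.
Local Notation T := (torus R d).

Definition tproj (u : 'rV[R]_d) : T := (\pi_T u)%qT.
(* an arbitrary representative, hence possibly not Borel in x: it is only used
   below inside expressions invariant under Z^d *)
Definition tlift (x : T) : 'rV[R]_d := repr x.

(* x + v *)
Definition tshift (x : T) (v : 'rV[R]_d) : T := tproj (tlift x + v).

(* the representative of r modulo 1 in [-1/2, 1/2[ *)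
Definition centered (r : R) : R := r - (Num.floor (r + 2^-1))%:~R.

(* y - x : the shortest vector v with x + v = y; ties, which only occur when
   some coordinates are antipodal, are broken by [centered]. *)
Definition tdisp (x y : T) : 'rV[R]_d :=
  \row_i centered (tlift y 0 i - tlift x 0 i).

Definition tdist (x y : T) : R := enorm (tdisp x y).

End Torus.

(** ** Probability measures and the Wasserstein distance *)

Notation prob_torus R d := (probability (torus R d) R).
Notation prob_torus2 R d :=
  (probability (Datatypes.prod (torus R d) (torus R d)) R).

Section Wasserstein.
Context {R : realType} {d : nat}.
Local Notation T := (torus R d).

(* Measures of the library are total set functions: they are identified when
   they agree on measurable sets. *)
Definition same_meas {dX} {X : measurableType dX} (m1 m2 : set X -> \bar R) :
  Prop := forall A, measurable A -> m1 A = m2 A.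

Definition diagt (x : T) : T * T := (x, x).

Lemma measurable_diagt : measurable_fun setT diagt.
Proof. by apply: measurable_fun_pair; exact: measurable_id. Qed.

Definition proj1t (z : T * T) : T := z.1.
Definition proj2t (z : T * T) : T := z.2.

HB.instance Definition _ := @isMeasurableFun.Build _ _ _ _ diagt measurable_diagt.
HB.instance Definition _ :=
  @isMeasurableFun.Build _ _ _ _ proj1t (@measurable_fst _ _ T T).
HB.instance Definition _ :=
  @isMeasurableFun.Build _ _ _ _ proj2t (@measurable_snd _ _ T T).

Definition pr1_push (pi : prob_torus2 R d) : prob_torus R d :=
  distribution pi proj1t.
Definition pr2_push (pi : prob_torus2 R d) : prob_torus R d :=
  distribution pi proj2t.
Definition diag_push (mu : prob_torus R d) : prob_torus2 R d :=
  distribution mu diagt.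

Definition couplings (mu nu : prob_torus R d) : set (prob_torus2 R d) :=
  [set pi | same_meas (pr1_push pi) mu /\ same_meas (pr2_push pi) nu].

Definition transport_cost (pi : prob_torus2 R d) : R :=
  \int[pi]_z (tdist z.1 z.2 ^+ 2).

Definition W2 (mu nu : prob_torus R d) : R :=
  Num.sqrt (inf [set transport_cost pi | pi in couplings mu nu]).

Definition W2_open (A : set (prob_torus R d)) : Prop :=
  forall mu, A mu ->
    exists2 r : R, 0 < r & forall nu, W2 mu nu < r -> A nu.

(* P_2(T^d) with the Borel sigma-algebra of W_2 *)
Definition prob_borel : measurableType (sigma_display W2_open) :=
  g_sigma_algebraType W2_open.

(* representatives of the elements of L^2_mu(T^d; R^d) *)
Definition L2_field (mu : prob_torus R d) (p : T -> 'rV[R]_d) : Prop :=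
  vmeasurable setT p /\ (\int[mu]_x (enorm (p x) ^+ 2)%:E < +oo)%E.

Definition narrow_cvg (pi : R -> prob_torus2 R d) (F : set_system R)
    (nu : prob_torus2 R d) : Prop :=
  forall f : T * T -> R, continuous f -> bounded_fun f ->
    (fun h => \int[pi h]_z f z) @ F --> \int[nu]_z f z.

End Wasserstein.
Arguments prob_borel : clear implicits.

(** ** Curves and the continuity equation *)

Section Curves.
Context {R : realType} {d : nat}.
Local Notation T := (torus R d).
Local Notation P := (prob_torus R d).
Local Notation E := (R^o * 'rV[R]_d)%type.

Definition has_velocity (xi : R -> T) (t : R) (u : 'rV[R]_d) : Prop :=
  (fun h : R => h^-1 *: tdisp (xi t) (xi (t + h))) @ 0^' --> u.

(* s lists the endpoints of finitely many non-overlapping subintervals *)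
Definition abs_continuous (a b : R) (xi : R -> T) : Prop :=
  forall e : R, 0 < e -> exists2 dl : R, 0 < dl &
    forall s : seq (R * R),
      all (fun J => (a <= J.1) && (J.1 <= J.2) && (J.2 <= b)) s ->
      pairwise (fun J K => (J.2 <= K.1) || (K.2 <= J.1)) s ->
      \sum_(J <- s) (J.2 - J.1) < dl ->
      \sum_(J <- s) tdist (xi J.1) (xi J.2) < e.

Definition W2_continuous (a b : R) (mu : R -> P) : Prop :=
  forall t, t \in `[a, b] ->
    (fun s => W2 (mu t) (mu s)) @ within `[a, b] (nbhs t) --> (0 : R).

Fixpoint Ck (k : nat) (f : E -> R^o) : Prop :=
  match k with
  | 0 => continuous f
  | k'.+1 => (forall z, differentiable f z) /\
             (forall v : E, Ck k' (fun z => 'D_v f z))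
  end.

(* phi read on R x R^d, where it is Z^d-periodic in the second variable *)
Definition periodization (phi : R -> T -> R) (z : E) : R^o :=
  phi z.1 (tproj z.2).

(* C^oo functions with compact support in ]a, b[ x T^d, extended by 0 *)
Definition test_function (a b : R) (phi : R -> T -> R) : Prop :=
  (forall k, Ck k (periodization phi)) /\
  exists a' b' : R, [/\ a < a', b' < b &
    forall t y, t \notin `[a', b'] -> phi t y = 0].

Definition dt (phi : R -> T -> R) (t : R) (y : T) : R :=
  'D_((1, 0) : E) (periodization phi) ((t, tlift y) : E).

Definition gradx (phi : R -> T -> R) (t : R) (y : T) : 'rV[R]_d :=
  \row_i 'D_((0, delta_mx 0 i) : E) (periodization phi) ((t, tlift y) : E).

(* d_t mu + div (v mu) = 0 in the sense of distributions on ]a, b[ x T^d *)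
Definition continuity_equation (a b : R) (mu : R -> P)
    (v : R -> T -> 'rV[R]_d) : Prop :=
  forall phi, test_function a b phi ->
    \int[lebesgue_measure]_(t in `[a, b])
      (\int[mu t]_y (dt phi t y + dotv (gradx phi t y) (v t y))) = 0.

End Curves.

(** ** The control problem *)

Section Control.
Context {R : realType} {d : nat}.
Local Notation T := (torus R d).
Local Notation P := (prob_torus R d).
Local Notation Rd := 'rV[R]_d.

Section Data.
Variable Tf : R.
Variables (F : R -> T -> P -> set Rd) (G : R -> T -> T -> P -> set Rd).
Variables (L Gf : T -> P -> R).

Definition F_borel : Prop :=
  setvalued_measurable (X := (R * T * prob_borel R d)%type)
    (`[0, Tf] `*` setT `*` setT) (fun z => F z.1.1 z.1.2 z.2).

Definition G_borel : Prop :=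
  setvalued_measurable (X := (R * T * T * prob_borel R d)%type)
    (`[0, Tf] `*` setT `*` setT `*` setT)
    (fun z => G z.1.1.1 z.1.1.2 z.1.2 z.2).

Definition F_assumptions (k : R -> R) : Prop :=
  [/\ F_borel,
      forall t x th, t \in `[0, Tf] -> nonempty_compact_convex (F t x th) &
      forall t s x1 x2 th1 th2, t \in `[0, Tf] -> s \in `[0, Tf] ->
        (hausdorff_dist (F t x1 th1) (F s x2 th2) <=
         (k t * (`|t - s| + tdist x1 x2 + W2 th1 th2))%:E)%E].

Definition G_assumptions (k : R -> R) : Prop :=
  [/\ G_borel,
      forall t x y th, t \in `[0, Tf] -> nonempty_compact_convex (G t x y th) &
      forall t s x1 x2 y1 y2 th1 th2, t \in `[0, Tf] -> s \in `[0, Tf] ->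
        (hausdorff_dist (G t x1 y1 th1) (G s x2 y2 th2) <=
         (k t * (`|t - s| + tdist x1 x2 + tdist y1 y2 + W2 th1 th2))%:E)%E].

Definition cost_assumptions (c : T -> P -> R) : Prop :=
  [/\ forall x th, 0 <= c x th,
      exists M : R, forall x th, c x th <= M &
      exists K : R, forall x1 x2 th1 th2,
        `|c x1 th1 - c x2 th2| <= K * (tdist x1 x2 + W2 th1 th2)].

(* Only the values on [t0, Tf] are constrained. As usual for differential
   inclusions, solutions are absolutely continuous; mere continuity together
   with an a.e. derivative would allow Cantor-like curves. *)
Definition trajectories (t0 : R) (xi0 : T) (mu0 : P) :
    set ((R -> T) * (R -> P)) :=
  [set z | let xi := z.1 in let mu := z.2 in
    [/\ {within `[t0, Tf], continuous xi},
        W2_continuous t0 Tf mu,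
        xi t0 = xi0 /\ same_meas (mu t0) mu0,
        abs_continuous t0 Tf xi /\
        {ae lebesgue_measure, forall t, t \in `[t0, Tf] ->
          exists2 u, has_velocity xi t u & F t (xi t) (mu t) u} &
        exists v : R -> T -> Rd,
          [/\ vmeasurable (X := (R * T)%type) (`[t0, Tf] `*` setT)
                (fun z => v z.1 z.2),
              forall t y, t \in `[t0, Tf] -> G t (xi t) y (mu t) (v t y) &
              continuity_equation t0 Tf mu v]]].

Definition total_cost (t0 : R) (xi : R -> T) (mu : R -> P) : R :=
  \int[lebesgue_measure]_(s in `[t0, Tf]) L (xi s) (mu s) + Gf (xi Tf) (mu Tf).

(* the costs are nonnegative, so [inf] is their infimum as soon as some
   trajectory exists *)
Definition value_function (t0 : R) (xi0 : T) (mu0 : P) : R :=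
  inf [set total_cost t0 z.1 z.2 | z in trajectories t0 xi0 mu0].

(* valued in \bar R only so that the infimum is unconditionally meaningful *)
Definition hamiltonian (t : R) (x : T) (mu : P) (px : Rd) (pmu : T -> Rd) :
    \bar R :=
  ereal_inf [set e | exists v w,
    [/\ F t x mu v, L2_field mu w,
        {ae mu, forall y, G t x y mu (w y)} &
        e = (L x mu + dotv v px + \int[mu]_y dotv (pmu y) (w y))%:E]].

End Data.

(* h |-> pi_h(B) is Borel for every Borel set B *)
Definition borel_family (pi : R -> prob_torus2 R d) : Prop :=
  forall B : set (T * T), measurable B ->
    measurable_fun (`[0, 1] : set R) (fun h => pi h B).

Definition admissible_variation (mu0 : P) (pi : R -> prob_torus2 R d) : Prop :=
  [/\ borel_family pi,
      forall h, h \in `[0, 1] -> same_meas (pr1_push (pi h)) mu0,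
      narrow_cvg pi 0^'+ (diag_push mu0) &
      exists2 C : R, 0 < C &
        let rate := fun h : R => (h^-1 * Num.sqrt (transport_cost (pi h)))%:E in
        (limf_esup rate (0 : R)%R^'+ <= C%:E)%E].

Definition superdifferential (U : R -> T -> P -> R) (t0 : R) (x0 : T)
    (mu0 : P) (pt : R) (px : Rd) (pmu : T -> Rd) : Prop :=
  L2_field mu0 pmu /\
  forall pi, admissible_variation mu0 pi ->
    let quotient := fun q : R * Rd => let h := q.1 in let y := q.2 in
      ((U (t0 + h) (tshift x0 y) (pr2_push (pi h)) - U t0 x0 mu0
        - pt * h - dotv px y
        - \int[pi h]_z dotv (pmu z.1) (tdisp z.1 z.2))
       / (h + enorm y))%:E in
    (limf_esup quotient (filter_prod (0 : R)%R^'+ (nbhs (0 : Rd)%R)) <= 0)%E.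

Definition subsolution (Tf : R) (H : R -> T -> P -> Rd -> (T -> Rd) -> \bar R)
    (U : R -> T -> P -> R) : Prop :=
  forall t x mu, 0 <= t < Tf ->
  forall pt px pmu, superdifferential U t x mu pt px pmu ->
    (0 <= pt%:E + H t x mu px pmu)%E.

End Control.

(* Main.v *)
Require Import Defs.
From HB Require Import structures.
From mathcomp Require Import all_boot all_order all_algebra archimedean.
From mathcomp Require Import all_classical all_reals all_analysis.
From mathcomp Require Import measurable_realfun ring lra.

Set Implicit Arguments.
Unset Strict Implicit.
Unset Printing Implicit Defensive.

Import Order.TTheory GRing.Theory Num.Theory.
Import numFieldNormedType.Exports.

Local Open Scope classical_set_scope.
Local Open Scope ring_scope.

(** Fix (a, x0, mu0) with a < Tf, a superdifferential (pt, px, pmu) of the value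
    function V there, and an admissible pair of velocities: v in F(a, x0, mu0) and
    w(y) in G(a, x0, y, mu0) for almost every y. The theorem follows if a control
    starts with these velocities, that is, if some trajectory on [a, Tf] has an
    agent displaced by h v + O(h^2) at time a + h, while its crowd is the image of
    mu0 under a map X_h = y + h w(y) + O(h^2), uniformly in y. Indeed the plans
    (Id, X_h) # mu0 are then admissible variations from mu0 along which the pairing
    with pmu is h <pmu, w> + O(h^2), the dynamic programming inequality
    V(a, x0, mu0) <= int_a^(a+h) L + V(a + h, agent, crowd) bounds the increment
    of V from below by - h L(x0, mu0) - O(h^2), and the inequality defining the
    superdifferential, divided by h, gives 0 <= pt + L + <v, px> + <pmu, w> in the
    limit ([hamiltonian_step]). Taking the infimum over v and w concludes.

    The trajectory is built in Lagrangian form. The unknowns are the velocities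
    of the agent and of every particle, and the inclusions are solved by the
    iteration of Filippov ([filippov]): starting from the constant velocities
    (v, w), each velocity is replaced by its projection on the image of F or G
    along the current displacements. Although k is only integrable, the constant
    velocities miss the images at time t by at most a multiple of t - a, since the
    Lipschitz estimate may be used with its constant taken at time a; and the
    iteration contracts in a norm weighted by a function E such that the integral
    of k E up to t is at most E(t) / 8 ([weight_ex]). This gives a second-order
    error, uniform over the particles ([lagrangian_ex]).

    A trajectory in the sense of the continuity equation needs a field p(t, y)
    which depends on the position of the particle instead of its label. It is the
    conditional expectation of the velocity given time and position, obtained from
    the Radon-Nikodym theorem. As G is convex-valued, a conditional expectation of
    a selection is still a selection ([convex_condexp]), and both fields give
    the same integrals against gradients of test functions ([law_boundary]).

    Dynamic programming requires this trajectory on [a, a + h] to be followed by an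
    arbitrary one on [a + h, Tf] ([glue_trajectory]). Test functions
    on the whole interval do not vanish at the junction, so both pieces need
    their boundary terms: the first because t |-> phi(t, X_t) is absolutely
    continuous along each particle ([transport]), the second by testing with
    smooth cutoffs in time that converge to 1 ([weak_boundary]). *)

(** * Euclidean space and nearest points *)

Section euclid.
Context {R : realType} {d : nat}.
Implicit Types (u v w z p q h : 'rV[R]_d) (A B : set 'rV[R]_d).

Lemma dotvC u v : dotv u v = dotv v u.
Proof. by apply: eq_bigr => i _; rewrite mulrC. Qed.

Lemma dotvDl u v w : dotv (u + v) w = dotv u w + dotv v w.
Proof. by rewrite /dotv -big_split; apply: eq_bigr => i _; rewrite mxE mulrDl. Qed.

Lemma dotvZl (c : R) u v : dotv (c *: u) v = c * dotv u v.
Proof. by rewrite /dotv mulr_sumr; apply: eq_bigr => i _; rewrite mxE mulrA. Qed.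

Lemma dotvNl u v : dotv (- u) v = - dotv u v.
Proof. by rewrite -scaleN1r dotvZl mulN1r. Qed.

Lemma dotvBl u v w : dotv (u - v) w = dotv u w - dotv v w.
Proof. by rewrite dotvDl dotvNl. Qed.

Lemma dotvDr u v w : dotv w (u + v) = dotv w u + dotv w v.
Proof. by rewrite !(dotvC w) dotvDl. Qed.

Lemma dotvZr (c : R) u v : dotv v (c *: u) = c * dotv v u.
Proof. by rewrite !(dotvC v) dotvZl. Qed.

Lemma dotvNr u v : dotv v (- u) = - dotv v u.
Proof. by rewrite !(dotvC v) dotvNl. Qed.

Lemma dotvBr u v w : dotv w (u - v) = dotv w u - dotv w v.
Proof. by rewrite !(dotvC w) dotvBl. Qed.

Lemma dotv0l u : dotv 0 u = 0.
Proof. by rewrite -(scale0r u) dotvZl mul0r. Qed.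

Lemma dotv_ge0 u : 0 <= dotv u u.
Proof. by apply: sumr_ge0 => i _; rewrite -expr2 sqr_ge0. Qed.

Lemma enorm_ge0 u : 0 <= enorm u. Proof. exact: sqrtr_ge0. Qed.

Lemma sqr_enorm u : enorm u ^+ 2 = dotv u u.
Proof. by rewrite /enorm sqr_sqrtr// dotv_ge0. Qed.

Lemma enorm0 : enorm (0 : 'rV[R]_d) = 0.
Proof. by rewrite /enorm dotv0l sqrtr0. Qed.

Lemma enormN u : enorm (- u) = enorm u.
Proof. by rewrite /enorm dotvNl dotvNr opprK. Qed.

Lemma enormB u v : enorm (u - v) = enorm (v - u).
Proof. by rewrite -enormN opprB. Qed.

Lemma enormZ (c : R) u : enorm (c *: u) = `|c| * enorm u.
Proof.
by rewrite /enorm dotvZl dotvZr mulrA -expr2 sqrtrM ?sqr_ge0// sqrtr_sqr.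
Qed.

Lemma le_coord_enorm u i : `|u 0 i| <= enorm u.
Proof.
rewrite -sqrtr_sqr ler_sqrt ?dotv_ge0// /dotv (bigD1 i)//= -expr2 lerDl.
by apply: sumr_ge0 => j _; rewrite -expr2 sqr_ge0.
Qed.

Lemma enorm_eq0 u : enorm u = 0 -> u = 0.
Proof.
move=> u0; apply/rowP => i; rewrite mxE; apply/normr0_eq0/eqP.
by rewrite eq_le normr_ge0 andbT -u0 le_coord_enorm.
Qed.

Lemma dotv_le u v : dotv u v <= enorm u * enorm v.
Proof.
have [u0|u0] := eqVneq (enorm u) 0.
  by rewrite (enorm_eq0 u0) dotv0l mulr_ge0// enorm_ge0.
have [v0|v0] := eqVneq (enorm v) 0.
  by rewrite (enorm_eq0 v0) dotvC dotv0l mulr_ge0// enorm_ge0.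
have := dotv_ge0 (enorm v *: u - enorm u *: v).
rewrite dotvBl !dotvBr !dotvZl !dotvZr -!sqr_enorm (dotvC v u).
have up : 0 < enorm u by rewrite lt_def u0 enorm_ge0.
have vp : 0 < enorm v by rewrite lt_def v0 enorm_ge0.
rewrite (_ : _ - _ = 2 * (enorm u * enorm v) * (enorm u * enorm v - dotv u v)); last by ring.
by rewrite pmulr_rge0 ?subr_ge0// !mulr_gt0.
Qed.

Lemma normr_dotv_le u v : `|dotv u v| <= enorm u * enorm v.
Proof.
by rewrite ler_norml dotv_le andbT lerNl -dotvNl (le_trans (dotv_le _ _))// enormN.
Qed.

Lemma enormD u v : enorm (u + v) <= enorm u + enorm v.
Proof.
rewrite -(@ler_pXn2r _ 2)// ?nnegrE ?addr_ge0 ?enorm_ge0// sqr_enorm.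
rewrite dotvDl !dotvDr (dotvC v u) -!sqr_enorm.
by have := dotv_le u v; nra.
Qed.

Lemma sqr_enorm_le u v : enorm u <= enorm v -> dotv u u <= dotv v v.
Proof. by move=> uv; rewrite -!sqr_enorm lerXn2r// nnegrE enorm_ge0. Qed.

Lemma enorm_triangle v u w : enorm (u - w) <= enorm (u - v) + enorm (v - w).
Proof. by rewrite (le_trans _ (enormD _ _))// addrA subrK. Qed.

Lemma enorm_sum (I : Type) (r : seq I) (P : pred I) (f : I -> 'rV[R]_d) :
  enorm (\sum_(i <- r | P i) f i) <= \sum_(i <- r | P i) enorm (f i).
Proof.
elim/big_ind2 : _ => //; first by rewrite enorm0.
by move=> ? ? ? ? h1 h2; rewrite (le_trans (enormD _ _))// lerD.
Qed.

Lemma le_coord_norm u i : `|u 0 i| <= `|u|.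
Proof.
rewrite [leRHS]mx_normrE.
exact: (le_bigmax _ (fun x : 'I_1 * 'I_d => `|u x.1 x.2|) (0, i)).
Qed.

Lemma le_norm_enorm u : `|u| <= enorm u.
Proof.
rewrite [leLHS]mx_normrE; apply/bigmax_leP; split; first exact: enorm_ge0.
by move=> [i j] _ /=; rewrite ord1 le_coord_enorm.
Qed.

Lemma enorm_le_sum u : enorm u <= \sum_(i < d) `|u 0 i|.
Proof.
rewrite [X in enorm X](matrix_sum_delta u) big_ord1 (le_trans (enorm_sum _ _ _))//.
apply: ler_sum => j _; rewrite enormZ ler_piMr//.
rewrite /enorm /dotv (bigD1 j)//= big1 ?addr0; last first.
  by move=> k kj; rewrite !mxE (negbTE kj) andbF mulr0.
by rewrite !mxE !eqxx mulr1 sqrtr1.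
Qed.

Lemma enorm_le_norm u : enorm u <= d%:R * `|u|.
Proof.
rewrite (le_trans (enorm_le_sum _))//.
rewrite (_ : d%:R * _ = \sum_(i < d) `|u|); last by rewrite sumr_const card_ord mulr_natl.
by apply: ler_sum => i _; exact: le_coord_norm.
Qed.

Lemma enorm_ler_dist u v : `|enorm u - enorm v| <= enorm (u - v).
Proof.
rewrite ler_norml; apply/andP; split.
  by have := enormD (v - u) u; rewrite subrK enormB; lra.
by have := enormD (u - v) v; rewrite subrK; lra.
Qed.

Lemma continuous_enorm : continuous (enorm : 'rV[R]_d -> R).
Proof.

move=> u; apply/(@cvgrPdist_le R R^o _ (nbhs u)) => e e0.
have ed : 0 < e / (d%:R + 1) by rewrite divr_gt0// ltr_wpDl.
apply: filterS (@cvgr_dist_le _ _ _ (nbhs u) _ id _ cvg_id _ ed) => v /= h.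
rewrite (le_trans (enorm_ler_dist _ _))// (le_trans (enorm_le_norm _))//.
rewrite (@le_trans _ _ ((d%:R + 1) * `|u - v|))// ?ler_wpM2r ?lerDl//.
by rewrite mulrC -ler_pdivlMr ?ltr_wpDl.
Qed.

Definition nearest (A : set 'rV[R]_d) (z p : 'rV[R]_d) :=
  A p /\ forall q, A q -> enorm (z - p) <= enorm (z - q).

(** Total: the value is 0 where no nearest point exists. *)
Definition nproj (A : set 'rV[R]_d) (z : 'rV[R]_d) : 'rV[R]_d :=
  xget 0 [set p | nearest A z p].

Lemma nprojP A z : nonempty_compact_convex A -> nearest A z (nproj A z).
Proof.
move=> [A0 cA _]; rewrite /nproj; case: xgetP => [y -> //|h]; exfalso.
have [|c Ac hc] := @EVT_min_rV R d (fun p => enorm (z - p)) A A0 cA.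
  apply: continuous_subspaceT => x.
  rewrite /continuous_at; apply: (@continuous_comp _ _ R (fun p => z - p) enorm x).
    by apply: (@cvgB _ _ _ (nbhs x)); [exact: cvg_cst|exact: cvg_id].
  exact: continuous_enorm.
by apply: (h c); split; [exact/set_mem|move=> q Aq; apply: hc; exact/mem_set].
Qed.

Lemma nproj_in A z : nonempty_compact_convex A -> A (nproj A z).
Proof. by case/(nprojP z). Qed.

Lemma nproj_le A z q : nonempty_compact_convex A -> A q ->
  enorm (z - nproj A z) <= enorm (z - q).
Proof. by case/(nprojP z) => _; apply. Qed.

Lemma convex_combination (A : set 'rV[R]_d) p q (t : R) :
  nonempty_compact_convex A -> A p -> A q ->
  0 <= t <= 1 -> A (t *: p + (1 - t) *: q).
Proof.
move=> [_ _ cA] Ap Aq /andP[t0 t1].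
by have := cA p q (Itv01 t0 t1) (mem_set Ap) (mem_set Aq); rewrite inE.
Qed.

(** Variational inequality of the projection: moving from the nearest point towards q
    inside the convex set cannot decrease the distance to first order. *)
Lemma nproj_dotv_le0 A z q : nonempty_compact_convex A -> A q ->
  dotv (z - nproj A z) (q - nproj A z) <= 0.
Proof.
move=> hA Aq; set p := nproj A z; rewrite leNgt; apply/negP => h.
have Ap : A p by exact: nproj_in.
pose c := dotv (q - p) (q - p).
have c0 : 0 <= c by exact: dotv_ge0.
pose s := dotv (z - p) (q - p).
have key (t : R) : 0 <= t <= 1 -> 2 * t * s <= t ^+ 2 * c.
  move=> t01; have := nproj_le z hA (convex_combination hA Aq Ap t01).
  rewrite -/p => /sqr_enorm_le.
  rewrite (_ : z - (_ + _) = (z - p) - t *: (q - p)); last first.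
    by apply/rowP => i; rewrite !mxE; ring.
  have expand (x y : 'rV[R]_d) : dotv (x - t *: y) (x - t *: y) =
      dotv x x - 2 * t * dotv x y + t ^+ 2 * dotv y y.
    by rewrite !(dotvBl, dotvBr, dotvZl, dotvZr) (dotvC y x); ring.
  by rewrite expand -/c -/s; lra.
(* t = s / (c + s) lies in [0, 1] and violates the inequality when s > 0 *)
have cs : 0 < c + s by rewrite ltr_wpDl.
have := key (s / (c + s)).
have -> : 0 <= s / (c + s) <= 1.
  by rewrite divr_ge0 ?(ltW cs) ?(ltW h)//= (ler_pdivrMr _ _ cs) mul1r lerDr.
move=> /(_ isT).
have t0 : 0 < s / (c + s) by rewrite divr_gt0.
have e : s / (c + s) * (c + s) = s by rewrite divfK// gt_eqF.
move: (s / (c + s)) t0 e => t t0 e h2.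
have h3 : 2 * s <= t * c by rewrite -(ler_pM2l t0); lra.
have h4 : 0 < t * s by rewrite mulr_gt0.
have s0 : 0 < s by [].
by move: e h3 h4 s0; rewrite mulrDr; clearbody s c; lra.
Qed.

Lemma nproj_id A z : nonempty_compact_convex A -> A z -> nproj A z = z.
Proof.
move=> hA Az; have := nproj_le z hA Az; rewrite subrr enorm0 => h.
by apply/esym/eqP; rewrite -subr_eq0; apply/eqP/enorm_eq0/eqP; rewrite eq_le h enorm_ge0.
Qed.

Lemma nproj_lip A z z' : nonempty_compact_convex A ->
  enorm (nproj A z - nproj A z') <= enorm (z - z').
Proof.
move=> hA; set p := nproj A z; set q := nproj A z'.
have h1 := nproj_dotv_le0 z hA (nproj_in z' hA).
have h2 := nproj_dotv_le0 z' hA (nproj_in z hA).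
rewrite -/p -/q in h1 h2.
have h3 : dotv (p - q) (p - q) <= dotv (z - z') (p - q).
  move: h1 h2; rewrite -(opprB p q) dotvNr !(dotvBl _ _ (p - q)).
  set x := dotv z _; set y := dotv z' _; set a := dotv p _; set b := dotv q _.
  by clearbody x y a b; lra.
have [e|e] := eqVneq (enorm (p - q)) 0; first by rewrite e enorm_ge0.
have e0 : 0 < enorm (p - q) by rewrite lt_def e enorm_ge0.
by rewrite -(ler_pM2r e0) -expr2 sqr_enorm (le_trans h3)// dotv_le.
Qed.

(** The squared distance to a convex set is differentiable, with gradient twice the
    residual. Through it the projection on a measurable set-valued map inherits the
    measurability of the distance function. *)
Lemma sqr_dist_nproj A z h : nonempty_compact_convex A ->
  `| enorm (z + h - nproj A (z + h)) ^+ 2 - enorm (z - nproj A z) ^+ 2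
     - 2 * dotv h (z - nproj A z) | <= dotv h h.
Proof.
move=> hA; set p := nproj A z; set q := nproj A (z + h).
have h1 := nproj_le (z + h) hA (nproj_in z hA).
have h2 := nproj_le z hA (nproj_in (z + h) hA).
have h3 := nproj_lip z (z + h) hA.
rewrite -/p -/q in h1 h2 h3.
rewrite opprD addNKr enormN in h3.
have h4 := dotv_le (q - p) h.
have h5 : enorm (p - q) * enorm h <= dotv h h.
  by rewrite -sqr_enorm expr2 ler_wpM2r ?enorm_ge0.
rewrite enormB in h5.
move: h1 h2 h4 h5 {h3}; clearbody p q => h1 h2 h4 h5.
have expand (x y : 'rV[R]_d) : dotv (x + y) (x + y) = dotv x x + 2 * dotv x y + dotv y y.
  by rewrite !(dotvDl, dotvDr) (dotvC y x); ring.
have := sqr_enorm_le h1; have := sqr_enorm_le h2; rewrite !sqr_enorm.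
rewrite !(addrAC z h) !(expand (_ - _) h) (dotvC h) (_ : z - q = (z - p) - (q - p)); last first.
  by apply/rowP => i; rewrite !mxE; ring.
rewrite (dotvBl (z - p) (q - p) h).
set a := dotv (z - p) (z - p); set b := dotv (z - p) h; set c := dotv h h in h5 *.
set e := dotv (q - p) h in h4 *; set f := dotv (_ - (q - p)) _.
set g := enorm _ * enorm h in h4 h5.
move: {h1 h2 expand hA} h4 h5; clearbody a b c e f g => h4 h5 k1 k2.
by rewrite ler_norml; apply/andP; split; lra.
Qed.

Lemma hausdorff_nproj A B p r : nonempty_compact_convex B -> A p ->
  (hausdorff_dist A B <= r%:E)%E -> enorm (p - nproj B p) <= r.
Proof.
move=> hB Ap; rewrite /hausdorff_dist ge_max => /andP[h _].
rewrite -lee_fin (le_trans _ h)//.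
apply: (@le_trans _ _ (ereal_inf [set (enorm (p - b))%:E | b in B])).
  by apply: le_ereal_inf_tmp => _ [b Bb <-]; rewrite lee_fin nproj_le.
by apply: ereal_sup_ubound; exists p.
Qed.

End euclid.

(** * Borel maps and the flat torus *)

Section second_countable.

Definition countable_base (V : topologicalType) := exists B : nat -> set V,
  (forall n, open (B n)) /\
  forall O x, open O -> O x -> exists n, B n x /\ B n `<=` O.

Lemma countable_base_of (I : countType) (V : topologicalType) (B : I -> set V) :
  (forall n, open (B n)) ->
  (forall O x, open O -> O x -> exists n, B n x /\ B n `<=` O) ->
  countable_base V.
Proof.
move=> oB hB; exists (fun n => if unpickle n is Some i then B i else set0); split.
  by move=> n; case: unpickle => [i|]; [exact: oB|exact: open0].
move=> O x oO Ox; have [i [Bx BO]] := hB _ _ oO Ox.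
by exists (pickle i); rewrite pickleK.
Qed.

Variable R : realType.

Definition rat_ball d (q : 'rV[rat]_d * nat) : set 'rV[R]_d :=
  ball (\row_i ratr (q.1 0 i) : 'rV[R]_d) (q.2.+1%:R^-1 : R).

Lemma rat_ball_base d (O : set 'rV[R]_d) x : open O -> O x ->
  exists q, rat_ball q x /\ rat_ball q `<=` O.
Proof.
move=> oO Ox.
have [e /= e0 xeO] : nbhs_ball x O by rewrite nbhs_ballE; exact: open_nbhs_nbhs.
have [n ne] : exists n, 2 * n.+1%:R^-1 < e.
  have [n _ /(_ n (leqnn n))] := near_infty_natSinv_lt (PosNum (divr_gt0 e0 (ltr0n R 2))).
  by rewrite /= ltr_pdivlMr// mulrC; exists n.
have r0 : 0 < n.+1%:R^-1 :> R by rewrite invr_gt0.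
have /choice[q hq] (i : 'I_d) : exists q : rat, `|x 0 i - ratr q| < n.+1%:R^-1.
  have /rat_in_itvoo[q] : x 0 i - n.+1%:R^-1 < x 0 i + n.+1%:R^-1.
    by rewrite ltrD2l gtrN.
  rewrite in_itv/= => /andP[h1 h2]; exists q; rewrite ltr_norml.
  by rewrite ltrBrDl -ltrBrDr opprK h2 ltrBlDl -ltrBlDr h1.
have cx : rat_ball (\row_i q i, n) x.
  by split => // i j; rewrite !mxE ord1 /ball/= distrC hq.
exists (\row_i q i, n) => /=; split => // y cy.
apply: xeO; apply: le_ball (ltW ne) _ _.
rewrite mulr_natl mulr2n; apply: ball_triangle cy.
exact: ball_sym.
Qed.

Lemma open_rat_ball d (q : 'rV[rat]_d * nat) : open (rat_ball q).
Proof. exact: ball_open. Qed.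

Lemma countable_base_rV d : countable_base 'rV[R]_d.
Proof.
apply: (@countable_base_of ('rV[rat]_d * nat)%type _ (@rat_ball d)).
  exact: open_rat_ball.
exact: rat_ball_base.
Qed.

Lemma countable_base_R : countable_base R.
Proof.
apply: (@countable_base_of (rat * rat)%type _ (fun q => `]ratr q.1, ratr q.2[%classic : set R)).
  by move=> q; exact: interval_open.
move=> O x oO Ox.
have [e /= e0 xeO] : nbhs_ball x O by rewrite nbhs_ballE; exact: open_nbhs_nbhs.
have /rat_in_itvoo[p] : x - e < x by lra.
have /rat_in_itvoo[q] : x < x + e by lra.
rewrite !in_itv/= => /andP[h1 h2] /andP[h3 h4].
exists (p, q) => /=; split; first by rewrite in_itv/= h1 h4.
move=> y /=; rewrite in_itv/= => /andP[k1 k2]; apply: xeO.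
by rewrite /ball/= ltr_norml; apply/andP; split; lra.
Qed.

End second_countable.

Section borel.
Context {dX} {X : measurableType dX}.

(** Preimages of open sets only: for a second countable target this agrees with
    measurability for the Borel sets, and it composes with continuous maps between
    spaces that carry no measurable structure. *)
Definition bmeas (V : topologicalType) (f : X -> V) :=
  forall O, open O -> measurable (f @^-1` O).

Lemma bmeas_comp (V W : topologicalType) (f : X -> V) (g : V -> W) :
  bmeas f -> continuous g -> bmeas (g \o f).
Proof.
by move=> mf /continuousP cg O oO; rewrite comp_preimage; apply: mf; exact: cg.
Qed.

Lemma bmeas_pair (V W : topologicalType) (f : X -> V) (g : X -> W) :
  countable_base V -> countable_base W ->
  bmeas f -> bmeas g -> bmeas (fun x => (f x, g x)).
Proof.
move=> [B [oB hB]] [C [oC hC]] mf mg O oO.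
rewrite (_ : _ @^-1` _ = \bigcup_(ij : nat * nat)
    (if `[< B ij.1 `*` C ij.2 `<=` O >] then
      f @^-1` B ij.1 `&` g @^-1` C ij.2 else set0)).
  apply: countable_bigcupT_measurable => // -[i j] /=.
  by case: ifPn => _ //; apply: measurableI; [exact: mf|exact: mg].
apply/seteqP; split => [x /= Ox|x [[i j] _]]; last first.
  by case: asboolP => //= h [Bx Cx]; exact: (h (f x, g x)).
have [[P Q] /= [Px Qy] PQO] : nbhs (f x, g x) O by exact: open_nbhs_nbhs.
move: Px Qy; rewrite !nbhsE => -[P' [oP' P'x] P'P] [Q' [oQ' Q'y] Q'Q].
have [i [Bx BP]] := hB _ _ oP' P'x.
have [j [Cy CQ]] := hC _ _ oQ' Q'y.
exists (i, j) => //=; case: asboolP => // h; exfalso; apply: h => -[u v] /= [Bu Cv].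
by apply: PQO; split => /=; [exact/P'P/BP|exact/Q'Q/CQ].
Qed.

Context {R : realType}.

Lemma bmeas_measurable (f : X -> R) : bmeas f <-> measurable_fun setT f.
Proof.
split=> [mf|mf O oO].
  apply: (measurability _ (RGenOpens.measurableE R)).
  by move=> _ [_ [x [y ->]] <-]; rewrite setTI; apply: mf; exact: interval_open.
by rewrite -[X in measurable X]setTI; apply: mf => //; exact: open_measurable.
Qed.

Lemma bmeas_rV d (f : X -> 'rV[R]_d) : bmeas f <-> vmeasurable setT f.
Proof.
split=> [mf i|mf O oO].
  apply/bmeas_measurable; apply: (bmeas_comp mf (g := fun u : 'rV[R]_d => u 0 i)).
  exact: coord_continuous.
have oB (z : 'rV[R]_d) r : measurable (f @^-1` ball z r).
  have [r0|r0] := leP r 0.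
    rewrite (_ : _ @^-1` _ = set0)//; apply/seteqP; split => // x /= [].
    by rewrite ltNge r0.
  rewrite (_ : _ @^-1` _ = \bigcap_(i : 'I_d) ((fun x => f x 0 i) @^-1` ball (z 0 i) r)).
    apply: fin_bigcap_measurable => // i _.
    rewrite -[X in measurable X]setTI; apply: mf => //; apply: open_measurable.
    exact: ball_open.
  apply/seteqP; split => [x /= [_ h] i _ /=|x h]; first exact: h.
  by split => // i j; rewrite ord1; exact: h.
rewrite (_ : _ @^-1` _ = \bigcup_(q : 'rV[rat]_d * nat)
    (if `[< rat_ball (R := R) q `<=` O >] then f @^-1` rat_ball q else set0)).
  apply: countable_bigcupT_measurable => // qn.
  by case: ifPn => _ //; exact: oB.
apply/seteqP; split => [x /= Ox|x [qn _]]; last first.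
  by case: asboolP => //= h Bx; exact: h.
have [q [hq1 hq2]] := rat_ball_base oO Ox.
by exists q => //; case: asboolP.
Qed.

Lemma bmeas_torus d (f : X -> torus R d) : bmeas f <-> measurable_fun setT f.
Proof.
split=> [mf|mf O oO].
  apply: (@measurability _ _ _ _ setT f (@open (torus R d))) => //.
  by move=> _ [B oB <-]; rewrite setTI; exact: mf.
by rewrite -[X in measurable X]setTI; apply: mf => //; exact: sub_sigma_algebra.
Qed.

End borel.

Section centered.
Context {R : realType}.
Implicit Types r s : R.

Lemma centered_itv r : - 2^-1 <= centered r < 2^-1.
Proof.
rewrite /centered; have := floor_itv (r + 2^-1).
rewrite intrD1 => /andP[h1 h2]; apply/andP; split; lra.
Qed.

Lemma centered_int r : centered r - r \is a Num.int.
Proof. by rewrite /centered addrAC subrr add0r rpredN intr_int. Qed.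

Lemma centered_periodic r s : r - s \is a Num.int -> centered r = centered s.
Proof.
move=> h; rewrite /centered -{2}(subrK s r) (addrC (r - s)) addrAC floorDrz//.
rewrite rmorphD/= (intrEfloor (r - s)) in h *.
by rewrite (eqP h); lra.
Qed.

Lemma centered_id r : - 2^-1 <= r < 2^-1 -> centered r = r.
Proof.
move=> h; rewrite /centered (_ : Num.floor _ = 0) ?subr0//.
by apply: floor_def; rewrite add0r; apply/andP; split; lra.
Qed.

Lemma centered_min r s : r - s \is a Num.int -> `|centered r| <= `|s|.
Proof.
move=> /centered_periodic ->; have [h|h] := boolP (- 2^-1 <= s < 2^-1).
  by rewrite centered_id.
have /andP[h1 h2] := centered_itv s.
apply: (@le_trans _ _ 2^-1); first by rewrite ler_norml; apply/andP; split; lra.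
move: h; rewrite negb_and -!ltNge => /orP[h|]; last rewrite -leNgt => h.
  by rewrite ltr0_norm; lra.
by rewrite ger0_norm; lra.
Qed.

Lemma normr_centered r : `|centered r| <= `|r|.
Proof. by apply: centered_min; rewrite subrr rpred0. Qed.

Lemma normr_centered_half r : `|centered r| <= 2^-1.
Proof. by have /andP[h1 h2] := centered_itv r; rewrite ler_norml; apply/andP; split; lra. Qed.

Lemma measurable_centered : measurable_fun setT (centered : R -> R).
Proof.
apply: measurable_funB => //.
apply: (nondecreasing_measurable measurableT) => x y xy.
by rewrite ler_int le_floor// lerD2r.
Qed.

End centered.

Section torus.
Context {R : realType} {d : nat}.
Local Notation T := (torus R d).
Local Notation Rd := 'rV[R]_d.
Implicit Types (x y z : T) (u v w : Rd).

Lemma zcongr_tproj u v : zcongr u v -> tproj u = tproj v.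
Proof. by move=> /(@eqmodP _ (zcongr_equiv R d) u v). Qed.

Lemma tproj_zcongr u v : tproj u = tproj v -> zcongr u v.
Proof. by move=> h; apply/(@eqmodP _ (zcongr_equiv R d) u v). Qed.

Lemma tliftK x : tproj (tlift x) = x.
Proof. exact: reprK. Qed.

Lemma tlift_tproj u i : (tlift (tproj u) 0 i - u 0 i) \is a Num.int.
Proof. by have /tproj_zcongr/forallP := tliftK (tproj u); apply. Qed.

Lemma tproj_ex x : exists u, x = tproj u.
Proof. by exists (tlift x); rewrite tliftK. Qed.

Lemma tshift_tproj u v : tshift (tproj u) v = tproj (u + v).
Proof.
apply: zcongr_tproj; apply/forallP => i; rewrite !mxE.
by rewrite opprD addrACA subrr addr0 tlift_tproj.
Qed.

Lemma tshift0 x : tshift x 0 = x.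
Proof. by have [u ->] := tproj_ex x; rewrite tshift_tproj addr0. Qed.

Lemma tshiftD x u v : tshift (tshift x u) v = tshift x (u + v).
Proof. by have [w ->] := tproj_ex x; rewrite !tshift_tproj addrA. Qed.

Lemma tdisp_tproj u v i : tdisp (tproj u) (tproj v) 0 i = centered (v 0 i - u 0 i).
Proof.
rewrite mxE; apply: centered_periodic.
rewrite (_ : _ - _ = (tlift (tproj v) 0 i - v 0 i) - (tlift (tproj u) 0 i - u 0 i)); last ring.
by rewrite rpredB// tlift_tproj.
Qed.

Lemma tdispK x y : tshift x (tdisp x y) = y.
Proof.
have [u ->] := tproj_ex x; have [v ->] := tproj_ex y.
rewrite tshift_tproj; apply: zcongr_tproj; apply/forallP => i.
rewrite mxE tdisp_tproj (_ : _ + _ - _ = centered (v 0 i - u 0 i) - (v 0 i - u 0 i)); last ring.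
exact: centered_int.
Qed.

Lemma tdisp_tshift x u v : (forall i, - 2^-1 <= v 0 i - u 0 i < 2^-1) ->
  tdisp (tshift x u) (tshift x v) = v - u.
Proof.
move=> h; have [w ->] := tproj_ex x; apply/rowP => i; rewrite !tshift_tproj tdisp_tproj !mxE.
by rewrite opprD addrACA subrr add0r centered_id.
Qed.

Lemma le_enorm_coord u v : (forall i, `|u 0 i| <= `|v 0 i|) -> enorm u <= enorm v.
Proof.
move=> h; rewrite /enorm ler_sqrt ?dotv_ge0//; apply: ler_sum => i _.
by rewrite -!expr2 -(real_normK (num_real (u 0 i))) -(real_normK (num_real (v 0 i))) lerXn2r// nnegrE.
Qed.

Lemma tdist_ge0 x y : 0 <= tdist x y. Proof. exact: enorm_ge0. Qed.

Lemma tdist_tproj u v : tdist (tproj u) (tproj v) <= enorm (u - v).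
Proof.
by rewrite enormB; apply: le_enorm_coord => i; rewrite tdisp_tproj !mxE normr_centered.
Qed.

Lemma tdist_tshift x u v : tdist (tshift x u) (tshift x v) <= enorm (u - v).
Proof.
have [w ->] := tproj_ex x; rewrite !tshift_tproj (le_trans (tdist_tproj _ _))//.
by rewrite opprD addrACA subrr add0r.
Qed.

Lemma tdistxx x : tdist x x = 0.
Proof.
have [w ->] := tproj_ex x; apply/eqP; rewrite eq_le tdist_ge0 andbT.
by rewrite (le_trans (tdist_tproj _ _))// subrr enorm0.
Qed.

(** The displacement minimizes the Euclidean length among all vectors that carry x to y,
    because it does so coordinate by coordinate. *)
Lemma tdist_min x y u : tshift x u = y -> tdist x y <= enorm u.
Proof.
by move=> <-; rewrite -{1}(tshift0 x) (le_trans (tdist_tshift _ _ _))// sub0r enormN.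
Qed.

Lemma tdist_triangle y x z : tdist x z <= tdist x y + tdist y z.
Proof.
apply: le_trans (enormD _ _); apply: tdist_min.
by rewrite -tshiftD !tdispK.
Qed.

Lemma tdistC x y : tdist x y = tdist y x.
Proof.
have H (a b : T) : tdist a b <= tdist b a.
  rewrite -[leRHS]enormN; apply: tdist_min.
  by rewrite -{1}(tdispK b a) tshiftD subrr tshift0.
by apply/eqP; rewrite eq_le !H.
Qed.

Lemma tdist_le x y : tdist x y <= d%:R.
Proof.
rewrite (le_trans (enorm_le_sum _))// (@le_trans _ _ (\sum_(i < d) 1))//.
  apply: ler_sum => i _; rewrite mxE (le_trans (normr_centered_half _))//; lra.
by rewrite sumr_const card_ord.
Qed.

Lemma continuous_tproj : continuous (tproj : Rd -> T).
Proof. exact: pi_continuous. Qed.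

Lemma tdist_ball (O : set T) x : open O -> O x ->
  exists2 r : R, 0 < r & forall y, tdist x y < r -> O y.
Proof.
move=> oO Ox.
have oO' : open ((fun u : Rd => tshift x u) @^-1` O).
  have -> : (fun u : Rd => tshift x u) = tproj \o (fun u => tlift x + u) by [].
  rewrite comp_preimage; apply: open_comp; last first.
    apply: open_comp => //; move=> ? _; exact: continuous_tproj.
  by move=> u _; apply: (@cvgD _ _ _ (nbhs u)); [exact: cvg_cst|exact: cvg_id].
have [e /= e0 h] : nbhs_ball (0 : Rd) ((fun u : Rd => tshift x u) @^-1` O).
  rewrite nbhs_ballE; apply: open_nbhs_nbhs; split => //=.
  by rewrite tshift0.
exists e => // y xy; rewrite -(tdispK x y); apply: h.
rewrite -ball_normE /ball_/= sub0r normrN.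
by rewrite (le_lt_trans (le_norm_enorm _)).
Qed.

(** The projection is open, so the images of rational balls form a base. *)
Lemma countable_base_torus : countable_base T.
Proof.
apply: (@countable_base_of ('rV[rat]_d * nat)%type _ (fun q => tproj @` rat_ball q)).
  move=> q; rewrite /open/= /quotient_open.
  have -> : \pi_T%qT @^-1` (tproj @` rat_ball q) =
      \bigcup_(k : 'rV[int]_d) ((fun u : Rd => u + map_mx intr k) @^-1` rat_ball q).
    apply/seteqP; split => [u [v qv] /tproj_zcongr/forallP vu|u [k _ /= qu]].
      exists (\row_i Num.floor (v 0 i - u 0 i)) => //=.
      rewrite (_ : _ + _ = v)//; apply/rowP => i; rewrite !mxE.
      have := vu i; rewrite intrEfloor => /eqP ->; ring.
    exists (u + map_mx intr k) => //; apply: zcongr_tproj; apply/forallP => i.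
    by rewrite !mxE addrAC subrr add0r intr_int.
  apply: bigcup_open => k _; apply: open_comp; last exact: open_rat_ball.
  by move=> u _; apply: (@cvgD _ _ _ (nbhs u)); [exact: cvg_id|exact: cvg_cst].
move=> O x oO; have [u ->] := tproj_ex x => Ou.
have oO' : open (tproj @^-1` O).
  by apply: open_comp => // v _; exact: continuous_tproj.
have [q [qu qO]] := rat_ball_base oO' Ou.
by exists q; split; [exists u|move=> _ [v /qO Ov <-]].
Qed.

End torus.
Section torus_meas.
Context {R : realType} {d : nat}.
Local Notation T := (torus R d).
Local Notation Rd := 'rV[R]_d.

(** A Borel section of the projection, unlike [tlift], whose values are arbitrary
    representatives. *)
Definition tsec (x : T) : Rd := \row_i centered (tlift x 0 i).

Lemma tsecK (x : T) : tproj (tsec x) = x.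
Proof.
have [u ->] := tproj_ex x; apply: zcongr_tproj; apply/forallP => i; rewrite mxE.
have -> : centered (tlift (tproj u) 0 i) = centered (u 0 i).
  by apply: centered_periodic; exact: tlift_tproj.
exact: centered_int.
Qed.

Lemma tshiftE (x : T) (u : Rd) : tshift x u = tproj (tsec x + u).
Proof. by rewrite -{1}(tsecK x) tshift_tproj. Qed.

Lemma measurable_tsec : vmeasurable setT tsec.
Proof.
move=> i; apply: (measurability _ (RGenOInfty.measurableE R)).
move=> _ [_ [a ->] <-]; rewrite setTI.
have [a1|a1] := ltP a (- 2^-1).
  rewrite (_ : _ @^-1` _ = setT)//; apply/seteqP; split => // x _ /=.
  rewrite in_itv/= andbT mxE; have /andP[h _] := centered_itv (tlift x 0 i); lra.
apply: sub_sigma_algebra.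
rewrite /open/= /quotient_open.
have -> : \pi_T%qT @^-1` ((fun x => tsec x 0 i) @^-1` `]a, +oo[) =
   \bigcup_(k : int) ((fun u : Rd => u 0 i) @^-1` `]a + k%:~R, 2^-1 + k%:~R[).
  apply/seteqP; split => [u|u [k _]] /=.
    rewrite mxE (centered_periodic (tlift_tproj u i)) !in_itv/= andbT => h.
    exists (Num.floor (u 0 i + 2^-1)) => //=; rewrite in_itv/=.
    have := centered_itv (u 0 i); rewrite /centered in h * => /andP[h1 h2].
    by apply/andP; split; lra.
  rewrite mxE (centered_periodic (tlift_tproj u i)) !in_itv/= andbT => /andP[h1 h2].
  have -> : centered (u 0 i) = u 0 i - k%:~R.
    rewrite -(@centered_id _ (_ - _)); last by apply/andP; split; lra.
    by apply: centered_periodic; rewrite opprB addrC subrK intr_int.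
  lra.
apply: bigcup_open => k _; apply: open_comp; last exact: interval_open.
by move=> u _; exact: coord_continuous.
Qed.

Section meas.
Context {dX} {X : measurableType dX}.

Lemma vmeasurable_tsec (f : X -> T) : measurable_fun setT f ->
  vmeasurable setT (fun x => tsec (f x)).
Proof. by move=> mf i; exact: (measurableT_comp (measurable_tsec i) mf). Qed.

Lemma vmeasurableD (f g : X -> Rd) : vmeasurable setT f -> vmeasurable setT g ->
  vmeasurable setT (fun x => f x + g x).
Proof.
move=> mf mg i; rewrite (_ : (fun x => _) = (fun x => f x 0 i + g x 0 i)).
  exact: measurable_funD.
by apply/funext => x; rewrite mxE.
Qed.

Lemma measurable_tproj (u : X -> Rd) : vmeasurable setT u ->
  measurable_fun setT (fun x => tproj (u x)).
Proof.
by move=> /bmeas_rV mu; apply/bmeas_torus/(bmeas_comp mu); exact: continuous_tproj.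
Qed.

Lemma measurable_tshift (f : X -> T) (u : X -> Rd) :
  measurable_fun setT f -> vmeasurable setT u ->
  measurable_fun setT (fun x => tshift (f x) (u x)).
Proof.
move=> mf mu; under eq_fun do rewrite tshiftE.
by apply: measurable_tproj; apply: vmeasurableD => //; exact: vmeasurable_tsec.
Qed.

Lemma vmeasurable_tdisp (f g : X -> T) :
  measurable_fun setT f -> measurable_fun setT g ->
  vmeasurable setT (fun x => tdisp (f x) (g x)).
Proof.
move=> mf mg i.
rewrite (_ : (fun x => _) = (fun x => centered (tsec (g x) 0 i - tsec (f x) 0 i))).
  apply: (measurableT_comp measurable_centered); apply: measurable_funB;
    exact: vmeasurable_tsec.
by apply/funext => x; rewrite -{1}(tsecK (f x)) -{1}(tsecK (g x)) tdisp_tproj.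
Qed.

Lemma measurable_dotv (f g : X -> Rd) : vmeasurable setT f -> vmeasurable setT g ->
  measurable_fun setT (fun x => dotv (f x) (g x)).
Proof. by move=> mf mg; apply: measurable_sum => i; exact: measurable_funM. Qed.

Lemma measurable_enorm (f : X -> Rd) : vmeasurable setT f ->
  measurable_fun setT (fun x => enorm (f x)).
Proof.
by move=> /bmeas_rV mf; apply/bmeas_measurable/(bmeas_comp mf); exact: continuous_enorm.
Qed.

Lemma measurable_tdist (f g : X -> T) :
  measurable_fun setT f -> measurable_fun setT g ->
  measurable_fun setT (fun x => tdist (f x) (g x)).
Proof. by move=> mf mg; apply: measurable_enorm; exact: vmeasurable_tdisp. Qed.

End meas.

Lemma measurable_continuous_torus2 (f : T * T -> R) :
  continuous f -> measurable_fun setT f.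
Proof.
move=> cf; apply/bmeas_measurable.
have h : bmeas (fun z : T * T => (z.1, z.2)).
  apply: bmeas_pair; [exact: countable_base_torus|exact: countable_base_torus| |].
    by apply/bmeas_torus; exact: measurable_fst.
  by apply/bmeas_torus; exact: measurable_snd.
by have := bmeas_comp h cf; congr bmeas; apply/funext => -[].
Qed.

End torus_meas.

(** * Probability measures and the Wasserstein distance *)

Section Rintegral_bounded.
Context {dX} {X : measurableType dX} {R : realType}.
Variable mu : {measure set X -> \bar R}.
Implicit Types (D : set X) (f g : X -> R) (M : R).

Lemma integrable_bounded D f M : measurable D -> (mu D < +oo)%E ->
  measurable_fun D f -> (forall x, D x -> `|f x| <= M) ->
  mu.-integrable D (EFin \o f).
Proof.
move=> mD muD mf hM; apply: measurable_bounded_integrable => //.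
exists M; split; first exact: num_real.
by move=> N MN x Dx; exact: le_trans (hM _ Dx) (ltW MN).
Qed.

Lemma normr_Rintegral_le D f M : measurable D -> (mu D < +oo)%E ->
  measurable_fun D f -> (forall x, D x -> `|f x| <= M) ->
  `|\int[mu]_(x in D) f x| <= M * fine (mu D).
Proof.
move=> mD muD mf hM; have fi := integrable_bounded mD muD mf hM.
rewrite (le_trans (le_normr_Rintegral mD fi))// -Rintegral_cst//.
apply: le_Rintegral => //.
  by apply: (@integrable_bounded _ _ M) => //; [exact: measurableT_comp|move=> x Dx; rewrite normr_id hM].
by apply: (@integrable_bounded _ _ `|M|) => //; exact: measurable_cst.
Qed.

End Rintegral_bounded.

Section Rintegral_transfer.
Context {dX} {X : measurableType dX} {dY} {Y : measurableType dY} {R : realType}.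

Lemma Rintegral_distribution (mu : probability X R) (phi : {mfun X >-> Y})
  (f : Y -> R) : measurable_fun setT f ->
  \int[distribution mu phi]_y f y = \int[mu]_x f (phi x).
Proof.
move=> /measurable_EFinP mf.
have hp : (\int[distribution mu phi]_y (EFin \o f)^\+ y = \int[mu]_x (fun x => (f (phi x))%:E)^\+ x)%E.
  rewrite ge0_integral_distribution//; last exact: measurable_funepos.
  by apply: eq_integral => x _; rewrite /= !funeposE.
have hn : (\int[distribution mu phi]_y (EFin \o f)^\- y = \int[mu]_x (fun x => (f (phi x))%:E)^\- x)%E.
  rewrite ge0_integral_distribution//; last exact: measurable_funeneg.
  by apply: eq_integral => x _; rewrite /= !funenegE.
by rewrite /Rintegral; congr fine; rewrite integralE hp hn -integralE.
Qed.

Lemma measurable_Rintegral_param (m : {sigma_finite_measure set Y -> \bar R})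
  (f : X * Y -> R) : measurable_fun setT f ->
  measurable_fun setT (fun x => \int[m]_y f (x, y)).
Proof.
move=> /measurable_EFinP mf; apply: (measurableT_comp (@fine_measurable R setT _)) => //.
rewrite (_ : (fun x => _) = (fun x => \int[m]_y (EFin \o f)^\+ (x, y) - \int[m]_y (EFin \o f)^\- (x, y))%E); last first.
  by apply/funext => x; rewrite integralE; congr (_ - _)%E; apply: eq_integral => y _;
    rewrite ?funeposE ?funenegE.
apply: emeasurable_funB.
  apply: (measurable_fun_fubini_tonelli_F (m2 := m) (EFin \o f)^\+%E) => //.
  exact: measurable_funepos.
apply: (measurable_fun_fubini_tonelli_F (m2 := m) (EFin \o f)^\-%E) => //.
exact: measurable_funeneg.
Qed.

Lemma measurable_sect1 (f : X * Y -> R) x : measurable_fun setT f ->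
  measurable_fun setT (fun y => f (x, y)).
Proof. by move=> mf; apply: (measurableT_comp mf); exact: pair1_measurable. Qed.

Lemma measurable_sect2 (f : X * Y -> R) y : measurable_fun setT f ->
  measurable_fun setT (fun x => f (x, y)).
Proof. by move=> mf; apply: (measurableT_comp mf); exact: pair2_measurable. Qed.

End Rintegral_transfer.

Section same_meas.
Context {dX} {X : measurableType dX} {R : realType}.

Lemma same_meas_Rintegral (m1 m2 : {measure set X -> \bar R}) D (f : X -> R) :
  same_meas m1 m2 -> \int[m1]_(x in D) f x = \int[m2]_(x in D) f x.
Proof.
by move=> h; rewrite /Rintegral; congr fine; apply: eq_measure_integral => A mA _; exact: h.
Qed.

End same_meas.

Section push.
Context {dX} {X : measurableType dX} {dY} {Y : measurableType dY} {R : realType}.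

Definition push (mu : probability X R) (f : X -> Y) (mf : measurable_fun setT f)
  : probability Y R := distribution mu (mfun_Sub (mem_set mf)).

Lemma pushE (mu : probability X R) f (mf : measurable_fun setT f) A :
  push mu mf A = mu (f @^-1` A).
Proof. by []. Qed.

Lemma Rintegral_push (mu : probability X R) f (mf : measurable_fun setT f) (g : Y -> R) :
  measurable_fun setT g -> \int[push mu mf]_y g y = \int[mu]_x g (f x).
Proof. by move=> mg; apply: Rintegral_distribution. Qed.

End push.

Section wasserstein.
Context {R : realType} {d : nat}.
Local Notation T := (torus R d).
Local Notation P := (prob_torus R d).
Implicit Types (mu nu : P) (pi : prob_torus2 R d).

Lemma measurable_tdist12 : measurable_fun setT (fun z : T * T => tdist z.1 z.2).
Proof. by apply: measurable_tdist; [exact: measurable_fst|exact: measurable_snd]. Qed.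

Lemma prob_lty {dX} {X : measurableType dX} (m : probability X R) A :
  measurable A -> (m A < +oo)%E.
Proof. by move=> mA; rewrite (le_lt_trans (probability_le1 _ mA))// ltry. Qed.

Lemma prob_integrable {dX} {X : measurableType dX} (m : probability X R) (f : X -> R) M :
  measurable_fun setT f -> (forall x, `|f x| <= M) -> m.-integrable setT (EFin \o f).
Proof.
by move=> mf hM; apply: (@integrable_bounded _ _ _ _ _ _ M) => //; exact: prob_lty.
Qed.

Lemma prob_Rintegral_le {dX} {X : measurableType dX} (m : probability X R) (f : X -> R) M :
  measurable_fun setT f -> (forall x, `|f x| <= M) -> `|\int[m]_x f x| <= M.
Proof.
move=> mf hM; rewrite -[leRHS]mulr1.
have -> : 1 = fine (m setT) by rewrite probability_setT.
by apply: normr_Rintegral_le => //; exact: prob_lty.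
Qed.

Lemma transport_cost_le pi c : (forall z : T * T, tdist z.1 z.2 <= c) -> transport_cost pi <= c ^+ 2.
Proof.
move=> h; rewrite (le_trans (ler_norm _))//; apply: prob_Rintegral_le.
  by apply: measurable_funX; exact: measurable_tdist12.
move=> z; rewrite ger0_norm ?exprn_ge0 ?tdist_ge0//.
by rewrite lerXn2r ?nnegrE ?tdist_ge0// (le_trans (tdist_ge0 z.1 z.2)).
Qed.

Lemma transport_cost_ge0 pi : 0 <= transport_cost pi.
Proof. by apply: Rintegral_ge0 => z _; rewrite exprn_ge0// tdist_ge0. Qed.

Lemma W2_ge0 mu nu : 0 <= W2 mu nu. Proof. exact: sqrtr_ge0. Qed.

Lemma transport_cost_lbound mu nu :
  lbound [set transport_cost pi | pi in couplings mu nu] 0.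
Proof. by move=> _ [pi _ <-]; exact: transport_cost_ge0. Qed.

Lemma W2_le_coupling mu nu pi c : couplings mu nu pi -> 0 <= c ->
  transport_cost pi <= c ^+ 2 -> W2 mu nu <= c.
Proof.
move=> hpi c0 h; rewrite /W2.
rewrite -[leRHS](ger0_norm c0) -sqrtr_sqr ler_sqrt ?exprn_ge0//.
apply: le_trans h; apply: ge_inf; last by exists pi.
by exists 0; exact: transport_cost_lbound.
Qed.

Lemma W2_le_dim mu nu : W2 mu nu <= d%:R.
Proof.
have [h|/set0P[pi hpi]] := eqVneq (couplings mu nu) set0.
  by rewrite /W2 h image_set0 inf0 sqrtr0.
apply: (W2_le_coupling hpi) => //; apply: transport_cost_le => z; exact: tdist_le.
Qed.

Lemma W2_same_meas mu nu mu' nu' : same_meas mu mu' -> same_meas nu nu' ->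
  W2 mu nu = W2 mu' nu'.
Proof.
move=> hm hn; rewrite /W2 (_ : couplings mu nu = couplings mu' nu')//.
apply/seteqP; split => pi [h1 h2]; split => A mA.
- by rewrite h1// hm.
- by rewrite h2// hn.
- by rewrite h1// hm.
- by rewrite h2// hn.
Qed.

Section maps.
Context {dX} {X : measurableType dX}.
Variables (m : probability X R).

Definition push2 (f g : X -> T) (mf : measurable_fun setT f) (mg : measurable_fun setT g) :=
  push m (measurable_fun_pair mf mg).

Lemma push2_coupling (f g : X -> T) mf mg : couplings (push m mf) (push m mg) (@push2 f g mf mg).
Proof. by split. Qed.

Lemma push2_cost (f g : X -> T) mf mg :
  transport_cost (@push2 f g mf mg) = \int[m]_x (tdist (f x) (g x) ^+ 2).
Proof.
by rewrite /transport_cost /push2 Rintegral_push//; apply: measurable_funX; exact: measurable_tdist12.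
Qed.

Lemma W2_push (f g : X -> T) (mf : measurable_fun setT f) (mg : measurable_fun setT g) c :
  0 <= c -> (forall x, tdist (f x) (g x) <= c) -> W2 (push m mf) (push m mg) <= c.
Proof.
move=> c0 h; apply: (W2_le_coupling (push2_coupling mf mg)) => //.
rewrite push2_cost (le_trans (ler_norm _))//; apply: prob_Rintegral_le.
  by apply: measurable_funX; exact: measurable_tdist.
by move=> x; rewrite ger0_norm ?exprn_ge0 ?tdist_ge0// lerXn2r ?nnegrE ?tdist_ge0.
Qed.

End maps.

Lemma W2_same0 mu nu : same_meas mu nu -> W2 mu nu = 0.
Proof.
move=> h; apply/eqP; rewrite eq_le W2_ge0 andbT.
have hid : same_meas mu (push mu (@measurable_id _ T setT)) by [].
rewrite (W2_same_meas hid (_ : same_meas nu (push mu (@measurable_id _ T setT)))).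
  by apply: W2_push => // x; rewrite tdistxx.
by move=> A mA; rewrite -h.
Qed.

Lemma coupling_ex mu nu : couplings mu nu !=set0.
Proof.
pose pi : prob_torus2 R d := (mu \x nu)%E.
exists pi; split => A mA.
  have -> : pr1_push pi A = pi (A `*` setT).
    by congr (pi _); apply/seteqP; split => -[x y] //= [].
  apply: etrans (product_measure1E mu nu mA measurableT) _.
  by rewrite [X in (_ * X)%E](_ : _ = 1%E) ?mule1//; exact: probability_setT.
have -> : pr2_push pi A = pi (setT `*` A).
  by congr (pi _); apply/seteqP; split => -[x y] //= [].
apply: etrans (product_measure1E mu nu measurableT mA) _.
by rewrite [X in (X * _)%E](_ : _ = 1%E) ?mul1e//; exact: probability_setT.
Qed.

(** The easy half of the duality for the transport distance: integrate the Lipschitz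
    bound against an almost optimal plan, and use t <= t^2 / (2 r) + r / 2 in place of the
    Cauchy-Schwarz inequality. *)
Lemma W2_lipschitz mu nu r (f : T -> R) K : W2 mu nu < r ->
  measurable_fun setT f -> (forall x y, `|f x - f y| <= K * tdist x y) -> 0 <= K ->
  `|\int[mu]_x f x - \int[nu]_x f x| <= K * r.
Proof.
move=> hr mf fK K0.
have r0 : 0 < r by rewrite (le_lt_trans (W2_ge0 mu nu)).
have [pi [h1 h2] hpi] : exists2 pi, couplings mu nu pi & transport_cost pi < r ^+ 2.
  set S := [set transport_cost pi | pi in couplings mu nu].
  have S0 : S !=set0 by have [pi hpi] := coupling_ex mu nu; exists (transport_cost pi), pi.
  have hS : has_inf S by split => //; exists 0; exact: transport_cost_lbound.
  have hlt : inf S < r ^+ 2.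
    move: hr; rewrite /W2 -/S -[X in _ < X](ger0_norm (ltW r0)) -sqrtr_sqr.
    by rewrite ltr_sqrt// exprn_gt0.
  have [|c [pi hpi <-] hc] := @inf_adherent R S (r ^+ 2 - inf S) _ hS.
    by rewrite subr_gt0.
  by exists pi => //; rewrite addrC subrK in hc.
have [B hB] : exists B : R, forall x, `|f x| <= B.
  have x0 : T := tproj 0.
  exists (`|f x0| + K * d%:R) => x; rewrite -(subrK (f x0) (f x)) addrC (le_trans (ler_normD _ _))//.
  by rewrite lerD2l (le_trans (fK _ _))// ler_wpM2l// tdist_le.
have mf1 : measurable_fun setT (fun z : T * T => f z.1).
  by apply: (measurableT_comp mf); exact: measurable_fst.
have mf2 : measurable_fun setT (fun z : T * T => f z.2).
  by apply: (measurableT_comp mf); exact: measurable_snd.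
have e1 : \int[mu]_x f x = \int[pi]_z f z.1.
  by rewrite -(same_meas_Rintegral _ _ h1) Rintegral_distribution.
have e2 : \int[nu]_x f x = \int[pi]_z f z.2.
  by rewrite -(same_meas_Rintegral _ _ h2) Rintegral_distribution.
have i1 := prob_integrable pi mf1 (fun z => hB z.1).
have i2 := prob_integrable pi mf2 (fun z => hB z.2).
rewrite e1 e2 -RintegralB// (le_trans (le_normr_Rintegral _ _))//.
  apply: (@prob_integrable _ _ _ _ (B + B)); first exact: measurable_funB.
  by move=> z; rewrite (le_trans (ler_normB _ _))// lerD.
have mc : measurable_fun setT (fun z : T * T => tdist z.1 z.2 ^+ 2).
  by apply: measurable_funX; exact: measurable_tdist12.
have ic : pi.-integrable setT (EFin \o (fun z : T * T => tdist z.1 z.2 ^+ 2)).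
  apply: (@prob_integrable _ _ _ _ (d%:R ^+ 2)) => // z.
  by rewrite ger0_norm ?exprn_ge0 ?tdist_ge0// lerXn2r ?nnegrE ?tdist_ge0// tdist_le.
have k0 : 0 <= K / (2 * r) by rewrite divr_ge0// mulr_ge0// ltW.
have ie : pi.-integrable setT (EFin \o (fun z : T * T => K / (2 * r) * tdist z.1 z.2 ^+ 2)).
  apply: (@prob_integrable _ _ _ _ (K / (2 * r) * d%:R ^+ 2)); first exact: measurable_funM.
  move=> z; have t0 : 0 <= tdist z.1 z.2 ^+ 2 by rewrite exprn_ge0// tdist_ge0.
  rewrite (ger0_norm (mulr_ge0 k0 t0)) (ler_wpM2l k0)//.
  by rewrite lerXn2r ?nnegrE ?tdist_ge0// tdist_le.
have ib : pi.-integrable setT (EFin \o (fun z : T * T => K * r / 2)).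
  exact: (@prob_integrable _ _ _ _ `|K * r / 2|).
apply: (@le_trans _ _ (\int[pi]_z (K / (2 * r) * tdist z.1 z.2 ^+ 2 + K * r / 2))).
  apply: le_Rintegral => //.
  - apply: (@prob_integrable _ _ _ _ (B + B)).
      by apply: measurableT_comp => //; exact: measurable_funB.
    by move=> z; rewrite normr_id (le_trans (ler_normB _ _))// lerD.
  - have := integrableD measurableT ie ib; apply: eq_integrable => // z _.
  - move=> z _; rewrite (le_trans (fK _ _))// -mulrA -mulrA -mulrDr ler_wpM2l//.
    set t := tdist _ _; rewrite -(ler_pM2l (_ : 0 < 2 * r)) ?mulr_gt0//.
    rewrite mulrDr mulrA mulfV ?mul1r ?mulf_neq0 ?gt_eqF//.
    by have := sqr_ge0 (t - r); nra.
rewrite RintegralD// RintegralZl// Rintegral_cst//.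
rewrite [fine _](_ : _ = 1) ?mulr1; last by rewrite [X in fine X](_ : _ = 1%E)//; exact: probability_setT.
have : K / (2 * r) * transport_cost pi <= K / (2 * r) * r ^+ 2 by rewrite ler_wpM2l// ltW.
rewrite {1}/transport_cost => h.
apply: le_trans (lerD h (lexx _)) _.
have -> : K / (2 * r) * r ^+ 2 = K * r / 2 by field; rewrite gt_eqF.
by rewrite -mulrDl; lra.
Qed.

End wasserstein.

(** * Integrals over intervals and integrable Lipschitz constants *)

Section dominated.
Context {dX} {X : measurableType dX} {R : realType}.
Variable mu : {measure set X -> \bar R}.

Lemma Rdominated_cvg (D : set X) (f_ : nat -> X -> R) (f g : X -> R) :
  measurable D -> (forall n, measurable_fun D (f_ n)) ->
  measurable_fun D f ->
  (forall x, D x -> f_ n x @[n --> \oo] --> f x) ->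
  mu.-integrable D (EFin \o g) ->
  (forall n x, D x -> `|f_ n x| <= g x) ->
  \int[mu]_(x in D) f_ n x @[n --> \oo] --> \int[mu]_(x in D) f x.
Proof.
move=> mD mf_ mf hf ig hg.
have h := @dominated_convergence _ _ _ mu D mD (fun n => EFin \o f_ n) (EFin \o f) (EFin \o g).
have h1 : \forall x \ae mu, D x -> (EFin \o f_ n) x @[n --> \oo] --> (EFin \o f) x.
  by apply: aeW => x Dx; apply: cvg_EFin; [near=> n|exact: hf].
have h2 : \forall x \ae mu, forall n, D x -> (`|(EFin \o f_ n) x| <= (EFin \o g) x)%E.
  by apply: aeW => x n Dx; rewrite lee_fin hg.
have [ifn _ hc] := h (fun n => (measurable_EFinP _ _).2 (mf_ n)) ((measurable_EFinP _ _).2 mf) h1 ig h2.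
apply: fine_cvg; rewrite fineK; first exact: hc.
exact: integrable_fin_num.
Unshelve. all: by end_near. Qed.

Lemma integrable_le (D : set X) (f g : X -> R) : measurable D -> measurable_fun D f ->
  (forall x, D x -> `|f x| <= g x) -> mu.-integrable D (EFin \o g) ->
  mu.-integrable D (EFin \o f).
Proof.
move=> mD mf fg; apply: le_integrable => //; first exact/measurable_EFinP.
by move=> x Dx; rewrite lee_fin (le_trans (fg _ Dx))// ler_norm.
Qed.

End dominated.

Section intervals.
Context {R : realType}.
Local Notation leb := (@lebesgue_measure R).
Implicit Types (a b s t M : R) (f g h : R -> R).

Lemma leb_itv_lty a b : (leb `[a, b]%classic < +oo)%E.
Proof.
rewrite lebesgue_measure_itv/=; case: ifP => _; last exact: ltry.
by rewrite -EFinB ltry.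
Qed.

Lemma fine_leb_itv a b : a <= b -> fine (leb `[a, b]%classic) = b - a.
Proof.
move=> ab; rewrite lebesgue_measure_itv/= lte_fin; case: ltP => //= ba.
by apply/esym/eqP; rewrite subr_eq0 eq_le ba ab.
Qed.

Lemma itv_integrable a b f M : measurable_fun setT f ->
  (forall t, t \in `[a, b] -> `|f t| <= M) -> leb.-integrable `[a, b] (EFin \o f).
Proof.
move=> mf hM; apply: (integrable_bounded (M := M)) => //; first exact: leb_itv_lty.
  exact: measurable_funTS.
Qed.

Lemma itv_integrable_le a b f g : measurable_fun `[a, b] f ->
  (forall t, t \in `[a, b] -> `|f t| <= g t) -> leb.-integrable `[a, b] (EFin \o g) ->
  leb.-integrable `[a, b] (EFin \o f).
Proof. by move=> mf fg; apply: integrable_le => //; exact: mf. Qed.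

Lemma itv_integrableM a b f h M : leb.-integrable `[a, b] (EFin \o f) ->
  measurable_fun `[a, b] h -> (forall t, t \in `[a, b] -> `|h t| <= M) ->
  leb.-integrable `[a, b] (EFin \o (fun t => f t * h t)).
Proof.
move=> fi mh hM.
have bh : [bounded h x | x in `[a, b]%classic].
  exists M; split; first exact: num_real.
  by move=> N MN t tab; exact: le_trans (hM _ tab) (ltW MN).
exact: (@integrableMl _ _ _ leb `[a, b]%classic (measurable_itv _) (EFin \o f) h fi mh bh).
Qed.

Lemma itv_dominated_cvg a b (f_ : nat -> R -> R) f g :
  (forall n, measurable_fun `[a, b] (f_ n)) -> measurable_fun `[a, b] f ->
  (forall t, t \in `[a, b] -> f_ n t @[n --> \oo] --> f t) ->
  leb.-integrable `[a, b] (EFin \o g) ->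
  (forall n t, t \in `[a, b] -> `|f_ n t| <= g t) ->
  \int[leb]_(t in `[a, b]) f_ n t @[n --> \oo] --> \int[leb]_(t in `[a, b]) f t.
Proof.
move=> mf_ mf hf ig hg; exact: (@Rdominated_cvg _ _ _ leb _ f_ f g (measurable_itv _) mf_ mf hf ig hg).
Qed.

Lemma Rintegral_itv_split a s t f : a <= s -> s <= t ->
  leb.-integrable `[a, t] (EFin \o f) ->
  \int[leb]_(x in `[a, t]) f x = \int[leb]_(x in `[a, s]) f x + \int[leb]_(x in `[s, t]) f x.
Proof.
move=> as_ st fi; have := @Rintegral_itvB R f (BLeft a) (BRight t) s fi.
rewrite !bnd_simp => /(_ as_ st) h; rewrite -(subrK (\int[leb]_(x in `[a, s]) f x) (\int[leb]_(x in `[a, t]) f x)).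
rewrite h addrC Rintegral_itv_obnd_cbnd//; apply: integrableS fi => //.
by apply: subset_itvr; rewrite bnd_simp.
Qed.

Lemma le_Rintegral_itv a b f g : leb.-integrable `[a, b] (EFin \o f) ->
  leb.-integrable `[a, b] (EFin \o g) ->
  (forall t, t \in `[a, b] -> f t <= g t) ->
  \int[leb]_(t in `[a, b]) f t <= \int[leb]_(t in `[a, b]) g t.
Proof. by move=> fi gi h; apply: le_Rintegral. Qed.

Lemma integrable_subitv a b s t f : a <= s -> t <= b ->
  leb.-integrable `[a, b] (EFin \o f) -> leb.-integrable `[s, t] (EFin \o f).
Proof. by move=> as_ tb; apply: integrableS => //; exact: subset_itvScc. Qed.

Lemma integral_exp_le a t l : 0 < l -> a <= t ->
  \int[leb]_(s in `[a, t]) expR (l * (s - a)) <= expR (l * (t - a)) / l.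
Proof.
move=> l0; rewrite le_eqVlt => /predU1P[<-|at_].
  by rewrite set_itv1 Rintegral_set1 divr_ge0 ?expR_ge0// ltW.
pose F s := expR (l * (s - a)) / l.
have dF s : is_derive (s : R) 1 F (expR (l * (s - a))).
  apply: is_derive_eq.
  by rewrite /GRing.scale/=; field; rewrite gt_eqF.
have cF : continuous F.
  by move=> s; apply: differentiable_continuous; apply/derivable1_diffP; case: (dF s).
rewrite /Rintegral (@continuous_FTC2 _ _ F)//.
- by rewrite /= lerBlDr lerDl divr_ge0 ?expR_ge0// ltW.
- apply: continuous_subspaceT => s.
  apply: continuous_comp; last exact: continuous_expR.
  by apply: cvgM; [exact: cvg_cst|apply: cvgB; [exact: cvg_id|exact: cvg_cst]].
- split; first by move=> s _; case: (dF s).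
    by apply: cvg_at_right_filter; exact: cF.
  by apply: cvg_at_left_filter; exact: cF.
- by move=> s _; rewrite derive1E; apply: derive_val.
Qed.

(** Truncate k at a level n for which the excess has integral at most 1/16. The bounded part
    is absorbed by an exponential with a large rate, the excess by its small mass. *)
Lemma weight_ex a b (k : R -> R) : (forall t, t \in `[a, b] -> 0 <= k t) ->
  leb.-integrable `[a, b] (EFin \o k) ->
  exists E : R -> R, [/\ continuous E, (forall t, a <= t -> 1 <= E t),
    (forall s t, s <= t -> E s <= E t) &
    forall t, t \in `[a, b] ->
      8 * \int[leb]_(s in `[a, t]) (k s * E s) <= E t].
Proof.
move=> k0 ki.
have mk : measurable_fun `[a, b] k by apply/measurable_EFinP; exact: measurable_int ki.
pose kn (n : nat) t := k t - Num.min (k t) n%:R.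
have mkm n : measurable_fun `[a, b] (fun t => Num.min (k t) n%:R).
  by apply: measurable_minr => //; exact: measurable_cst.
have mkn n : measurable_fun `[a, b] (kn n) by apply: measurable_funB => //; exact: mkm.
have kn0 n t : t \in `[a, b] -> 0 <= kn n t.
  by move=> _; rewrite subr_ge0 ge_min lexx.
have knk n t : t \in `[a, b] -> kn n t <= k t.
  by move=> tab; rewrite gerBl le_min k0//=.
have ikn n : leb.-integrable `[a, b] (EFin \o kn n).
  by apply: (itv_integrable_le (mkn n) _ ki) => t tab; rewrite ger0_norm ?kn0 ?knk.
have : \int[leb]_(t in `[a, b]) kn n t @[n --> \oo] --> \int[leb]_(t in `[a, b]) (0 : R).
  apply: (@itv_dominated_cvg _ _ _ _ k) => //.
    move=> t tab; apply: cvg_near_cst; near=> n.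
    rewrite /kn (_ : Num.min _ _ = k t) ?subrr//; apply/min_idPl.
    near: n; exact: nbhs_infty_ger.
  by move=> n t tab; rewrite ger0_norm ?kn0 ?knk.
rewrite Rintegral_cst// mul0r => /(@cvgrPdist_lt _ R^o) /(_ (16^-1)).
have h16 : 0 < 16^-1 :> R by rewrite invr_gt0.
move=> /(_ h16)[n _ /(_ n (leqnn n)) /=]; rewrite sub0r normrN => hn.
pose l : R := 16 * n.+1%:R.
have l0 : 0 < l by rewrite mulr_gt0.
pose E t := expR (l * (t - a)).
have cE : continuous E.
  move=> s; apply: continuous_comp; last exact: continuous_expR.
  by apply: cvgM; [exact: cvg_cst|apply: cvgB; [exact: cvg_id|exact: cvg_cst]].
have Emono s t : s <= t -> E s <= E t.
  by move=> st; rewrite ler_expR ler_wpM2l ?(ltW l0)// lerD2r.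
have E0 s : 0 <= E s by exact: expR_ge0.
have mE : measurable_fun setT E by exact: continuous_measurable_fun.
exists E; split => // [t at_|t].
  by rewrite -expR0 ler_expR mulr_ge0 ?subr_ge0// ltW.
rewrite in_itv/= => /andP[at_ tb].
have sub : `[a, t] `<=` `[a, b] by apply: subset_itvl; rewrite bnd_simp.
have iE (g : R -> R) : leb.-integrable `[a, b] (EFin \o g) ->
    leb.-integrable `[a, t] (EFin \o (fun s => g s * E s)).
  move=> /(@integrable_subitv a b a t g (lexx a) tb) gi.
  apply: (@itv_integrableM _ _ _ _ (E t)) => //; first exact: measurable_funTS.
  by move=> s; rewrite in_itv/= => /andP[_ st]; rewrite ger0_norm// Emono.
have im : leb.-integrable `[a, b] (EFin \o (fun t => Num.min (k t) n%:R)).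
  apply: (itv_integrable_le (mkm n) _ ki) => s sab.
  by rewrite ger0_norm ?ge_min ?lexx// le_min k0//=.
have -> : \int[leb]_(s in `[a, t]) (k s * E s) =
   \int[leb]_(s in `[a, t]) (Num.min (k s) n%:R * E s) + \int[leb]_(s in `[a, t]) (kn n s * E s).
  rewrite -RintegralD//; [|exact: iE|exact: iE].
  by apply: eq_Rintegral => s _; rewrite /kn; ring.
(* the bounded part: int n E <= n E / l with rate l = 16 (n + 1) *)
have h1 : \int[leb]_(s in `[a, t]) (Num.min (k s) n%:R * E s) <= n.+1%:R * (E t / l).
  apply: (@le_trans _ _ (\int[leb]_(s in `[a, t]) (n.+1%:R * E s))).
    apply: le_Rintegral_itv; first exact: iE.
      apply: (@itv_integrable _ _ _ (n.+1%:R * E t)); first exact: measurable_funM.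
      move=> s; rewrite in_itv/= => /andP[_ st].
      by rewrite ger0_norm ?mulr_ge0// ler_wpM2l// Emono.
    move=> s _; rewrite ler_wpM2r// (@le_trans _ _ n%:R)//; first by rewrite ge_min lexx orbT.
    by rewrite ler_nat.
  rewrite RintegralZl//; last first.
    apply: (@itv_integrable _ _ _ (E t)) => // s; rewrite in_itv/= => /andP[_ st].
    by rewrite ger0_norm// Emono.
  by rewrite ler_wpM2l// integral_exp_le.
(* the excess: E is nondecreasing and the mass of the excess is at most 1/16 *)
have h2 : \int[leb]_(s in `[a, t]) (kn n s * E s) <= E t / 16.
  apply: (@le_trans _ _ (\int[leb]_(s in `[a, t]) (kn n s * E t))).
    apply: le_Rintegral_itv; first exact: iE.
      apply: (@itv_integrableM _ _ _ _ (E t)) => //.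
        exact: integrable_subitv (ikn n).
      by move=> s _; rewrite ger0_norm.
    by move=> s; rewrite in_itv/= => /andP[as_ st]; rewrite ler_wpM2l ?Emono// kn0// in_itv/= as_ (le_trans st).
  rewrite RintegralZr//; last exact: integrable_subitv (ikn n).
  rewrite mulrC ler_wpM2l//.
  have : \int[leb]_(s in `[a, t]) kn n s <= \int[leb]_(s in `[a, b]) kn n s.
    rewrite (@Rintegral_itv_split a t b)// lerDl; apply: Rintegral_ge0 => s /= sab.
    by apply: kn0; move: sab; rewrite !in_itv/= => /andP[ts ->]; rewrite (le_trans at_ ts).
  by move=> h; rewrite (le_trans h)// (le_trans _ (ltW hn))// ler_norm.
have e1 : n.+1%:R * (E t / l) = E t / 16 by rewrite /l; field.
by move: h1 h2; rewrite e1; lra.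
Unshelve. all: by end_near. Qed.

End intervals.

(** * Measurable selections and the theorem of Filippov *)

Section vector_integral.
Context {R : realType} {d : nat}.
Local Notation leb := (@lebesgue_measure R).
Local Notation Rd := 'rV[R]_d.
Implicit Types (a b s t M : R) (u v : R -> Rd) (w : Rd).

Definition vint a t u : Rd := \row_i \int[leb]_(s in `[a, t]) u s 0 i.

Definition vbounded M u := vmeasurable setT u /\ forall t, enorm (u t) <= M.

Lemma vbounded_integrable M u a b i : vbounded M u ->
  leb.-integrable `[a, b] (EFin \o (fun t => u t 0 i)).
Proof.
move=> [mu hM]; apply: (@itv_integrable _ _ _ _ M); first exact: mu.
by move=> t _; rewrite (le_trans (le_coord_enorm _ _)).
Qed.

Lemma vbounded_dotv M u w : vbounded M u ->
  measurable_fun setT (fun t => dotv (u t) w).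
Proof. by move=> [mu _]; apply: measurable_dotv => // i; exact: measurable_cst. Qed.

Lemma vbounded_dotv_le M u w t : vbounded M u -> `|dotv (u t) w| <= M * enorm w.
Proof.
by move=> [_ hM]; rewrite (le_trans (normr_dotv_le _ _))// ler_wpM2r// enorm_ge0.
Qed.

Lemma dotv_vint M a t u w : vbounded M u ->
  dotv (vint a t u) w = \int[leb]_(s in `[a, t]) dotv (u s) w.
Proof.
move=> bu; rewrite /dotv.
have H (r : seq 'I_d) :
    leb.-integrable `[a, t] (EFin \o (fun s => \sum_(i <- r) u s 0 i * w 0 i)) /\
    \sum_(i <- r) vint a t u 0 i * w 0 i = \int[leb]_(s in `[a, t]) \sum_(i <- r) u s 0 i * w 0 i.
  elim: r => [|i r [ih1 ih2]].
    split; last by rewrite big_nil; under eq_Rintegral do rewrite big_nil; rewrite Rintegral_cst// mul0r.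
    rewrite (_ : (fun s => _) = (fun=> 0)); last by apply/funext => s; rewrite big_nil.
    by apply: (@itv_integrable _ _ _ _ 0) => // s _; rewrite normr0.
  have ii : leb.-integrable `[a, t] (EFin \o (fun s => u s 0 i * w 0 i)).
    apply: (@itv_integrableM _ _ _ _ (fun=> w 0 i) `|w 0 i|) => //.
    exact: vbounded_integrable bu.
  split.
    rewrite (_ : EFin \o _ = (fun s => (u s 0 i * w 0 i)%:E + (\sum_(j <- r) u s 0 j * w 0 j)%:E)%E).
      exact: integrableD.
    by apply/funext => s; rewrite /= big_cons EFinD.
  rewrite big_cons ih2; under [RHS]eq_Rintegral do rewrite big_cons.
  by rewrite RintegralD// mxE RintegralZr//; exact: vbounded_integrable bu.
by have [_] := H (index_enum 'I_d).
Qed.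

(** Pair the integral with itself and apply the Cauchy-Schwarz inequality under the integral sign. *)
Lemma enorm_vint_le M a t u : vbounded M u ->
  enorm (vint a t u) <= \int[leb]_(s in `[a, t]) enorm (u s).
Proof.
move=> bu; have [mu hM] := bu; set w := vint a t u.
have [w0|w0] := eqVneq (enorm w) 0.
  by rewrite w0; apply: Rintegral_ge0 => s _; exact: enorm_ge0.
have wp : 0 < enorm w by rewrite lt_def w0 enorm_ge0.
have ie : leb.-integrable `[a, t] (EFin \o (fun s => enorm (u s))).
  apply: (@itv_integrable _ _ _ _ M); first exact: measurable_enorm.
  by move=> s _; rewrite ger0_norm ?enorm_ge0.
rewrite -(ler_pM2r wp) -expr2 sqr_enorm {1}/w (dotv_vint _ _ _ bu).
rewrite -RintegralZr//; apply: le_Rintegral_itv.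
- apply: (@itv_integrable _ _ _ _ (M * enorm w)); first exact: vbounded_dotv bu.
  by move=> s _; exact: vbounded_dotv_le.
- by apply: (@itv_integrableM _ _ _ _ (fun=> enorm w) (enorm w)) => // s _; rewrite ger0_norm// enorm_ge0.
- by move=> s _; exact: dotv_le.
Qed.

Lemma enorm_vint_le_fun M a t u (g : R -> R) : vbounded M u ->
  leb.-integrable `[a, t] (EFin \o g) ->
  (forall s, s \in `[a, t] -> enorm (u s) <= g s) ->
  enorm (vint a t u) <= \int[leb]_(s in `[a, t]) g s.
Proof.
move=> bu gi hg; rewrite (le_trans (enorm_vint_le _ _ bu))//; apply: le_Rintegral_itv => //.
have [mu hM] := bu; apply: (@itv_integrable _ _ _ _ M); first exact: measurable_enorm.
by move=> s _; rewrite ger0_norm ?enorm_ge0.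
Qed.

Lemma vintB M M' a t u v : vbounded M u -> vbounded M' v ->
  vint a t (fun s => u s - v s) = vint a t u - vint a t v.
Proof.
move=> bu bv; apply/rowP => i; rewrite !mxE -RintegralB//.
- by apply: eq_Rintegral => s _; rewrite !mxE.
- exact: vbounded_integrable bu.
- exact: vbounded_integrable bv.
Qed.

Lemma vboundedB M M' u v : vbounded M u -> vbounded M' v ->
  vbounded (M + M') (fun s => u s - v s).
Proof.
move=> [mu hM] [mv hM']; split.
  move=> i; rewrite (_ : (fun s => _) = (fun s => u s 0 i - v s 0 i)).
    by apply: measurable_funB; [exact: mu|exact: mv].
  by apply/funext => s; rewrite !mxE.
by move=> t; rewrite (le_trans (enormD _ _))// enormN lerD.
Qed.

Lemma vint_split M a s t u : vbounded M u -> a <= s -> s <= t ->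
  vint a t u - vint a s u = vint s t u.
Proof.
move=> bu as_ st; apply/rowP => i; rewrite !mxE (@Rintegral_itv_split _ a s t)//.
  by rewrite addrC addKr.
exact: vbounded_integrable bu.
Qed.

Lemma vint_cst a t w : a <= t -> vint a t (fun=> w) = (t - a) *: w.
Proof. by move=> at_; apply/rowP => i; rewrite !mxE Rintegral_cst// fine_leb_itv// mulrC. Qed.

Lemma vint_lt a t u : t < a -> vint a t u = 0.
Proof.
move=> ta; apply/rowP => i; rewrite !mxE set_itv_ge ?Rintegral_set0//.
by rewrite bnd_simp -ltNge.
Qed.

Lemma vint_self a u : vint a a u = 0.
Proof. by apply/rowP => i; rewrite !mxE set_itv1 Rintegral_set1. Qed.

Lemma enorm_vint_itv M s t u : vbounded M u -> s <= t -> enorm (vint s t u) <= M * (t - s).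
Proof.
move=> bu st; have [mu hM] := bu.
rewrite (le_trans (enorm_vint_le_fun (g := fun=> M) bu _ _))//.
  by apply: (@itv_integrable _ _ _ _ `|M|).
by rewrite Rintegral_cst// fine_leb_itv.
Qed.

Lemma vint_lip M a s t u : vbounded M u -> enorm (vint a t u - vint a s u) <= M * `|t - s|.
Proof.
move=> bu; have M0 : 0 <= M by have [_ hM] := bu; rewrite (le_trans (enorm_ge0 (u 0))).
wlog st : s t / s <= t.
  by move=> h; have [st|/ltW ts] := leP s t; [exact: h|rewrite enormB distrC; exact: h].
rewrite (ger0_norm (_ : 0 <= t - s)) ?subr_ge0//.
have [sa|as_] := ltP s a; last by rewrite (vint_split bu)// enorm_vint_itv.
rewrite (vint_lt _ sa) subr0; have [ta|at_] := ltP t a.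
  by rewrite vint_lt// enorm0 mulr_ge0// subr_ge0.
by rewrite (le_trans (enorm_vint_itv bu at_))// ler_wpM2l// lerB// ltW.
Qed.

Lemma measurable_vint {dX} {X : measurableType dX} a (U : R -> X -> Rd) :
  vmeasurable setT (fun z : R * X => U z.1 z.2) ->
  vmeasurable setT (fun z : R * X => vint a z.1 (U ^~ z.2)).
Proof.
move=> mU i.
rewrite (_ : (fun z => _) = (fun z : R * X => \int[leb]_s
   (if (a <= s) && (s <= z.1) then U s z.2 0 i else 0))); last first.
  apply/funext => z; rewrite mxE Rintegral_mkcond; apply: eq_Rintegral => s _.
  by rewrite patchE mem_setE in_itv.
pose f (zs : (R * X) * R) := if (a <= zs.2) && (zs.2 <= zs.1.1) then U zs.2 zs.1.2 0 i else 0.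
suff mf : measurable_fun setT f by exact: (measurable_Rintegral_param leb mf).
rewrite /f.
apply: measurable_fun_ifT => //.
  apply: measurable_and; apply: measurable_fun_ler => //.
  exact: (measurableT_comp measurable_fst).
have h : measurable_fun setT (fun zs : (R * X) * R => (zs.2, zs.1.2)).
  apply: measurable_fun_pair => //.
  exact: (measurableT_comp measurable_snd).
exact: (measurableT_comp (mU i) h).
Qed.

End vector_integral.

Section setvalued.
Context {R : realType} {d : nat}.
Local Notation Rd := 'rV[R]_d.
Context {dX} {X : measurableType dX}.

Lemma enorm_sub_open (z : Rd) (r : R) : open [set p : Rd | enorm (z - p) < r].
Proof.
have -> : [set p : Rd | enorm (z - p) < r] = (fun p => enorm (z - p)) @^-1` [set x | x < r] by [].
apply: open_comp; last exact: open_lt.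
move=> p _; rewrite /continuous_at; apply: (@continuous_comp _ _ R (fun p : Rd => z - p) enorm p).
  by apply: (@cvgB _ _ _ (nbhs p)); [exact: cvg_cst|exact: cvg_id].
exact: continuous_enorm.
Qed.

(** The distance is 1-Lipschitz in the point, so the point may be replaced by a rational
    approximation, after which only the measurability of the set-valued map matters. *)
Lemma measurable_dist (D : set X) (Phi : X -> set Rd) (u : X -> Rd) : measurable D ->
  setvalued_measurable D Phi -> (forall x, D x -> nonempty_compact_convex (Phi x)) ->
  vmeasurable setT u ->
  measurable_fun D (fun x => enorm (u x - nproj (Phi x) (u x))).
Proof.
move=> mD mPhi hPhi mu; apply: (measurability _ (RGenInftyO.measurableE R)).
move=> _ [_ [r ->] <-].
pose c (q : 'rV[rat]_d) : Rd := \row_i ratr (q 0 i).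
rewrite (_ : D `&` _ = \bigcup_(qn : 'rV[rat]_d * rat) (
   (D `&` [set x | Phi x `&` [set p : Rd | enorm (c qn.1 - p) < r - ratr qn.2] !=set0]) `&`
   [set x | enorm (u x - c qn.1) < ratr qn.2])).
  apply: countable_bigcupT_measurable => // qn; apply: measurableI.
    by apply: mPhi; exact: enorm_sub_open.
  have mq : measurable_fun setT (fun x => enorm (u x - c qn.1)).
    apply: measurable_enorm; apply: vmeasurableD => // i; exact: measurable_cst.
  have -> : [set x | enorm (u x - c qn.1) < ratr qn.2] =
      (fun x => enorm (u x - c qn.1)) @^-1` `]-oo, ratr qn.2[.
    by apply/seteqP; split => x /=; rewrite in_itv.
  by rewrite -[X in measurable X]setTI; exact: mq.
apply/seteqP; split => [x [Dx] /=|x [qn _] [[Dx [p [Php /= h1]]] /= h2]]; last first.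
  split => //=; rewrite in_itv/=; apply: le_lt_trans (nproj_le _ (hPhi _ Dx) Php) _.
  by rewrite (le_lt_trans (enorm_triangle (c qn.1) _ _))//; lra.
rewrite in_itv/= => h.
set p := nproj (Phi x) (u x) in h.
have /rat_in_itvoo[e] : 0 < (r - enorm (u x - p)) / 2 by rewrite divr_gt0// subr_gt0.
rewrite in_itv/= => /andP[e0 e1].
have [q hq] : exists q, enorm (u x - c q) < ratr e.
  have ux : [set p0 : Rd | enorm (u x - p0) < ratr e] (u x) by rewrite /= subrr enorm0.
  have [qn [hqn1 hqn2]] := @rat_ball_base R d _ (u x) (@enorm_sub_open (u x) (ratr e)) ux.
  by exists qn.1; apply: hqn2; rewrite /rat_ball; apply: ballxx; rewrite invr_gt0.
exists (q, e) => //=; split => //; split => //.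
exists p; split => /=; first exact: nproj_in (hPhi _ Dx).
rewrite (le_lt_trans (enorm_triangle (u x) _ _))// enormB.
by move: hq e1; lra.
Qed.

(** The residual of the projection is half the gradient of the squared distance, a limit of
    measurable difference quotients. *)
Lemma vmeasurable_nproj (D : set X) (Phi : X -> set Rd) (u : X -> Rd) : measurable D ->
  setvalued_measurable D Phi -> (forall x, D x -> nonempty_compact_convex (Phi x)) ->
  vmeasurable setT u -> vmeasurable D (fun x => nproj (Phi x) (u x)).
Proof.
move=> mD mPhi hPhi mu i.
(* difference quotients of the squared distance in the direction of the i-th axis *)
pose e (n : nat) : Rd := n.+1%:R^-1 *: delta_mx 0 i.
pose g n x := u x 0 i - (2^-1 * n.+1%:R) *
  (enorm (u x + e n - nproj (Phi x) (u x + e n)) ^+ 2 - enorm (u x - nproj (Phi x) (u x)) ^+ 2).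
have mui : measurable_fun D (fun x => u x 0 i) by exact: measurable_funTS (mu i).
have mg n : measurable_fun D (g n).
  apply: measurable_funB => //; apply: measurable_funM => //.
  apply: measurable_funB; apply: measurable_funX; apply: measurable_dist => //.
  by apply: vmeasurableD => // j; exact: measurable_cst.
apply: (measurable_fun_cvg mg) => x Dx.
apply/(@cvgrPdist_le _ R^o) => r r0; near=> n.
have := sqr_dist_nproj (u x) (e n) (hPhi _ Dx); move: (hPhi _ Dx) => _.
set A := enorm _ ^+ 2; set B := enorm _ ^+ 2; set p := nproj (Phi x) (u x).
have de w : dotv (e n) w = n.+1%:R^-1 * w 0 i.
  rewrite dotvZl; congr (_ * _); rewrite /dotv (bigD1 i)//= big1 ?addr0 ?mxE ?eqxx ?mul1r//.
  by move=> j ji; rewrite mxE (negbTE ji) andbF mul0r.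
rewrite !de !mxE !eqxx mulr1 /g -/A -/B => h.
set N : R := n.+1%:R in h *.
have N0 : 0 < N by rewrite ltr0n.
have -> : p 0 i - (u x 0 i - 2^-1 * N * (A - B)) =
   2^-1 * N * (A - B - 2 * (N^-1 * (u x 0 i - p 0 i))).
  by field; rewrite gt_eqF.
rewrite normrM ger0_norm; last by rewrite mulr_ge0// ltW.
apply: (@le_trans _ _ (2^-1 * N * (N^-1 * N^-1))).
  by rewrite ler_wpM2l// mulr_ge0// ltW.
rewrite -mulrA mulVKf ?gt_eqF//.
apply: (@le_trans _ _ N^-1); first by rewrite ler_piMl ?invr_ge0 ?(ltW N0)// invf_le1//; lra.
by rewrite /N ltW//; near: n; exact: (near_infty_natSinv_lt (PosNum r0)).
Unshelve. all: by end_near. Qed.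

End setvalued.

Section geometric.
Context {R : realType}.

Lemma half_cvg0 : (fun n : nat => (2^-1 : R) ^+ n) @ \oo --> (0 : R).
Proof. by apply: cvg_expr; rewrite ger0_norm// invf_lt1// ltr1n. Qed.

Lemma half_le0 (x c : R) : (forall n : nat, x <= c * (2^-1) ^+ n) -> x <= 0.
Proof.
move=> h.
have hc : (fun n : nat => c * (2^-1 : R) ^+ n) @ \oo --> (c * 0 : R).
  by apply: cvgM; [exact: cvg_cst|exact: half_cvg0].
rewrite mulr0 in hc.
rewrite -(cvg_lim _ hc)//; apply: limr_ge; first by apply/cvg_ex; exists 0.
by near=> n; exact: h.
Unshelve. all: by end_near. Qed.

Lemma half_tail (u : nat -> R) (K : R) :
  (forall n, `|u n.+1 - u n| <= K * (2^-1) ^+ n) ->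
  forall n m, `|u (n + m)%N - u n| <= 2 * K * (2^-1) ^+ n.
Proof.
move=> h n m.
have K0 : 0 <= K by have := h 0%N; rewrite expr0 mulr1; exact: le_trans.
have : `|u (n + m)%N - u n| <= 2 * K * ((2^-1) ^+ n - (2^-1) ^+ (n + m)).
  elim: m => [|m ih]; first by rewrite addn0 !subrr normr0 mulr0.
  rewrite addnS -(subrK (u (n + m)%N) (u (n + m).+1)) -addrA.
  rewrite (le_trans (ler_normD _ _))//.
  have -> : 2 * K * ((2^-1) ^+ n - (2^-1) ^+ (n + m).+1) =
     K * (2^-1) ^+ (n + m) + 2 * K * ((2^-1) ^+ n - (2^-1) ^+ (n + m)).
    by rewrite exprS; field.
  by rewrite lerD.
move=> /le_trans; apply; rewrite ler_wpM2l ?mulr_ge0// gerBl exprn_ge0//.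
Qed.

Lemma half_cvg (u : nat -> R) (K : R) :
  (forall n, `|u n.+1 - u n| <= K * (2^-1) ^+ n) ->
  cvg (u @ \oo) /\ forall n, `|lim (u @ \oo) - u n| <= 2 * K * (2^-1) ^+ n.
Proof.
move=> h.
have hc : cvg (u @ \oo).
  apply: cauchy_cvg; apply: cauchy_exP => e e0.
  have hk : (fun n : nat => 2 * K * (2^-1 : R) ^+ n) @ \oo --> (2 * K * 0 : R).
    by apply: cvgM; [exact: cvg_cst|exact: half_cvg0].
  rewrite mulr0 in hk.
  move: hk => /(@cvgrPdist_lt _ R^o) /(_ _ e0) [n _ /(_ n (leqnn n)) /= hn].
  exists (u n); exists n => // m /= nm; rewrite -(subnKC nm) /ball/= distrC.
  apply: (le_lt_trans (half_tail h n (m - n))).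
  by rewrite (le_lt_trans (ler_norm _))// -normrN -sub0r.
split => // n.
have hd : (fun m => `|u m - u n|) @ \oo --> `|lim (u @ \oo) - u n|.
  by apply: (@cvg_norm _ R^o); apply: cvgB; [exact: hc|exact: cvg_cst].
rewrite -(cvg_lim _ hd)//; apply: limr_le; first by apply/cvg_ex; eexists; exact: hd.
near=> m; have nm : (n <= m)%N by near: m; exact: nbhs_infty_ge.
by rewrite -(subnKC nm); exact: half_tail.
Unshelve. all: by end_near. Qed.

End geometric.

Section filippov.
Context {R : realType} {d : nat} {dX : measure_display} {Om : measurableType dX}.
Local Notation leb := (@lebesgue_measure R).
Local Notation Rd := 'rV[R]_d.
Variables (a b M C : R) (k : R -> R).
Hypothesis C0 : 0 <= C.
Hypothesis k0 : forall t, t \in `[a, b] -> 0 <= k t.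
Hypothesis k1 : leb.-integrable `[a, b] (EFin \o k).

Definition velocity (U : R -> Om -> Rd) :=
  vmeasurable setT (fun z : R * Om => U z.1 z.2) /\ forall t om, enorm (U t om) <= M.

Definition disp (U : R -> Om -> Rd) t om := vint a t (U ^~ om).

Variables (S : (R -> Om -> Rd) -> R -> Om -> set Rd) (W : Om -> Rd).
Hypothesis mS : forall U, velocity U ->
  setvalued_measurable (X := (R * Om)%type) (`[a, b] `*` setT) (fun z => S (disp U) z.1 z.2).
Hypothesis lipS : forall U V t c, velocity U -> velocity V -> t \in `[a, b] ->
  (forall om, enorm (disp U t om - disp V t om) <= c) ->
  forall om, (hausdorff_dist (S (disp U) t om) (S (disp V) t om) <= (k t * c)%:E)%E.
Hypothesis nccS : forall U t om, velocity U -> t \in `[a, b] ->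
  nonempty_compact_convex (S (disp U) t om).
Hypothesis leS : forall U t om p, velocity U -> t \in `[a, b] ->
  S (disp U) t om p -> enorm p <= M.
Hypothesis mW : vmeasurable setT W.
Hypothesis leW : forall om, enorm (W om) <= M.
Hypothesis distW : forall t om, t \in `[a, b] ->
  enorm (W om - nproj (S (disp (fun=> W)) t om) (W om)) <= C * (t - a).

Lemma velocity_vbounded U om : velocity U -> vbounded M (U ^~ om).
Proof.
by move=> [mU hU]; split => // i; exact: (measurableT_comp (mU i) (pair2_measurable om)).
Qed.

Lemma M_ge0 : Om -> 0 <= M.
Proof. by move=> om; rewrite (le_trans (enorm_ge0 (W om))). Qed.

Let step (U : R -> Om -> Rd) t om : Rd :=
  if t \in `[a, b] then nproj (S (disp U) t om) (U t om) else 0.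

Lemma velocity_step U : velocity U -> velocity (step U).
Proof.
move=> hU; split; last first.
  move=> t om; rewrite /step; case: ifPn => tab; last by rewrite enorm0 M_ge0.
  by apply: (leS hU tab); apply: nproj_in; exact: nccS.
have mD : measurable (`[a, b] `*` setT : set (R * Om)) by exact: measurableX.
have h := vmeasurable_nproj mD (mS hU) _ hU.1.
move=> i; rewrite (_ : (fun z => _) = (fun z : R * Om => nproj (S (disp U) z.1 z.2) (U z.1 z.2) 0 i)
   \_ (`[a, b] `*` setT)).
  apply/(measurable_restrictT _ mD); apply: h => -[t om] [/= tab _]; exact: nccS.
apply/funext => -[t om]; rewrite patchE /step in_setX in_setT andbT mem_setE /=.
by case: (t \in `[a, b]); rewrite ?mxE.
Qed.

Let Un n := iter n step (fun=> W).

Lemma velocity_Un n : velocity (Un n).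
Proof.
elim: n => [|n ih]; last exact: velocity_step.
split => //= i; exact: (measurableT_comp (mW i) measurable_snd).
Qed.

Lemma UnS n t om : t \in `[a, b] -> Un n.+1 t om = nproj (S (disp (Un n)) t om) (Un n t om).
Proof. by move=> tab; rewrite /Un iterS {1}/step tab. Qed.

Lemma Un_in n t om : t \in `[a, b] -> S (disp (Un n)) t om (Un n.+1 t om).
Proof. by move=> tab; rewrite UnS//; apply: nproj_in; apply: nccS tab; exact: velocity_Un. Qed.

Lemma dispB U V t om : velocity U -> velocity V ->
  disp U t om - disp V t om = vint a t (fun s => U s om - V s om).
Proof.
by move=> hU hV; rewrite (vintB _ _ (velocity_vbounded om hU) (velocity_vbounded om hV)).
Qed.

Lemma disp_le U V t om (g : R -> R) : velocity U -> velocity V ->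
  leb.-integrable `[a, t] (EFin \o g) ->
  (forall s, s \in `[a, t] -> enorm (U s om - V s om) <= g s) ->
  enorm (disp U t om - disp V t om) <= \int[leb]_(s in `[a, t]) g s.
Proof.
move=> hU hV gi hg; rewrite dispB//.
by apply: (enorm_vint_le_fun (vboundedB (velocity_vbounded om hU) (velocity_vbounded om hV))).
Qed.

Variable E : R -> R.
Hypothesis cE : continuous E.
Hypothesis E1 : forall t, a <= t -> 1 <= E t.
Hypothesis Emono : forall s t, s <= t -> E s <= E t.
Hypothesis intE : forall t, t \in `[a, b] -> 8 * \int[leb]_(s in `[a, t]) (k s * E s) <= E t.

Lemma sub_ab s t : t \in `[a, b] -> s \in `[a, t] -> s \in `[a, b].
Proof. by rewrite !in_itv/= => /andP[_ tb] /andP[-> st]; rewrite (le_trans st). Qed.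

Lemma kE_integrable t : t \in `[a, b] -> leb.-integrable `[a, t] (EFin \o (fun s => k s * E s)).
Proof.
move=> tab; apply: (@itv_integrableM _ _ _ _ _ (E t)).
- by apply: integrable_subitv k1 => //; move: tab; rewrite in_itv/= => /andP[].
- by apply: measurable_funTS; exact: continuous_measurable_fun.
- move=> s; rewrite in_itv/= => /andP[as_ st].
  by rewrite ger0_norm ?Emono// (le_trans ler01)// E1.
Qed.

Lemma kE_scaled t c : t \in `[a, b] -> 0 <= c ->
  leb.-integrable `[a, t] (EFin \o (fun s => c * (k s * E s))) /\
  \int[leb]_(s in `[a, t]) (c * (k s * E s)) <= c * E t / 8.
Proof.
move=> tab c0; split.
  under [X in EFin \o X]eq_fun do rewrite mulrC.
  by apply: (@itv_integrableM _ _ _ _ (fun=> c) `|c|) => //; exact: kE_integrable.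
rewrite RintegralZl//; last exact: kE_integrable.
by rewrite -mulrA ler_wpM2l// ler_pdivlMr// mulrC intE.
Qed.

Let B n t := C * (t - a) ^+ 2 * (2^-1) ^+ n * E t.

(** The Lipschitz bound of S turns a distance between displacements into a distance between
    velocities, whose integral gains the factor 1/8 by the choice of the weight E. The
    first step uses the bound on the distance of W from the images, hence the factor
    (t - a)^2, which is then inherited by all steps. *)
Lemma disp_step n t om : t \in `[a, b] ->
  enorm (disp (Un n.+1) t om - disp (Un n) t om) <= B n t.
Proof.
elim: n t om => [|n ih] t om tab.
  have [at_ tb] : a <= t /\ t <= b by move: tab; rewrite in_itv/= => /andP[].
  apply: (@le_trans _ _ (\int[leb]_(s in `[a, t]) (C * (t - a)))).
    apply: disp_le; [exact: velocity_Un|exact: velocity_Un| |].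
      by apply: (@itv_integrable _ _ _ _ `|C * (t - a)|).
    move=> s sat; rewrite UnS ?(sub_ab tab)// enormB.
    rewrite (le_trans (distW _ (sub_ab tab sat)))// ler_wpM2l// lerB//.
    by move: sat; rewrite in_itv/= => /andP[].
  rewrite Rintegral_cst// fine_leb_itv// -mulrA -expr2 /B expr0 mulr1.
  by rewrite ler_peMr ?E1// mulr_ge0// exprn_ge0// subr_ge0.
have [at_ tb] : a <= t /\ t <= b by move: tab; rewrite in_itv/= => /andP[].
have c0 : 0 <= C * (t - a) ^+ 2 * (2^-1) ^+ n by rewrite !mulr_ge0 ?exprn_ge0 ?subr_ge0.
have [i1 i2] := kE_scaled tab c0.
apply: le_trans (disp_le _ _ i1 _) _; [exact: velocity_Un|exact: velocity_Un| |].
  move=> s sat; have sab := sub_ab tab sat.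
  rewrite UnS// enormB.
  apply: le_trans (hausdorff_nproj (nccS _ (velocity_Un n.+1) sab) (Un_in n om sab)
    (lipS (velocity_Un n) (velocity_Un n.+1) sab (c := B n s) _ om)) _.
    by move=> om'; rewrite enormB ih.
  move: (sat); rewrite in_itv/= => /andP[as_ st].
  have -> : k s * B n s = C * (s - a) ^+ 2 * 2^-1 ^+ n * (k s * E s) by rewrite /B; ring.
  rewrite ler_wpM2r ?mulr_ge0 ?k0 ?(le_trans ler01 (E1 as_))//.
  rewrite ler_wpM2r ?exprn_ge0// ler_wpM2l//.
  by rewrite lerXn2r ?nnegrE ?subr_ge0 ?lerB.
apply: le_trans i2 _; rewrite /B [2^-1 ^+ n.+1]exprS.
have : 0 <= C * (t - a) ^+ 2 * (2^-1) ^+ n * E t.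
  by rewrite mulr_ge0// (le_trans ler01)// E1.
have -> : C * (t - a) ^+ 2 * (2^-1 * 2^-1 ^+ n) * E t = C * (t - a) ^+ 2 * 2^-1 ^+ n * E t / 2 by field.
by move: (C * _ * _ * _) => x x0; lra.
Qed.

Let K t := k t * (C * (t - a) ^+ 2 * E t).

Lemma E_ge0 t : a <= t -> 0 <= E t.
Proof. by move=> at_; rewrite (le_trans ler01)// E1. Qed.

Lemma itv_le t : t \in `[a, b] -> a <= t /\ t <= b.
Proof. by rewrite in_itv/= => /andP. Qed.

Lemma K_ge0 t : t \in `[a, b] -> 0 <= K t.
Proof.
move=> tab; have [at_ _] := itv_le tab.
by rewrite /K !mulr_ge0 ?k0 ?E_ge0 ?exprn_ge0 ?subr_ge0.
Qed.

(** A summable bound at every time and label: this is what makes the velocities converge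
    everywhere and not only in a norm of integral type. *)
Lemma Un_step n t om : t \in `[a, b] ->
  enorm (Un n.+2 t om - Un n.+1 t om) <= K t * (2^-1) ^+ n.
Proof.
move=> tab; rewrite UnS// enormB.
apply: le_trans (hausdorff_nproj (nccS _ (velocity_Un n.+1) tab) (Un_in n om tab)
  (lipS (velocity_Un n) (velocity_Un n.+1) tab (c := B n t) _ om)) _.
  by move=> om'; rewrite enormB disp_step.
by rewrite /K /B -!mulrA [E t * _]mulrC.
Qed.

Lemma Un_out n t om : t \notin `[a, b] -> Un n.+1 t om = 0.
Proof. by move=> tab; rewrite /Un iterS {1}/step (negbTE tab). Qed.

Let Ulim t om : Rd := \row_i lim ((fun n => Un n.+1 t om 0 i) @ \oo).

Lemma Un_coord n t om i : t \in `[a, b] ->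
  `|Un n.+2 t om 0 i - Un n.+1 t om 0 i| <= K t * (2^-1) ^+ n.
Proof.
move=> tab; apply: le_trans (Un_step n om tab).
by have := le_coord_enorm (Un n.+2 t om - Un n.+1 t om) i; rewrite !mxE.
Qed.

Lemma Un_cvg t om i : (fun n => Un n.+1 t om 0 i) @ \oo --> Ulim t om 0 i.
Proof.
rewrite mxE; have [tab|tab] := boolP (t \in `[a, b]).
  by have [h _] := half_cvg (fun n => Un_coord n om i tab).
rewrite (_ : (fun n => _) = (fun=> 0)); first exact: is_cvg_cst.
by apply/funext => n; rewrite Un_out// mxE.
Qed.

Lemma Ulim_dist n t om : t \in `[a, b] ->
  enorm (Ulim t om - Un n.+1 t om) <= d%:R * 2 * K t * (2^-1) ^+ n.
Proof.
move=> tab; rewrite (le_trans (enorm_le_sum _))//.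
rewrite (@le_trans _ _ (\sum_(i < d) 2 * K t * (2^-1) ^+ n))//; last first.
  by rewrite sumr_const card_ord -[leLHS]mulr_natl !mulrA.
apply: ler_sum => i _; have [_ h] := half_cvg (fun n => Un_coord n om i tab).
by have := h n; rewrite !mxE.
Qed.

Lemma velocity_Ulim : velocity Ulim.
Proof.
split.
  move=> i; apply: (@measurable_fun_cvg _ _ R setT (fun n z => Un n.+1 z.1 z.2 0 i)).
    by move=> n; have [h _] := velocity_Un n.+1; exact: h.
  by move=> z _; exact: Un_cvg.
move=> t om; have [tab|tab] := boolP (t \in `[a, b]); last first.
  rewrite (_ : Ulim t om = 0) ?enorm0 ?M_ge0//; apply/rowP => i; rewrite !mxE.
  rewrite (_ : (fun n => _) = (fun=> 0)) ?lim_cst//.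
  by apply/funext => n; rewrite Un_out// mxE.
rewrite -subr_le0; apply: (@half_le0 _ _ (d%:R * 2 * K t)) => n.
have := Ulim_dist n om tab; have [_ /(_ t om)] := velocity_Un n.+1.
by have := enormD (Ulim t om - Un n.+1 t om) (Un n.+1 t om); rewrite subrK; lra.
Qed.

Lemma disp_Ulim n t om : t \in `[a, b] ->
  enorm (disp Ulim t om - disp (Un n.+1) t om) <=
  d%:R * (C * (t - a) ^+ 2 * E t) * (2^-1) ^+ n.
Proof.
move=> tab; have [at_ tb] := itv_le tab.
have c0 : 0 <= d%:R * 2 * (C * (t - a) ^+ 2) * (2^-1) ^+ n.
  by rewrite !mulr_ge0 ?exprn_ge0 ?subr_ge0.
have [i1 i2] := kE_scaled tab c0.
apply: le_trans (disp_le _ _ i1 _) _.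
- exact: velocity_Ulim.
- exact: velocity_Un.
- move=> s sat; have sab := sub_ab tab sat; have [as_ _] := itv_le sab.
  rewrite (le_trans (Ulim_dist n om sab))//.
  have -> : d%:R * 2 * K s * 2^-1 ^+ n = d%:R * 2 * (C * (s - a) ^+ 2) * (2^-1) ^+ n * (k s * E s).
    by rewrite /K; ring.
  rewrite ler_wpM2r ?mulr_ge0 ?k0 ?E_ge0// ler_wpM2r ?exprn_ge0// ler_wpM2l// ler_wpM2l//.
  by rewrite lerXn2r ?nnegrE ?subr_ge0 ?lerB//; move: sat; rewrite in_itv/= => /andP[].
apply: le_trans i2 _.
have : 0 <= d%:R * (C * (t - a) ^+ 2 * E t) * (2^-1) ^+ n.
  by rewrite !mulr_ge0 ?E_ge0 ?exprn_ge0 ?subr_ge0.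
have -> : d%:R * 2 * (C * (t - a) ^+ 2) * 2^-1 ^+ n * E t / 8 =
  d%:R * (C * (t - a) ^+ 2 * E t) * 2^-1 ^+ n / 4 by field.
by move: (d%:R * _ * _) => x; lra.
Qed.

Lemma Ulim_in t om : t \in `[a, b] -> S (disp Ulim) t om (Ulim t om).
Proof.
move=> tab; have ncc := nccS om velocity_Ulim tab.
suff e0 : enorm (Ulim t om - nproj (S (disp Ulim) t om) (Ulim t om)) <= 0.
  have /enorm_eq0/eqP : enorm (Ulim t om - nproj (S (disp Ulim) t om) (Ulim t om)) = 0.
    by apply/eqP; rewrite eq_le e0 enorm_ge0.
  by rewrite subr_eq0 => /eqP ->; exact: nproj_in.
apply: (@half_le0 _ _ (d%:R * 3 * K t)) => n.
apply: le_trans (nproj_le _ ncc (nproj_in (Un n.+2 t om) ncc)) _.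
apply: le_trans (enorm_triangle (Un n.+2 t om) _ _) _.
have h1 := Ulim_dist n.+1 om tab.
have h2 : enorm (Un n.+2 t om - nproj (S (disp Ulim) t om) (Un n.+2 t om)) <=
    k t * (d%:R * (C * (t - a) ^+ 2 * E t) * (2^-1) ^+ n).
  apply: (hausdorff_nproj ncc (Un_in n.+1 om tab)).
  apply: (lipS (velocity_Un n.+1) velocity_Ulim tab) => om'.
  by rewrite enormB disp_Ulim.
apply: le_trans (lerD h1 h2) _; rewrite exprS.
have -> : k t * (d%:R * (C * (t - a) ^+ 2 * E t) * 2^-1 ^+ n) = d%:R * K t * 2^-1 ^+ n by rewrite /K; ring.
have : 0 <= d%:R * K t * 2^-1 ^+ n by rewrite mulr_ge0 ?exprn_ge0// mulr_ge0// K_ge0.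
have -> : d%:R * 2 * K t * (2^-1 * 2^-1 ^+ n) = d%:R * K t * 2^-1 ^+ n by field.
have -> : d%:R * 3 * K t * 2^-1 ^+ n = d%:R * K t * 2^-1 ^+ n * 3 by ring.
by move: (d%:R * _ * _) => x; lra.
Qed.

Lemma disp_Ulim_W t om : t \in `[a, b] ->
  enorm (disp Ulim t om - (t - a) *: W om) <= (d%:R + 1) * C * E b * (t - a) ^+ 2.
Proof.
move=> tab; have [at_ tb] := itv_le tab.
have -> : (t - a) *: W om = disp (Un 0) t om by rewrite /disp vint_cst.
apply: le_trans (enorm_triangle (disp (Un 1) t om) _ _) _.
apply: le_trans (lerD (disp_Ulim 0 om tab) (disp_step 0 om tab)) _.
rewrite /B !expr0 !mulr1.
have -> : d%:R * (C * (t - a) ^+ 2 * E t) + C * (t - a) ^+ 2 * E t =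
  (d%:R + 1) * C * E t * (t - a) ^+ 2 by ring.
by rewrite ler_wpM2r ?exprn_ge0 ?subr_ge0// ler_wpM2l ?Emono// mulr_ge0// addr_ge0.
Qed.

Lemma filippov_weighted : exists2 U, velocity U &
  (forall t om, t \in `[a, b] -> S (disp U) t om (U t om)) /\
  (forall t om, t \in `[a, b] ->
    enorm (disp U t om - (t - a) *: W om) <= (d%:R + 1) * C * E b * (t - a) ^+ 2).
Proof.
exists Ulim; first exact: velocity_Ulim.
by split; [exact: Ulim_in|exact: disp_Ulim_W].
Qed.

End filippov.

Section filippov_thm.
Context {R : realType} {d : nat} {dX : measure_display} {Om : measurableType dX}.
Local Notation leb := (@lebesgue_measure R).
Local Notation Rd := 'rV[R]_d.

(** Differential inclusions with a measurable family of labels om, coupled through the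
    displacements of all labels: S receives the whole displacement field. Besides existence,
    the solution stays at second order from the straight motion with velocities W,
    uniformly in the labels, whenever W nearly solves the inclusion. *)
Theorem filippov (a b M C : R) (k : R -> R)
  (S : (R -> Om -> Rd) -> R -> Om -> set Rd) (W : Om -> Rd) :
  a <= b -> 0 <= C -> (forall t, t \in `[a, b] -> 0 <= k t) ->
  leb.-integrable `[a, b] (EFin \o k) ->
  (forall U, velocity M U ->
    setvalued_measurable (X := (R * Om)%type) (`[a, b] `*` setT) (fun z => S (disp a U) z.1 z.2)) ->
  (forall U V t c, velocity M U -> velocity M V -> t \in `[a, b] ->
    (forall om, enorm (disp a U t om - disp a V t om) <= c) ->
    forall om, (hausdorff_dist (S (disp a U) t om) (S (disp a V) t om) <= (k t * c)%:E)%E) ->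
  (forall U t om, velocity M U -> t \in `[a, b] ->
    nonempty_compact_convex (S (disp a U) t om)) ->
  (forall U t om p, velocity M U -> t \in `[a, b] -> S (disp a U) t om p -> enorm p <= M) ->
  vmeasurable setT W -> (forall om, enorm (W om) <= M) ->
  (forall t om, t \in `[a, b] ->
    enorm (W om - nproj (S (disp a (fun=> W)) t om) (W om)) <= C * (t - a)) ->
  exists2 U, velocity M U &
  (forall t om, t \in `[a, b] -> S (disp a U) t om (U t om)) /\
  exists C' : R, forall t om, t \in `[a, b] ->
    enorm (disp a U t om - (t - a) *: W om) <= C' * (t - a) ^+ 2.
Proof.
move=> ab C0 k0 k1 mS lipS nccS leS mW leW distW.
have [E [cE E1 Emono intE]] := weight_ex k0 k1.
have [U hU [h1 h2]] := filippov_weighted C0 k0 k1 mS lipS nccS leS mW leW distW cE E1 Emono intE.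
by exists U => //; split => //; exists ((d%:R + 1) * C * E b).
Qed.

End filippov_thm.

(** * Lagrangian solutions of the controlled system *)

Section pushd.
Context {dX} {X : measurableType dX} {dY} {Y : measurableType dY} {R : realType}.

(** Push-forward for maps not known to be measurable, with a default value; it allows the
    law of the crowd to be written for every displacement field. *)
Definition pushd (P0 : probability Y R) (mu : probability X R) (f : X -> Y) : probability Y R :=
  if pselect (measurable_fun setT f) is left mf then push mu mf else P0.

Lemma pushdE P0 mu f (mf : measurable_fun setT f) : pushd P0 mu f = push mu mf.
Proof. by rewrite /pushd; case: pselect => // mf'; rewrite (Prop_irrelevance mf' mf). Qed.

End pushd.

Section hausdorff.
Context {R : realType} {d : nat}.
Local Notation Rd := 'rV[R]_d.
Implicit Types (A B : set Rd).

Lemma hausdorff_nprojr A B q r : nonempty_compact_convex A -> B q ->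
  (hausdorff_dist A B <= r%:E)%E -> enorm (q - nproj A q) <= r.
Proof.
move=> hA Bq; rewrite /hausdorff_dist ge_max => /andP[_ h].
rewrite -lee_fin (le_trans _ h)//.
apply: (@le_trans _ _ (ereal_inf [set (enorm (a - q))%:E | a in A])).
  by apply: le_ereal_inf_tmp => _ [a Aa <-]; rewrite lee_fin [leRHS]enormB nproj_le.
by apply: ereal_sup_ubound; exists q.
Qed.

Lemma ncc_bounded A : nonempty_compact_convex A -> exists B : R, forall p, A p -> enorm p <= B.
Proof.
move=> [A0 cA _].
have [|c Ac hc] := @EVT_max_rV R d enorm A A0 cA.
  by apply: continuous_subspaceT => x; exact: continuous_enorm.
by exists (enorm c) => p Ap; apply: hc; exact/mem_set.
Qed.

End hausdorff.

Section arith.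
Context {R : realType}.
Implicit Types c x y z t : R.
Lemma le_two_three c x y : 0 <= c -> x <= c -> y <= c -> x + y <= 3 * c.
Proof. lra. Qed.

Lemma le_three c x y z : x <= c -> y <= c -> z <= c -> x + y + z <= 3 * c.
Proof. lra. Qed.

Lemma le_add_two c x y t : 0 <= c -> x <= c -> y <= c -> t + x + y <= t + c + c + c.
Proof. lra. Qed.

Lemma le_add_three c x y z t : x <= c -> y <= c -> z <= c -> t + x + y + z <= t + c + c + c.
Proof. lra. Qed.

End arith.

Section lagrangian.
Context {R : realType} {d : nat}.
Local Notation leb := (@lebesgue_measure R).
Local Notation Rd := 'rV[R]_d.
Local Notation T := (torus R d).
Local Notation P := (prob_torus R d).

Section flow.
Variables (a M : R) (mu0 : P) (U : R -> T -> Rd).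
Hypothesis hU : velocity M U.

Definition flow t y : T := tshift y (disp a U t y).
Definition law t : P := pushd mu0 mu0 (flow t).

Lemma disp_lip s t y : enorm (disp a U t y - disp a U s y) <= M * `|t - s|.
Proof. exact: vint_lip (velocity_vbounded y hU). Qed.

Lemma velocity_ge0 : 0 <= M.
Proof. by have [_ h] := hU; rewrite (le_trans (enorm_ge0 (U 0 (tproj 0)))). Qed.

Lemma measurable_disp : vmeasurable setT (fun z : R * T => disp a U z.1 z.2).
Proof. by have [mU _] := hU; exact: measurable_vint. Qed.

Lemma measurable_flow : measurable_fun setT (fun z : R * T => flow z.1 z.2).
Proof. by apply: measurable_tshift; [exact: measurable_snd|exact: measurable_disp]. Qed.

Lemma measurable_flowt t : measurable_fun setT (flow t).
Proof. exact: (measurableT_comp measurable_flow (pair1_measurable t)). Qed.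

Lemma lawE t : law t = push mu0 (measurable_flowt t).
Proof. exact: pushdE. Qed.

Lemma tdist_flow s t y : tdist (flow s y) (flow t y) <= M * `|t - s|.
Proof. by rewrite (le_trans (tdist_tshift _ _ _))// enormB disp_lip. Qed.

Lemma W2_law s t : W2 (law s) (law t) <= M * `|t - s|.
Proof.
rewrite !lawE; apply: W2_push => [|y]; first by rewrite mulr_ge0// velocity_ge0.
exact: tdist_flow.
Qed.

Lemma measurable_law : measurable_fun setT (fun t => law t : prob_borel R d).
Proof.
apply: (@measurability _ _ R (prob_borel R d) setT _ (@W2_open R d)) => //.
move=> _ [A oA <-]; rewrite setTI; apply: open_measurable.
rewrite openE => t /= At; have [r r0 hr] := oA _ At.
have M0 := velocity_ge0.
apply/nbhs_ballP; exists (r / (M + 1)) => /=; first by rewrite divr_gt0// ltr_wpDl.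
move=> s; rewrite /ball/= distrC => hs; apply: hr.
rewrite (le_lt_trans (W2_law _ _))// (le_lt_trans _ (_ : (M + 1) * `|s - t| < r))//.
  by rewrite ler_wpM2r// lerDl.
by rewrite mulrC -ltr_pdivlMr// ltr_wpDl.
Qed.

End flow.

Section curve.
Variables (a M : R) (x0 : T) (u : R -> Rd).
Hypothesis hu : vbounded M u.
Definition agent_path t : T := tshift x0 (vint a t u).

Lemma tdist_path s t : tdist (agent_path s) (agent_path t) <= M * `|t - s|.
Proof. by rewrite (le_trans (tdist_tshift _ _ _))// enormB (vint_lip _ _ _ hu). Qed.

Lemma measurable_path : measurable_fun setT agent_path.
Proof.
have [mu _] := hu.
have mU : vmeasurable setT (fun z : R * unit => u z.1).
  by move=> i; exact: (measurableT_comp (mu i) measurable_fst).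
apply: measurable_tshift => [|i]; first exact: measurable_cst.
have h := @measurable_vint R d _ unit a (fun s (_ : unit) => u s) mU i.
exact: (measurableT_comp h (pair2_measurable tt)).
Qed.

End curve.

Variables (Tf : R) (k : R -> R).
Variables (F : R -> T -> P -> set Rd) (G : R -> T -> T -> P -> set Rd).
Hypothesis k_ge0 : forall t, t \in `[0, Tf] -> 0 <= k t.
Hypothesis k_L1 : leb.-integrable `[0, Tf] (EFin \o k).
Hypothesis hF : F_assumptions Tf F k.
Hypothesis hG : G_assumptions Tf G k.

(** The images at time 0 are within a fixed Hausdorff distance of all the others, because
    the torus, its measures and the time interval have finite diameter. *)
Lemma FG_bounded : 0 <= Tf -> exists M : R, 0 <= M /\
  (forall t x th p, t \in `[0, Tf] -> F t x th p -> enorm p <= M) /\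
  (forall t x y th p, t \in `[0, Tf] -> G t x y th p -> enorm p <= M).
Proof.
move=> T0; have t0 : 0 \in `[0, Tf] by rewrite in_itv/= lexx.
have x0 : T := tproj 0; have th0 : P := dirac x0.
have [_ nccF lipF] := hF; have [_ nccG lipG] := hG.
have [BF hBF] := ncc_bounded (nccF 0 x0 th0 t0).
have [BG hBG] := ncc_bounded (nccG 0 x0 x0 th0 t0).
pose rF := k 0 * (Tf + d%:R + d%:R); pose rG := k 0 * (Tf + d%:R + d%:R + d%:R).
have key t : t \in `[0, Tf] -> `|0 - t| <= Tf.
  by rewrite in_itv/= => /andP[t1 t2]; rewrite sub0r normrN ger0_norm.
exists (Num.max 0 (Num.max (BF + rF) (BG + rG))); split; first by rewrite le_max lexx.
split=> [t x th p tT Fp|t x y th p tT Gp].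
  have h : (hausdorff_dist (F 0%R x0 th0) (F t x th) <= rF%:E)%E.
    rewrite (le_trans (lipF _ _ _ _ _ _ t0 tT))// lee_fin ler_wpM2l ?k_ge0//.
    by rewrite !lerD ?key ?tdist_le ?W2_le_dim.
  have h1 := hausdorff_nprojr (nccF 0 x0 th0 t0) Fp h.
  have h2 := hBF _ (nproj_in p (nccF 0 x0 th0 t0)).
  rewrite !le_max; apply/orP; right; apply/orP; left.
  by rewrite -(subrK (nproj (F 0 x0 th0) p) p) addrC (le_trans (enormD _ _))// lerD.
have h : (hausdorff_dist (G 0%R x0 x0 th0) (G t x y th) <= rG%:E)%E.
  rewrite (le_trans (lipG _ _ _ _ _ _ _ _ t0 tT))// lee_fin ler_wpM2l ?k_ge0//.
  by rewrite !lerD ?key ?tdist_le ?W2_le_dim.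
have h1 := hausdorff_nprojr (nccG 0 x0 x0 th0 t0) Gp h.
have h2 := hBG _ (nproj_in p (nccG 0 x0 x0 th0 t0)).
rewrite !le_max; apply/orP; right; apply/orP; right.
by rewrite -(subrK (nproj (G 0 x0 x0 th0) p) p) addrC (le_trans (enormD _ _))// lerD.
Qed.

Section existence.
Variables (a M : R) (x0 : T) (mu0 : P) (v : Rd) (w : T -> Rd).
Hypothesis aT : 0 <= a <= Tf.
Hypothesis M0 : 0 <= M.
Hypothesis leF : forall t x th p, t \in `[0, Tf] -> F t x th p -> enorm p <= M.
Hypothesis leG : forall t x y th p, t \in `[0, Tf] -> G t x y th p -> enorm p <= M.
Hypothesis Fv : F a x0 mu0 v.
Hypothesis mw : vmeasurable setT w.
Hypothesis Gw : forall y, G a x0 y mu0 (w y).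

Let Om := (bool * T)%type.

Let aab : a \in `[0, Tf]. Proof. by rewrite in_itv. Qed.

Lemma sub0T t : t \in `[a, Tf] -> t \in `[0, Tf].
Proof. by rewrite !in_itv/= => /andP[at_ ->]; rewrite andbT (le_trans _ at_)//; case/andP: aT. Qed.

Let agent (D : R -> Om -> Rd) t : T := tshift x0 (D t (true, x0)).
Let particle (D : R -> Om -> Rd) t y : T := tshift y (D t (false, y)).
Let crowd (D : R -> Om -> Rd) t : P := pushd mu0 mu0 (particle D t).

(** The coupled system as one inclusion over the labels bool * T: (true, x0) is the agent
    and (false, y) the particle that starts at y. *)
Definition dynamics (D : R -> Om -> Rd) t (om : Om) : set Rd :=
  if om.1 then F t (agent D t) (crowd D t) else G t (agent D t) (particle D t om.2) (crowd D t).

Let Ub (b : bool) (U : R -> Om -> Rd) t y := U t (b, y).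

Lemma velocity_Ub b U : velocity M U -> velocity M (Ub b U).
Proof.
move=> [mU hU]; split => [i|t y]; last exact: hU.
have h : measurable_fun setT (fun z : R * T => (z.1, (b, z.2))).
  apply: measurable_fun_pair => //; apply: measurable_fun_pair => //.
exact: (measurableT_comp (mU i) h).
Qed.

Lemma crowdE U : crowd (disp a U) = law a mu0 (Ub false U).
Proof. by []. Qed.

Lemma velocity_agent (U : R -> Om -> Rd) : velocity M U -> vbounded M (fun t => U t (true, x0)).
Proof. exact: velocity_vbounded. Qed.

Lemma measurable_agent_crowd U : velocity M U ->
  measurable_fun setT (fun t => agent (disp a U) t) /\
  measurable_fun setT (fun t => crowd (disp a U) t : prob_borel R d).
Proof.
move=> hU; split; first exact: measurable_path (velocity_agent hU).
exact: measurable_law (velocity_Ub false hU).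
Qed.

Lemma measurable_dynamics U : velocity M U ->
  setvalued_measurable (X := (R * Om)%type) (`[a, Tf] `*` setT)
    (fun z => dynamics (disp a U) z.1 z.2).
Proof.
move=> hU O oO; have [mA mC] := measurable_agent_crowd hU.
have [bF _ _] := hF; have [bG _ _] := hG.
have mz1 : measurable_fun setT (fun z : R * Om => z.1) by exact: measurable_fst.
pose phi (z : R * Om) := (z.1, agent (disp a U) z.1, crowd (disp a U) z.1 : prob_borel R d).
pose psi (z : R * Om) := (z.1, agent (disp a U) z.1, particle (disp a U) z.1 z.2.2,
  crowd (disp a U) z.1 : prob_borel R d).
have mphi : measurable_fun setT phi.
  apply: measurable_fun_pair; last exact: (measurableT_comp mC mz1).
  by apply: measurable_fun_pair => //; exact: (measurableT_comp mA mz1).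
have mpsi : measurable_fun setT psi.
  apply: measurable_fun_pair; last exact: (measurableT_comp mC mz1).
  apply: measurable_fun_pair.
    by apply: measurable_fun_pair => //; exact: (measurableT_comp mA mz1).
  have h : measurable_fun setT (fun z : R * Om => (z.1, z.2.2)).
    by apply: measurable_fun_pair => //; exact: (measurableT_comp measurable_snd measurable_snd).
  exact: (measurableT_comp (measurable_flow a (velocity_Ub false hU)) h).
have mD : measurable (`[a, Tf] `*` setT : set (R * Om)) by exact: measurableX.
have mB : measurable [set z : R * Om | z.2.1 = true].
  have h : measurable_fun setT (fun z : R * Om => z.2.1).
    exact: (measurableT_comp measurable_fst measurable_snd).
  by have := h measurableT [set true] Logic.I; rewrite setTI.
have hphi := mphi measurableT _ (bF _ oO); rewrite setTI in hphi.
have hpsi := mpsi measurableT _ (bG _ oO); rewrite setTI in hpsi.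
rewrite (_ : _ `&` _ = (`[a, Tf] `*` setT) `&`
  (([set z : R * Om | z.2.1 = true] `&` phi @^-1` ((`[0, Tf] `*` setT `*` setT) `&`
     [set z | F z.1.1 z.1.2 z.2 `&` O !=set0])) `|`
   (~` [set z : R * Om | z.2.1 = true] `&` psi @^-1` ((`[0, Tf] `*` setT `*` setT `*` setT) `&`
     [set z | G z.1.1.1 z.1.1.2 z.1.2 z.2 `&` O !=set0])))).
  apply: measurableI => //; apply: measurableU; apply: measurableI => //.
  exact: measurableC.
apply/seteqP; split => -[t [[] y]] [[/= tab _]] /=; rewrite /dynamics/=.
- by move=> h; split => //; left; split => //; split => //=; split => //; split => //; exact: sub0T.
- move=> h; split => //; right; split => //; split => //=; split => //; split => //; split => //.
  exact: sub0T.
- by move=> [[_ [_ h]]|[]].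
- by move=> [[]|[_ [_ h]]].
Qed.

(** A uniform bound on displacements bounds the distances of positions, and the transport
    distance of the two laws through the coupling that keeps labels. *)
Lemma lip_dynamics U V t c : velocity M U -> velocity M V -> t \in `[a, Tf] ->
  (forall om, enorm (disp a U t om - disp a V t om) <= c) ->
  forall om, (hausdorff_dist (dynamics (disp a U) t om) (dynamics (disp a V) t om) <=
    (3 * k t * c)%:E)%E.
Proof.
move=> hU hV /sub0T tab hc [bb y]; rewrite /dynamics/=.
have c0 : 0 <= c by rewrite (le_trans _ (hc (true, x0)))// enorm_ge0.
have [_ _ lF] := hF; have [_ _ lG] := hG.
have hA : tdist (agent (disp a U) t) (agent (disp a V) t) <= c.
  by rewrite (le_trans (tdist_tshift _ _ _)).
have hP z : tdist (particle (disp a U) t z) (particle (disp a V) t z) <= c.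
  by rewrite (le_trans (tdist_tshift _ _ _)).
have hC : W2 (crowd (disp a U) t) (crowd (disp a V) t) <= c.
  rewrite !crowdE (lawE a mu0 (velocity_Ub false hU)) (lawE a mu0 (velocity_Ub false hV)).
  exact: W2_push.
have kt := k_ge0 tab.
case: bb.
  rewrite (le_trans (lF _ _ _ _ _ _ tab tab))// lee_fin subrr normr0 add0r.
  rewrite -mulrA mulrCA ler_wpM2l//.
  exact: (le_two_three c0 hA hC).
rewrite (le_trans (lG _ _ _ _ _ _ _ _ tab tab))// lee_fin subrr normr0 add0r.
rewrite -mulrA mulrCA ler_wpM2l//.
exact: (le_three hA (hP y) hC).
Qed.

Let W (om : Om) : Rd := if om.1 then v else w om.2.

Lemma measurable_W : vmeasurable setT W.
Proof.
move=> i; rewrite (_ : (fun om => _) = (fun om : Om => if om.1 then v 0 i else w om.2 0 i)).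
  exact: (measurable_fun_ifT measurable_fst (measurable_cst _)
    (measurableT_comp (mw i) measurable_snd)).
by apply/funext => -[[] y].
Qed.

Lemma le_W om : enorm (W om) <= M.
Proof. by case: om => -[] y; rewrite /W/=; [exact: leF Fv|exact: leG (Gw y)]. Qed.

(** The straight motion nearly solves the inclusion: at time t it misses the image by
    k(a) (1 + 3 M) (t - a), because the Hausdorff estimate between the times a and t may be
    written with the constant of time a. *)
Lemma lagrangian_ex : exists u U, [/\ vbounded M u, velocity M U,
  forall t, t \in `[a, Tf] -> F t (agent_path a x0 u t) (law a mu0 U t) (u t),
  forall t y, t \in `[a, Tf] -> G t (agent_path a x0 u t) (flow a U t y) (law a mu0 U t) (U t y) &
  exists C : R, forall t, t \in `[a, Tf] ->
    enorm (vint a t u - (t - a) *: v) <= C * (t - a) ^+ 2 /\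
    forall y, enorm (disp a U t y - (t - a) *: w y) <= C * (t - a) ^+ 2].
Proof.
have a0 : 0 <= a by case/andP: aT.
have aTf : a <= Tf by case/andP: aT.
have [_ nccF lF] := hF; have [_ nccG lG] := hG.
have hW : velocity M (fun=> W).
  split => [i|_ om]; last exact: le_W.
  exact: (measurableT_comp (measurable_W i) measurable_snd).
have ka := k_ge0 aab.
have [] := @filippov R d _ Om a Tf M (k a * (1 + 3 * M)) (fun t => 3 * k t) dynamics W aTf.
- by rewrite mulr_ge0// addr_ge0// mulr_ge0.
- by move=> t /sub0T tT; rewrite mulr_ge0// k_ge0.
- rewrite (_ : EFin \o _ = EFin \o (fun t => k t * 3)); last by apply/funext => t /=; rewrite mulrC.
  apply: (@itv_integrableM _ _ _ _ (fun=> 3) 3) => //; last by move=> t _; rewrite ger0_norm.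
  exact: integrable_subitv k_L1.
- exact: measurable_dynamics.
- by move=> U V t c hU hV tab hc om; exact: lip_dynamics.
- move=> U t [[] y] hU /sub0T tab; [exact: nccF|exact: nccG].
- by move=> U t [[] y] p hU /sub0T tab; [exact: leF|exact: leG].
- exact: measurable_W.
- exact: le_W.
- move=> t om tab; have tT := sub0T tab.
  have [at_ tb] : a <= t /\ t <= Tf by move: tab; rewrite in_itv/= => /andP.
  have ta0 : `|a - t| = t - a by rewrite distrC ger0_norm// subr_ge0.
  have hd om' : enorm (disp a (fun=> W) t om') <= M * (t - a).
    rewrite /disp vint_cst// enormZ ger0_norm ?subr_ge0// mulrC ler_wpM2r ?subr_ge0//.
    exact: le_W.
  have hA : tdist x0 (agent (disp a (fun=> W)) t) <= M * (t - a).
    by rewrite (le_trans (tdist_min (erefl _))).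
  have hP y : tdist y (particle (disp a (fun=> W)) t y) <= M * (t - a).
    by rewrite (le_trans (tdist_min (erefl _))).
  have hC : W2 mu0 (crowd (disp a (fun=> W)) t) <= M * (t - a).
    have hid : same_meas mu0 (push mu0 (@measurable_id _ T setT)) by [].
    rewrite !crowdE (lawE a mu0 (velocity_Ub false hW)).
    rewrite (W2_same_meas hid (fun A _ => erefl _)).
    by apply: W2_push => //; rewrite mulr_ge0// subr_ge0.
  have e : k a * (1 + 3 * M) * (t - a) = k a * (t - a + M * (t - a) + M * (t - a) + M * (t - a)) by ring.
  have Mt : 0 <= M * (t - a) by rewrite mulr_ge0// subr_ge0.
  case: om => -[] y.
    apply: (hausdorff_nproj (A := F a x0 mu0)) => //; first exact: nccF.
    rewrite (le_trans (lF _ _ _ _ _ _ aab tT))// lee_fin ta0 e ler_wpM2l//.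
    exact: (le_add_two _ Mt hA hC).
  apply: (hausdorff_nproj (A := G a x0 y mu0)) => //; first exact: nccG.
  rewrite (le_trans (lG _ _ _ _ _ _ _ _ aab tT))// lee_fin ta0 e ler_wpM2l//.
  exact: (le_add_three _ hA (hP y) hC).
move=> U hU [hS [C hC]].
exists (fun t => U t (true, x0)), (Ub false U); split.
- exact: velocity_agent.
- exact: velocity_Ub.
- by move=> t tab; exact: (hS t (true, x0) tab).
- by move=> t y tab; exact: (hS t (false, y) tab).
- exists C => t tab; split; first exact: (hC t (true, x0) tab).
  by move=> y; exact: (hC t (false, y) tab).
Qed.

End existence.
End lagrangian.

(** * Conditional expectation and convexity *)

Section density.
Context {dX} {X : measurableType dX} {dY} {Y : measurableType dY} {R : realType}.
Variables (P : probability X R) (f : X -> R) (M : R) (phi : X -> Y).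

(** The image under phi of the measure with density f with respect to P. The
    hypotheses are parameters of the constant, so that the measure structure can be attached
    to it. *)
Definition mdens (mphi : measurable_fun setT phi) (mf : measurable_fun setT f)
  (f0 : forall x, 0 <= f x) (fM : forall x, f x <= M) (B : set Y) : \bar R :=
  (\int[P]_(x in phi @^-1` B) (f x)%:E)%E.

Hypotheses (mphi : measurable_fun setT phi) (mf : measurable_fun setT f)
  (f0 : forall x, 0 <= f x) (fM : forall x, f x <= M).
Local Notation nu := (mdens mphi mf f0 fM).

Lemma measurable_preimage B : measurable B -> measurable (phi @^-1` B).
Proof. by move=> mB; rewrite -[X in measurable X]setTI; exact: mphi. Qed.

Lemma mdens0 : nu set0 = 0%E.
Proof. by rewrite /nu preimage_set0 integral_set0. Qed.

Lemma mdens_ge0 B : (0 <= nu B)%E.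
Proof. by apply: integral_ge0 => x _; rewrite lee_fin. Qed.

Lemma mdens_sigma : semi_sigma_additive nu.
Proof.
move=> A mA tA mUA.
have h := @semi_sigma_additive_nng_induced _ X R P (EFin \o f) ((measurable_EFinP _ _).2 mf) _
  (fun n => phi @^-1` A n).
rewrite /nu preimage_bigcup; apply: h.
- by move=> x; rewrite lee_fin.
- by move=> n; exact: measurable_preimage.
- move/trivIsetP: tA => tA'; apply/trivIsetP => i j _ _ ij.
  by rewrite -preimage_setI tA'// preimage_set0.
- by apply: bigcup_measurable => n _; exact: measurable_preimage.
Qed.

HB.instance Definition _ := isMeasure.Build _ _ _ nu mdens0 mdens_ge0 mdens_sigma.

Lemma mdens_fin : fin_num_fun nu.
Proof.
move=> B mB; apply: integrable_fin_num => //; first exact: measurable_preimage.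
apply: (integrableS measurableT) => //; first exact: measurable_preimage.
by apply: (@prob_integrable _ _ _ _ _ M) => // x; rewrite ger0_norm.
Qed.

HB.instance Definition _ := @Measure_isFinite.Build _ _ _ nu mdens_fin.

Definition mdens_measure : {finite_measure set Y -> \bar R} := nu.

Lemma mdens_dominated : mdens_measure `<< push P mphi.
Proof.
apply/null_content_dominatesP => B mB; rewrite /push /= => hB.
by rewrite /mdens_measure /= /mdens; apply: null_set_integral => //;
  [exact: measurable_preimage|exact/measurable_EFinP/measurable_funTS].
Qed.

End density.

Section condexp.
Context {dX} {X : measurableType dX} {dY} {Y : measurableType dY} {R : realType}.
Variable (P : probability X R).

(** The density of the image of U P with respect to the image of P. Testing against
    nonnegative g is the change of variables for this density, applied once on Y
    and once on X, where the density of U P is U itself. *)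
Lemma condexp_ge0 (phi : X -> Y) (mphi : measurable_fun setT phi) (U : X -> R) (M : R) :
  measurable_fun setT U -> (forall x, 0 <= U x) -> (forall x, U x <= M) ->
  exists r : Y -> R, [/\ measurable_fun setT r, (push P mphi).-integrable setT (EFin \o r) &
    forall g : Y -> R, measurable_fun setT g -> (forall y, 0 <= g y) ->
      (\int[push P mphi]_y (g y * r y)%:E = \int[P]_x (g (phi x) * U x)%:E)%E].
Proof.
move=> mU U0 UM.
have mid := @measurable_id _ X setT.
pose nu := mdens_measure P mphi mU U0 UM; pose nu0 := mdens_measure P mid mU U0 UM.
have dnu : nu `<< push P mphi := @mdens_dominated _ _ _ _ _ P U M phi mphi mU U0 UM.
have dnu0 : nu0 `<< P.
  have h := @mdens_dominated _ _ _ _ _ P U M id mid mU U0 UM.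
  by apply: (null_content_dominatesP _ _).2 => A mA PA; apply: (null_content_dominatesP _ _).1 h A mA PA.
pose rho := Radon_Nikodym_SigmaFinite.f nu (push P mphi).
pose rho0 := Radon_Nikodym_SigmaFinite.f nu0 P.
have rho_fin y : rho y \is a fin_num := Radon_Nikodym_SigmaFinite.f_fin_num dnu y.
have rho_int : (push P mphi).-integrable setT rho := Radon_Nikodym_SigmaFinite.f_integrable dnu.
have mrho : measurable_fun setT rho by exact: measurable_int rho_int.
have rhoE : EFin \o (fine \o rho) = rho by apply/funext => y /=; rewrite fineK.
have iU : P.-integrable setT (EFin \o U).
  by apply: (@prob_integrable _ _ _ _ _ M) => // x; rewrite ger0_norm.
have rho0U : ae_eq P setT rho0 (EFin \o U).
  apply: integral_ae_eq => //.
  - exact: Radon_Nikodym_SigmaFinite.f_integrable.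
  - exact/measurable_EFinP.
  - by move=> A _ mA; rewrite -Radon_Nikodym_SigmaFinite.f_integral.
exists (fine \o rho); split.
- exact: (measurableT_comp (@fine_measurable R setT measurableT)).
- by rewrite rhoE.
move=> g mg g0.
have mg' : measurable_fun setT (EFin \o g) by exact/measurable_EFinP.
have mgphi : measurable_fun setT (fun x => (g (phi x))%:E).
  by apply/measurable_EFinP; exact: (measurableT_comp mg mphi).
have g0' y : (0 <= (EFin \o g) y)%E by rewrite lee_fin.
transitivity (\int[push P mphi]_y ((EFin \o g) y * rho y))%E.
  by apply: eq_integral => y _; rewrite /= EFinM fineK.
rewrite (Radon_Nikodym_SigmaFinite.change_of_variables dnu g0' measurableT mg').
transitivity (\int[nu0]_x ((EFin \o g) (phi x)))%E.
  have h := ge0_integral_pushforward mphi nu0 measurableT mg' (fun y _ => g0' y).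
  by rewrite preimage_setT in h; exact: h.
rewrite -(Radon_Nikodym_SigmaFinite.change_of_variables dnu0 (fun x => g0' (phi x)) measurableT mgphi).
apply: ae_eq_integral => //.
- by apply: emeasurable_funM => //; exact: measurable_int (Radon_Nikodym_SigmaFinite.f_integrable dnu0).
- by apply/measurable_EFinP; apply: measurable_funM => //; exact: (measurableT_comp mg mphi).
- have := ae_eqe_mul2l (fun x => (g (phi x))%:E) rho0U.
  by apply: filterS => x h Dx; rewrite (h Dx) -EFinM.
Qed.

(** Bounded functions of any sign are reduced to nonnegative ones by adding a constant. *)
Lemma condexp (phi : X -> Y) (mphi : measurable_fun setT phi) (U : X -> R) (M : R) :
  measurable_fun setT U -> (forall x, `|U x| <= M) ->
  exists v : Y -> R, [/\ measurable_fun setT v, (push P mphi).-integrable setT (EFin \o v) &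
    forall (g : Y -> R) B, measurable_fun setT g -> (forall y, `|g y| <= B) ->
      \int[push P mphi]_y (g y * v y) = \int[P]_x (g (phi x) * U x)].
Proof.
move=> mU UM.
have [|||r [mr ir hr]] := @condexp_ge0 phi mphi (fun x => U x + M) (M + M).
- exact: measurable_funD.
- by move=> x; have := UM x; rewrite ler_norml => /andP[]; lra.
- by move=> x; have := UM x; rewrite ler_norml => /andP[]; lra.
pose m := push P mphi.
have hM (c : R) : m.-integrable setT (EFin \o (fun=> c)).
  exact: (@prob_integrable _ _ _ _ _ `|c|).
exists (fun y => r y - M); split.
- exact: measurable_funB.
- have := integrableB measurableT ir (hM M).
  by apply: eq_integrable => // y _; rewrite /= EFinB.
move=> g B mg gB.
have mgphi : measurable_fun setT (fun x => g (phi x)) by exact: (measurableT_comp mg mphi).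
have bg : [bounded g y | y in setT].
  by exists B; split; [exact: num_real|move=> N BN y _; exact: le_trans (gB y) (ltW BN)].
have igr (h : Y -> R) B' : measurable_fun setT h -> (forall y, `|h y| <= B') ->
    m.-integrable setT (EFin \o (fun y => h y * r y)).
  move=> mh hB'.
  have bh : [bounded h y | y in setT].
    by exists B'; split; [exact: num_real|move=> N BN y _; exact: le_trans (hB' y) (ltW BN)].
  exact: (integrableMr measurableT mh bh ir).
have hr' (h : Y -> R) : measurable_fun setT h -> (forall y, 0 <= h y) ->
    \int[m]_y (h y * r y) = \int[P]_x (h (phi x) * (U x + M)).
  by move=> mh h0; rewrite /Rintegral hr.
have iP (h : X -> R) B' : measurable_fun setT h -> (forall x, `|h x| <= B') ->
    P.-integrable setT (EFin \o h) by exact: prob_integrable.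
have B0 : 0 <= B by rewrite (le_trans _ (gB (phi point)))//.
have M0 : 0 <= M by rewrite (le_trans _ (UM point))//.
have nUM x : `|U x + M| <= M + M by rewrite (le_trans (ler_normD _ _))// lerD// ger0_norm.
have i1 : P.-integrable setT (EFin \o (fun x => g (phi x) * (U x + M))).
  apply: (iP _ (B * (M + M))); first by apply: measurable_funM => //; exact: measurable_funD.
  by move=> x; rewrite normrM ler_pM.
have i2 : P.-integrable setT (EFin \o (fun x => B * (U x + M))).
  apply: (iP _ (B * (M + M))); first by apply: measurable_funM => //; exact: measurable_funD.
  by move=> x; rewrite normrM (ger0_norm B0) ler_wpM2l.
have i3 : P.-integrable setT (EFin \o (fun x => g (phi x) * M)).
  apply: (iP _ (B * M)); first exact: measurable_funM.
  by move=> x; rewrite normrM (ger0_norm M0) ler_wpM2r.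
have e1 : \int[m]_y (g y * r y) = \int[P]_x (g (phi x) * (U x + M)).
  have gB0 y : 0 <= g y + B by have := gB y; rewrite ler_norml => /andP[]; lra.
  have := hr' (fun y => g y + B) (measurable_funD mg (measurable_cst _)) gB0.
  have -> : \int[m]_y ((g y + B) * r y) = \int[m]_y (g y * r y) + \int[m]_y (B * r y).
    rewrite -RintegralD//; [|exact: igr mg gB|].
      by apply: eq_Rintegral => y _; rewrite mulrDl.
    by apply: (igr (fun=> B) B) => // y; rewrite ger0_norm.
  have -> : \int[P]_x ((g (phi x) + B) * (U x + M)) =
     \int[P]_x (g (phi x) * (U x + M)) + \int[P]_x (B * (U x + M)).
    by rewrite -RintegralD//; apply: eq_Rintegral => x _; rewrite mulrDl.
  by rewrite (hr' (fun=> B))//; apply: addIr.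
have e2 : \int[m]_y (g y * M) = \int[P]_x (g (phi x) * M).
  by rewrite Rintegral_push//; exact: measurable_funM.
transitivity (\int[m]_y (g y * r y) - \int[m]_y (g y * M)).
  rewrite -RintegralB//; [|exact: igr mg gB|].
    by apply: eq_Rintegral => y _; rewrite mulrBr.
  apply: (@prob_integrable _ _ _ _ _ (B * M)); first exact: measurable_funM.
  by move=> y; rewrite normrM (ger0_norm M0) ler_wpM2r.
rewrite e1 e2 -RintegralB//.
by apply: eq_Rintegral => x _; rewrite mulrDr addrK.
Qed.

End condexp.

Section sum_integral.
Context {R : realType} {d : nat}.
Local Notation Rd := 'rV[R]_d.
Context {dY} {Y : measurableType dY}.

Lemma dotv_integrable (m : probability Y R) (g v : Y -> Rd) B :
  vmeasurable setT g -> (forall y, enorm (g y) <= B) ->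
  (forall i, m.-integrable setT (EFin \o (fun y => v y 0 i))) ->
  (forall i, m.-integrable setT (EFin \o (fun y => g y 0 i * v y 0 i))) /\
  m.-integrable setT (EFin \o (fun y => dotv (g y) (v y))).
Proof.
move=> mg gB iv.
have h i : m.-integrable setT (EFin \o (fun y => g y 0 i * v y 0 i)).
  have bg : [bounded g y 0 i | y in setT].
    exists B; split; first exact: num_real.
    move=> N BN y _; apply: le_trans (le_coord_enorm _ _) _.
    exact: le_trans (gB y) (ltW BN).
  exact: (integrableMr measurableT (mg i) bg (iv i)).
split => //.
have := @integrable_sum _ _ _ m setT measurableT _ (index_enum 'I_d) predT
  (fun i => EFin \o (fun y => g y 0 i * v y 0 i)) (fun i _ => h i).
by apply: eq_integrable => // y _; rewrite /= sumEFin.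
Qed.

Lemma Rintegral_sumv (m : probability Y R) (f : 'I_d -> Y -> R) :
  (forall i, m.-integrable setT (EFin \o f i)) ->
  \int[m]_y (\sum_(i < d) f i y) = \sum_(i < d) \int[m]_y f i y.
Proof.
move=> hf.
have H (r : seq 'I_d) : m.-integrable setT (EFin \o (fun y => \sum_(i <- r) f i y)) /\
    \int[m]_y (\sum_(i <- r) f i y) = \sum_(i <- r) \int[m]_y f i y.
  elim: r => [|i r [ih1 ih2]].
    split; last by rewrite big_nil; under eq_Rintegral do rewrite big_nil;
      rewrite Rintegral_cst// mul0r.
    by apply: (@prob_integrable _ _ _ _ _ 0) => [|y]; rewrite ?big_nil ?normr0//;
      under eq_fun do rewrite big_nil; exact: measurable_cst.
  split.
    have := integrableD measurableT (hf i) ih1.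
    by apply: eq_integrable => // y _; rewrite /= big_cons EFinD.
  rewrite big_cons -ih2 -RintegralD//.
  by apply: eq_Rintegral => y _; rewrite big_cons.
by have [] := H (index_enum 'I_d).
Qed.

End sum_integral.

Section convex_condexp.
Context {R : realType} {d : nat}.
Local Notation Rd := 'rV[R]_d.
Context {dX} {X : measurableType dX} {dY} {Y : measurableType dY}.

Lemma vmeasurable_comp (phi : X -> Y) (g : Y -> Rd) : measurable_fun setT phi ->
  vmeasurable setT g -> vmeasurable setT (fun x => g (phi x)).
Proof. by move=> mphi mg i; exact: (measurableT_comp (mg i) mphi). Qed.

Lemma Rintegral_dotv_push (P : probability X R) (phi : X -> Y) (mphi : measurable_fun setT phi)
  (g v : Y -> Rd) (U : X -> Rd) B M :
  vmeasurable setT g -> (forall y, enorm (g y) <= B) ->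
  vmeasurable setT U -> (forall x, enorm (U x) <= M) ->
  (forall i, (push P mphi).-integrable setT (EFin \o (fun y => v y 0 i))) ->
  (forall i (h : Y -> R) B', measurable_fun setT h -> (forall y, `|h y| <= B') ->
    \int[push P mphi]_y (h y * v y 0 i) = \int[P]_x (h (phi x) * U x 0 i)) ->
  \int[push P mphi]_y dotv (g y) (v y) = \int[P]_x dotv (g (phi x)) (U x).
Proof.
move=> mg gB mU UM iv hv.
have [igv _] := dotv_integrable mg gB iv.
rewrite Rintegral_sumv//.
have iU i : P.-integrable setT (EFin \o (fun x => U x 0 i)).
  apply: (@prob_integrable _ _ _ _ _ M); first exact: mU.
  by move=> x; rewrite (le_trans (le_coord_enorm _ _)).
have mgphi := vmeasurable_comp mphi mg.
have igU i : P.-integrable setT (EFin \o (fun x => g (phi x) 0 i * U x 0 i)).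
  apply: (@prob_integrable _ _ _ _ _ (B * M)).
    by apply: measurable_funM; [exact: mgphi|exact: mU].
  move=> x; rewrite normrM ler_pM//.
    by rewrite (le_trans (le_coord_enorm _ _)).
  by rewrite (le_trans (le_coord_enorm _ _)).
rewrite [RHS]Rintegral_sumv//.
apply: eq_bigr => i _; apply: (hv i (fun y => g y 0 i) B); first exact: mg.
by move=> y; rewrite (le_trans (le_coord_enorm _ _)).
Qed.

Lemma ge0_Rintegral_eq0_ae (m : probability Y R) (f : Y -> R) :
  m.-integrable setT (EFin \o f) -> (forall y, 0 <= f y) -> \int[m]_y f y <= 0 ->
  ae_eq m setT f (cst 0).
Proof.
move=> fi f0 hf.
have mf : measurable_fun setT (EFin \o f) by exact: measurable_int fi.
have I0 : (0 <= \int[m]_y (f y)%:E)%E by apply: integral_ge0 => y _; rewrite lee_fin.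
have : (\int[m]_y `|(EFin \o f) y| = 0)%E.
  rewrite (eq_integral (EFin \o f)); last by move=> y _; rewrite /= ger0_norm.
  have fn : (\int[m]_y (EFin \o f) y)%E \is a fin_num by exact: integrable_fin_num.
  apply/eqP; rewrite eq_le I0 andbT -(fineK fn) lee_fin; exact: hf.
move=> /(ae_eq_integral_abs m measurableT mf).
by apply: filterS => y /[apply] -[].
Qed.

Lemma ae_eq_Rintegral (m : probability Y R) (f g : Y -> R) :
  measurable_fun setT f -> measurable_fun setT g -> ae_eq m setT f g ->
  \int[m]_y f y = \int[m]_y g y.
Proof.
move=> mf mg fg; rewrite /Rintegral; congr fine.
apply: ae_eq_integral => //; try exact/measurable_EFinP.
by apply: filterS fg => y /[apply] ->.
Qed.

(** A bounded multiple of z with the same direction, so that a field that is only known to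
    be integrable can be tested against itself. *)
Definition damp (z : Rd) : Rd := (1 + dotv z z)^-1 *: z.

Lemma enorm_damp z : enorm (damp z) <= 1.
Proof.
have z0 := dotv_ge0 z; have p : 0 < 1 + dotv z z by lra.
rewrite /damp enormZ ger0_norm ?invr_ge0 ?(ltW p)// mulrC ler_pdivrMr// mul1r -sqr_enorm.
have := sqr_ge0 (enorm z - 1); rewrite sqrrB mulr1 expr1n; have := sqr_ge0 (enorm z); lra.
Qed.

Lemma vmeasurable_damp (f : Y -> Rd) : vmeasurable setT f -> vmeasurable setT (fun y => damp (f y)).
Proof.
move=> mf i; under eq_fun do rewrite mxE.
apply: measurable_funM; last exact: mf.
have cinv : continuous (fun x : R => (1 + `|x|)^-1).
  move=> x; have h : 1 + `|x| != 0 by rewrite gt_eqF// ltr_pwDl.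
  apply: cvgV => //.
  by apply: cvgD; [exact: cvg_cst|exact: norm_continuous].
have := measurableT_comp (continuous_measurable_fun cinv) (measurable_dotv mf mf).
by apply: eq_measurable_fun => y _; rewrite /= ger0_norm// dotv_ge0.
Qed.

(** Let v be the conditional expectation of U and p its pointwise projection on C. Tested with
    a positive multiple of v - p, the defining property of v and the variational inequality of
    the projection give that <v - p, v - p> has zero weighted integral: v = p almost everywhere. *)
Lemma convex_condexp (P : probability X R) (phi : X -> Y) (mphi : measurable_fun setT phi)
    (U : X -> Rd) (M : R) (C : Y -> set Rd) :
  vmeasurable setT U -> setvalued_measurable setT C ->
  (forall y, nonempty_compact_convex (C y)) -> (forall y u, C y u -> enorm u <= M) ->
  (forall x, C (phi x) (U x)) ->
  exists p : Y -> Rd, [/\ vmeasurable setT p, forall y, C y (p y) &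
    forall g B, vmeasurable setT g -> (forall y, enorm (g y) <= B) ->
      \int[push P mphi]_y dotv (g y) (p y) = \int[P]_x dotv (g (phi x)) (U x)].
Proof.
move=> mU mC nC CM UC; set m := push P mphi.
have UM x : enorm (U x) <= M by exact: CM (UC x).
have UMi i x : `|U x 0 i| <= M by rewrite (le_trans (le_coord_enorm _ _)).
have hv i := condexp P mphi (mU i) (UMi i).
have [v' hv'] := choice hv.
pose v y : Rd := \row_i v' i y.
have vE i : (fun y => v y 0 i) = v' i by apply/funext => y; rewrite mxE.
have mv : vmeasurable setT v by move=> i; rewrite vE; have [] := hv' i.
have iv i : m.-integrable setT (EFin \o (fun y => v y 0 i)) by rewrite vE; have [] := hv' i.
have cv g B : vmeasurable setT g -> (forall y, enorm (g y) <= B) ->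
    \int[m]_y dotv (g y) (v y) = \int[P]_x dotv (g (phi x)) (U x).
  move=> mg gB; apply: (Rintegral_dotv_push mg gB mU UM iv).
  move=> i h B' mh hB'; have [_ _ H] := hv' i.
  by rewrite -(H h B')//; apply: eq_Rintegral => y _; rewrite mxE.
pose p y := nproj (C y) (v y).
have pC y : C y (p y) by exact: nproj_in.
have mp : vmeasurable setT p by exact: vmeasurable_nproj.
have pM y : enorm (p y) <= M by exact: CM (pC y).
have mpphi := vmeasurable_comp mphi mp.
(* v is only integrable, so it is tested with the bounded field damp (v - p) *)
pose z y := v y - p y.
have mz : vmeasurable setT z.
  move=> i; rewrite (_ : (fun y => _) = (fun y => v y 0 i - p y 0 i)).
    by apply: measurable_funB; [exact: mv|exact: mp].
  by apply/funext => y; rewrite /z mxE [X in _ + X]mxE.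
pose g y := damp (z y).
have mg : vmeasurable setT g by exact: vmeasurable_damp.
have g1 y : enorm (g y) <= 1 by exact: enorm_damp.
have mgphi := vmeasurable_comp mphi mg.
have ip i : m.-integrable setT (EFin \o (fun y => p y 0 i)).
  apply: (@prob_integrable _ _ _ _ _ M); first exact: mp.
  by move=> y; rewrite (le_trans (le_coord_enorm _ _)).
have [_ igv] := dotv_integrable mg g1 iv.
have [_ igp] := dotv_integrable mg g1 ip.
have bound (a b : Rd) : enorm a <= 1 -> enorm b <= M -> `|dotv a b| <= M.
  move=> ha hb; rewrite (le_trans (normr_dotv_le _ _))// -[leRHS]mul1r ler_pM// ?enorm_ge0//.
have igz : m.-integrable setT (EFin \o (fun y => dotv (g y) (z y))).
  have := integrableB measurableT igv igp.
  by apply: eq_integrable => // y _; rewrite /= -EFinB -dotvBr.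
have gz0 y : 0 <= dotv (g y) (z y).
  by rewrite /g /damp dotvZl mulr_ge0// ?dotv_ge0// invr_ge0 addr_ge0// dotv_ge0.
have z0 : ae_eq m setT (fun y => dotv (g y) (z y)) (cst 0).
  apply: ge0_Rintegral_eq0_ae => //.
  have -> : \int[m]_y dotv (g y) (z y) = \int[m]_y dotv (g y) (v y) - \int[m]_y dotv (g y) (p y).
    by rewrite -RintegralB//; apply: eq_Rintegral => y _; rewrite dotvBr.
  rewrite (cv _ _ mg g1) Rintegral_push; last exact: measurable_dotv.
  have bb q : vmeasurable setT q -> (forall x, enorm (q x) <= M) ->
      P.-integrable setT (EFin \o (fun x => dotv (g (phi x)) (q x))).
    move=> mq hq; apply: (@prob_integrable _ _ _ _ _ M); first exact: measurable_dotv.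
    by move=> x; exact: bound.
  rewrite subr_le0; apply: le_Rintegral => //; [exact: bb|exact: bb|].
  move=> x _; rewrite -subr_le0 -dotvBr /g /damp dotvZl.
  rewrite pmulr_rle0; first exact: nproj_dotv_le0.
  by rewrite invr_gt0 ltr_pwDl// dotv_ge0.
exists p; split => // h B mh hB.
rewrite -(cv _ _ mh hB).
apply: ae_eq_Rintegral; [exact: measurable_dotv|exact: measurable_dotv|].
apply: filterS z0 => y /[apply] /= hy.
have zy : z y = 0.
  apply: enorm_eq0.
  move: hy; rewrite /g /damp dotvZl => /eqP; rewrite mulf_eq0 => /orP[|].
    by rewrite invr_eq0 => /eqP hh; have := dotv_ge0 (z y); lra.
  by move=> /eqP hh; rewrite /enorm hh sqrtr0.
by have /subr0_eq -> := zy.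
Qed.

End convex_condexp.

Section time_prob.
Context {R : realType} {dY} {Y : measurableType dY}.
Local Notation leb := (@lebesgue_measure R).

Let RL := measurableTypeR R.

Lemma measurable_idL : @measurable_fun _ _ RL R setT (fun t => t).
Proof. by move=> _ A mA; rewrite setTI. Qed.

Definition unif (a b : R) (ab : a < b) : probability R R :=
  push (uniform_prob ab : probability RL R) measurable_idL.

Lemma Rintegral_uniform (a b : R) (ab : a < b) (f : R -> R) B :
  measurable_fun setT f -> (forall t, `|f t| <= B) ->
  \int[(unif ab)]_t f t = (b - a)^-1 * \int[leb]_(t in `[a, b]) f t.
Proof.
move=> mf fB.
have f0 t : (0 <= (f t + B)%:E)%E.
  by rewrite lee_fin; have := fB t; rewrite ler_norml => /andP[]; lra.
have mfB : measurable_fun setT (fun t => (f t + B)%:E).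
  by apply/measurable_EFinP; apply: measurable_funD => //; exact: measurable_cst.
have ii : leb.-integrable `[a, b] (EFin \o f) by exact: (itv_integrable mf (fun t _ => fB t)).
have ic : leb.-integrable `[a, b] (EFin \o (fun=> B)).
  by apply: (@itv_integrable _ _ _ _ `|B|).
have hB : \int[(unif ab)]_t (f t + B) =
    (b - a)^-1 * \int[leb]_(t in `[a, b]) (f t + B).
  rewrite /unif Rintegral_push; last by apply: measurable_funD => //; exact: measurable_cst.
  rewrite /Rintegral (integral_uniform ab mfB f0) fineM//.
  have : leb.-integrable `[a, b] (EFin \o (fun t => f t + B)).
    apply: (@itv_integrable _ _ _ _ (B + `|B|)); first exact: measurable_funD.
    by move=> t _; rewrite (le_trans (ler_normD _ _))// lerD2r.
  by move=> /integrable_fin_num -> //.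
move: hB; rewrite RintegralD//; first last.
- exact: (@prob_integrable _ _ _ _ _ `|B|).
- exact: (@prob_integrable _ _ _ _ _ B).
rewrite [in RHS]RintegralD// !Rintegral_cst// fine_leb_itv ?(ltW ab)//.
rewrite [X in _ * fine X](_ : _ = 1%E); last exact: probability_setT.
rewrite mulrDr mulr1 [_ * (B * _)]mulrC -mulrA divff ?mulr1 ?subr_eq0 ?gt_eqF//.
exact: addIr.
Qed.

(** Time is randomized uniformly over the interval, so that conditioning on time and
    position takes place in a probability space. *)
Lemma time_prob_ex (a b : R) (mu : probability Y R) : a < b ->
  exists P : probability (R * Y)%type R, forall (f : R * Y -> R) B,
    measurable_fun setT f -> (forall z, `|f z| <= B) ->
    \int[P]_z f z = (b - a)^-1 * \int[leb]_(t in `[a, b]) \int[mu]_y f (t, y).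
Proof.
move=> ab; exists ((unif ab) \x mu)%E => f B mf fB.
have fi : ((unif ab) \x mu)%E.-integrable setT (EFin \o f).
  exact: (@prob_integrable _ _ _ _ _ B).
have mg : measurable_fun setT (fun t => \int[mu]_y f (t, y)) by exact: measurable_Rintegral_param.
have mft t : measurable_fun setT (fun y => f (t, y)) by exact: (measurable_sect1 t mf).
have gB t : `|\int[mu]_y f (t, y)| <= B by exact: prob_Rintegral_le.
rewrite -(Rintegral_uniform ab mg gB) /Rintegral; congr fine.
rewrite -(integral12_prod_meas1 fi); apply: eq_integral => t _.
rewrite /fubini_F fineK//; apply: integrable_fin_num => //.
exact: (@prob_integrable _ _ _ _ _ B).
Qed.

End time_prob.

(** * Smooth functions along Lipschitz curves *)

Section zero_derivative.
Context {R : realType}.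

Lemma zero_derivativeP (J : R -> R) x :
  (forall e : R, 0 < e -> exists2 dl : R, 0 < dl & forall h, `|h| < dl -> `|J (x + h) - J x| <= e * `|h|) ->
  is_derive x 1 J 0.
Proof.
move=> H; suff c : (fun h : R => h^-1 *: (J (h *: (1 : R^o) + x) - J x)) @ 0^' --> (0 : R^o).
  by apply: DeriveDef; [apply/cvg_ex; exists 0|exact/cvg_lim].
apply/(@cvgrPdist_le _ R^o) => e e0; have [dl dl0 hd] := H _ e0.
near=> h.
have h0 : h != 0 by near: h; exact: nbhs_dnbhs_neq.
rewrite sub0r normrN [h *: _]mulr1 addrC normrM normfV.
rewrite ler_pdivrMl ?normr_gt0// mulrC addrC [h + x]addrC; apply: hd.
by near: h; exact: dnbhs0_lt.
Unshelve. all: by end_near. Qed.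

Lemma zero_derivative_cst (J : R -> R) a b : a <= b ->
  (forall x, x \in `]a, b[ -> forall e : R, 0 < e -> exists2 dl : R, 0 < dl &
     forall h, `|h| < dl -> `|J (x + h) - J x| <= e * `|h|) ->
  {within `[a, b], continuous J} -> J b = J a.
Proof.
rewrite le_eqVlt => /predU1P[->//|ab] H cJ.
have [|c _] := @MVT R J (fun=> 0) a b ab _ cJ; first by move=> x xab; exact: zero_derivativeP (H x xab).
by rewrite mul0r => /eqP; rewrite subr_eq0 => /eqP.
Qed.

Lemma near_delta (P : R -> Prop) t : (\forall s \near t, P s) ->
  exists2 dl : R, 0 < dl & forall s, `|s - t| < dl -> P s.
Proof.
move=> /nbhs_ballP[dl /= dl0 hd]; exists dl => // s hs.
by apply: hd; rewrite /ball/= distrC.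
Qed.

Lemma cont_near (h : R -> R) (t e : R) : continuous h -> 0 < e ->
  \forall s \near t, `|h s - h t| <= e.
Proof.
move=> ch e0; have := ch t => /(@cvgrPdist_le _ R^o)/(_ e e0).
by apply: filterS => s; rewrite distrC.
Qed.

Lemma near_id_le (t e : R) : 0 < e -> \forall s \near t, `|s - t| <= e.
Proof. by apply: (@cont_near id); move=> x; exact: cvg_id. Qed.

End zero_derivative.

Section transport.
Context {R : realType} {d : nat}.
Local Notation leb := (@lebesgue_measure R).
Local Notation Rd := 'rV[R]_d.
Local Notation T := (torus R d).
Local Notation E := (R^o * Rd)%type.
Implicit Types (f : E -> R^o) (z : E).

Lemma coordB (u v : Rd) i : (u - v) 0 i = u 0 i - v 0 i.
Proof. by rewrite !mxE. Qed.

Definition tder f z : R := 'D_((1, 0) : E) f z.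
Definition xder f z : Rd := \row_i 'D_((0, delta_mx 0 i) : E) f z.

Definition C1 f := (forall z, differentiable f z) /\ (forall v, continuous (fun z => 'D_v f z)).

Lemma diff_coordE f z (s : R) (w : Rd) : differentiable f z ->
  'd f z ((s, w) : E) = s * tder f z + dotv (xder f z) w.
Proof.
move=> df; have -> : ((s, w) : E) = (s : R) *: ((1, 0) : E) + \sum_(i < d) w 0 i *: ((0, delta_mx 0 i) : E).
  apply/pair_eqP/andP; split; apply/eqP => /=.
    rewrite [X in _ = _ + X](_ : _ = 0) ?addr0; first by rewrite [RHS]mulr1.
    rewrite (raddf_sum (@fst R^o Rd : {additive _ -> _})).
    by rewrite big1// => i _; rewrite /= scaler0.
  rewrite scaler0 add0r (raddf_sum (@snd R^o Rd : {additive _ -> _})) /=.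
  exact: row_sum_delta.
rewrite linearD linearZ /= linear_sum; congr (_ + _).
  by rewrite /tder deriveE.
rewrite /dotv; apply: eq_bigr => i _; rewrite linearZ/= /xder mxE deriveE//.
by rewrite mulrC.
Qed.

Lemma diff_small f z : differentiable f z -> forall e : R, 0 < e -> exists2 dl : R, 0 < dl &
  forall h : E, `|h| < dl -> `|f (z + h) - f z - 'd f z h| <= e * `|h|.
Proof.
move=> /diff_locally/eqaddoP df e e0; have := df e e0.
rewrite /= => /nbhs_ballP[dl /= dl0 hd]; exists dl => // h hh.
have := hd h; rewrite ball_prod_normE/= sub0r normrN => /(_ hh).
have -> // : f (z + h) - f z - 'd f z h = (f \o shift z - (cst (f z) + 'd f z)) h.
by rewrite !fctE/= opprD addrA [h + z]addrC.
Qed.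

Definition zperiodic f := forall t (x y : Rd), zcongr x y -> f (t, x) = f (t, y).

Lemma periodic_derive f v : zperiodic f -> zperiodic (fun z => 'D_v f z).
Proof.
move=> pf t x y xy; rewrite /derive.
suff -> : (fun h => h^-1 *: ((f \o shift ((t, x) : E)) (h *: v) - f (t, x))) =
          (fun h => h^-1 *: ((f \o shift ((t, y) : E)) (h *: v) - f (t, y))) by [].
apply/funext => h; congr (_ *: _); congr (_ - _); last exact: pf.
apply: pf; apply/forallP => i; rewrite !mxE opprD addrACA subrr add0r.
exact: (forallP xy).
Qed.

Lemma periodic_tsec f t x : zperiodic f -> f (t, x) = f (t, tsec (tproj x)).
Proof. by move=> pf; apply: pf; apply: tproj_zcongr; rewrite tsecK. Qed.

Lemma periodic_bounded f a b : continuous f -> zperiodic f ->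
  exists2 K : R, 0 <= K & forall t x, t \in `[a, b] -> `|f (t, x)| <= K.
Proof.
move=> cf pf; have [ab|ba] := leP a b; last first.
  by exists 0 => // t x; rewrite in_itv/= => /andP[h1 h2]; have := lt_le_trans ba (le_trans h1 h2); rewrite ltxx.
pose cube := [set v : Rd | forall i, `[-1, 1]%classic (v 0 i)].
pose A : set E := `[a, b]%classic `*` cube.
have A0 : A !=set0.
  exists (a, 0); split; first by rewrite /= in_itv/= lexx.
  by move=> i /=; rewrite mxE in_itv/= oppr_le0 !ler01.
have cA : compact A.
  apply: compact_setX; first exact: segment_compact.
  exact: (@rV_compact R d (fun=> `[-1, 1]%classic) (fun _ => @segment_compact R (-1) 1)).
have cn : {within A, continuous (fun z : E => `|f z|)}.
  apply: continuous_subspaceT => z; apply: continuous_comp; first exact: cf.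
  exact: (@norm_continuous _ R^o).
have [c _ hc] := compact_EVT_max A0 cA cn.
exists `|f c| => // t x tab; rewrite periodic_tsec//.
apply: hc; apply/mem_set; split => // i /=.
rewrite mxE; have := centered_itv (tlift (tproj x) 0 i); rewrite in_itv/=; lra.
Qed.

Lemma periodic_measurable {dX} {X : measurableType dX} f (r : X -> R) (y : X -> T) :
  continuous f -> zperiodic f -> measurable_fun setT r -> measurable_fun setT y ->
  measurable_fun setT (fun o => f (r o, tlift (y o))).
Proof.
move=> cf pf mr my; rewrite (_ : (fun o => _) = (fun o => f (r o, tsec (y o)))); last first.
  by apply/funext => o; rewrite periodic_tsec// tliftK.
apply/bmeas_measurable; apply: (bmeas_comp (g := f)) => //.
apply: bmeas_pair; [exact: countable_base_R|exact: countable_base_rV|exact/bmeas_measurable|].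
by apply/bmeas_rV; exact: vmeasurable_tsec.
Qed.

(** Periodicity reduces the space variable to a compact cube. *)
Lemma der_bounded f a b : C1 f -> zperiodic f -> exists2 K : R, 0 <= K &
  forall t x, t \in `[a, b] -> `|tder f (t, x)| <= K /\ enorm (xder f (t, x)) <= K.
Proof.
move=> hf pf.
have [K0 K00 h0] := periodic_bounded a b (hf.2 (1, 0)) (periodic_derive (1, 0) pf).
have H (i : 'I_d) : exists K : R, 0 <= K /\ forall t x, t \in `[a, b] ->
    `|'D_((0, delta_mx 0 i) : E) f (t, x)| <= K.
  have [K KK hK] := periodic_bounded a b
   (hf.2 (0, delta_mx 0 i)) (periodic_derive (0, delta_mx 0 i) pf).
  by exists K.
have [K hK] := choice H.
have S0 : 0 <= \sum_(i < d) K i by apply: sumr_ge0 => i _; have [] := hK i.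
exists (K0 + \sum_(i < d) K i) => [|t x tab]; first by rewrite addr_ge0.
split; first by rewrite (le_trans (h0 _ _ tab))// lerDl.
rewrite (le_trans (enorm_le_sum _))// (le_trans (_ : _ <= \sum_(i < d) K i)) ?lerDr//.
by apply: ler_sum => i _; rewrite mxE; have [_] := hK i; exact.
Qed.

Section along_curve.
Variables (f : E -> R^o) (a M : R) (u : R -> Rd) (x : Rd).
Hypotheses (hf : C1 f) (pf : zperiodic f) (hu : vbounded M u).

Let Z s : E := (s, x + vint a s u).
Let g s := tder f (Z s) + dotv (xder f (Z s)) (u s).

Lemma bound_ge0 : 0 <= M.
Proof. by have [_ h] := hu; exact: le_trans (enorm_ge0 _) (h 0). Qed.

Lemma continuous_C1 : continuous f.
Proof. by move=> z; apply: differentiable_continuous; have [] := hf. Qed.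

Lemma curve_dist s t : `|Z t - Z s| <= (1 + M) * `|t - s|.
Proof.
have M0 := bound_ge0.
rewrite prod_normE /= ge_max; apply/andP; split.
  by rewrite ler_peMl// lerDl.
rewrite (_ : _ - _ = vint a t u - vint a s u); last by rewrite /= opprD addrACA subrr add0r.
rewrite (le_trans (le_norm_enorm _))// (le_trans (vint_lip _ _ _ hu))//.
by rewrite ler_wpM2r// lerDr.
Qed.

Lemma continuous_curve : continuous Z.
Proof.
have M0 := bound_ge0.
move=> s; apply/cvgrPdist_le => e e0; near=> t.
rewrite (le_trans (curve_dist _ _))// -ler_pdivlMl ?ltr_pwDl//.
by rewrite distrC; near: t; apply: near_id_le; rewrite mulr_gt0// invr_gt0 ltr_pwDl.
Unshelve. all: by end_near. Qed.

Lemma continuous_tder : continuous (fun s => tder f (Z s)).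
Proof. by move=> s; apply: continuous_comp; [exact: continuous_curve|apply: (hf.2)]. Qed.

Lemma continuous_xder i : continuous (fun s => xder f (Z s) 0 i).
Proof.
rewrite (_ : (fun s => _) = (fun s => 'D_((0, delta_mx 0 i) : E) f (Z s))).
  move=> s; apply: (@continuous_comp _ _ _ Z (fun z => 'D_((0, delta_mx 0 i) : E) f z)).
    exact: continuous_curve.
  exact: hf.2.
by apply/funext => s; rewrite mxE.
Qed.

Lemma vmeasurable_xder_curve : vmeasurable setT (fun s => xder f (Z s)).
Proof. by move=> i; apply: continuous_measurable_fun; exact: continuous_xder. Qed.

Lemma measurable_rate : measurable_fun setT g.
Proof.
have [mu _] := hu; apply: measurable_funD.
  by apply: continuous_measurable_fun; exact: continuous_tder.
by apply: measurable_dotv => //; exact: vmeasurable_xder_curve.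
Qed.

Lemma rate_cont t e : 0 < e -> exists2 dl : R, 0 < dl & forall s, `|s - t| < dl ->
  `|tder f (Z s) - tder f (Z t)| <= e /\ enorm (xder f (Z s) - xder f (Z t)) <= e.
Proof.
move=> e0; pose e1 := e / (d%:R + 1).
have d0 : 0 < d%:R + 1 :> R by rewrite ltr_wpDl.
have e10 : 0 < e1 by rewrite divr_gt0.
have : \forall s \near t, `|tder f (Z s) - tder f (Z t)| <= e /\
    forall i, `|xder f (Z s) 0 i - xder f (Z t) 0 i| <= e1.
  near=> s; split.
    by near: s; exact: (cont_near t continuous_tder e0).
  move=> i; move: i; near: s; apply: filter_forall => i.
  exact: (cont_near t (@continuous_xder i) e10).
move=> /near_delta[dl dl0 hd]; exists dl => // s hs; have [h1 h2] := hd s hs.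
split => //; rewrite (le_trans (enorm_le_sum _))//.
rewrite (le_trans (ler_sum _ (G := fun=> e1) _))//.
  by move=> i _; rewrite coordB.
rewrite sumr_const card_ord -mulr_natl /e1 mulrCA ler_piMr ?(ltW e0)//.
by rewrite ler_pdivrMr// mul1r lerDl.
Unshelve. all: by end_near. Qed.

Lemma rate_bounded b : exists2 K : R, 0 <= K & forall s, s \in `[a, b] -> `|g s| <= K.
Proof.
have M0 := bound_ge0.
have [K K0 hK] := der_bounded a b hf pf.
have [_ hM] := hu; exists (K + K * M) => [|s sab]; first by rewrite addr_ge0// mulr_ge0.
have [h1 h2] := hK s (x + vint a s u) sab.
rewrite (le_trans (ler_normD _ _))// lerD//.
by rewrite (le_trans (normr_dotv_le _ _))// ler_pM// enorm_ge0.
Qed.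

Lemma rate_integrable s t b : a <= s -> t <= b -> leb.-integrable `[s, t] (EFin \o g).
Proof.
move=> as_ tb; have [K K0 hK] := rate_bounded b.
by apply: (integrable_subitv as_ tb); exact: (itv_integrable measurable_rate hK).
Qed.

Let J t := f (Z t) - \int[leb]_(s in `[a, t]) g s.

Lemma frozen_rate t e p q : 0 <= e -> a <= p -> p <= q ->
  (forall s, s \in `[p, q] ->
     `|tder f (Z s) - tder f (Z t)| <= e /\ enorm (xder f (Z s) - xder f (Z t)) <= e) ->
  `|\int[leb]_(s in `[p, q]) g s - ((q - p) * tder f (Z t) + dotv (xder f (Z t)) (vint p q u))|
    <= e * (1 + M) * (q - p).
Proof.
move=> e0 ap pq H; have M0 := bound_ge0; have [mu hM] := hu.
have ig : leb.-integrable `[p, q] (EFin \o g) by exact: (rate_integrable ap (lexx q)).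
have ic : leb.-integrable `[p, q] (EFin \o (fun=> tder f (Z t))).
  by apply: (@itv_integrable _ _ _ _ `|tder f (Z t)|).
have iu : leb.-integrable `[p, q] (EFin \o (fun s => dotv (u s) (xder f (Z t)))).
  apply: (@itv_integrable _ _ _ _ (M * enorm (xder f (Z t)))); first exact: vbounded_dotv hu.
  by move=> s _; exact: vbounded_dotv_le.
have -> : (q - p) * tder f (Z t) + dotv (xder f (Z t)) (vint p q u) =
    \int[leb]_(s in `[p, q]) (tder f (Z t) + dotv (u s) (xder f (Z t))).
  by rewrite RintegralD// Rintegral_cst// fine_leb_itv// mulrC -(dotv_vint _ _ _ hu) dotvC.
have mD : measurable_fun setT (fun s => g s - (tder f (Z t) + dotv (u s) (xder f (Z t)))).
  apply: measurable_funB; first exact: measurable_rate.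
  by apply: measurable_funD; [exact: measurable_cst|exact: vbounded_dotv hu].
rewrite -RintegralB//; last first.
  apply: (@itv_integrable _ _ _ _ (`|tder f (Z t)| + M * enorm (xder f (Z t)))).
    by apply: measurable_funD; [exact: measurable_cst|exact: vbounded_dotv hu].
  by move=> s _; rewrite (le_trans (ler_normD _ _))// lerD// vbounded_dotv_le.
rewrite -(fine_leb_itv pq); apply: normr_Rintegral_le => //.
- exact: leb_itv_lty.
- exact: measurable_funTS.
move=> s spq; have [h1 h2] := H s spq.
rewrite /g (dotvC (u s)) opprD addrACA -dotvBl mulrDr mulr1.
rewrite (le_trans (ler_normD _ _))// lerD// (le_trans (normr_dotv_le _ _))//.
by rewrite ler_pM// enorm_ge0.
Qed.

Lemma increment_rate b t e : t \in `]a, b[ -> 0 < e -> exists2 dl : R, 0 < dl &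
  forall p q, p <= q -> `|p - t| < dl -> `|q - t| < dl -> a <= p /\
  `|\int[leb]_(s in `[p, q]) g s - ((q - p) * tder f (Z t) + dotv (xder f (Z t)) (vint p q u))|
    <= e * (1 + M) * (q - p).
Proof.
rewrite in_itv/= => /andP[at_ tb] e0; have [dl dl0 hd] := rate_cont t e0.
exists (Num.min dl (t - a)); first by rewrite lt_min dl0 subr_gt0.
move=> p q pq; rewrite !lt_min => /andP[p1 p2] /andP[q1 q2].
have ap : a <= p by move: p2; rewrite ltr_norml => /andP[]; lra.
split => //; apply: frozen_rate => //; first exact: ltW.
move=> s; rewrite in_itv/= => /andP[ps sq]; apply: hd.
by move: p1 q1; rewrite !ltr_norml => /andP[p3 p4] /andP[q3 q4]; apply/andP; split; lra.
Qed.

(** J has derivative 0 at every time, although u is only measurable: both increments are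
    compared with the same linear expression in the increment of the primitive of u, so that
    no differentiability of that primitive is involved. *)
Lemma zero_rate b t e : t \in `]a, b[ -> 0 < e -> exists2 dl : R, 0 < dl &
  forall h, `|h| < dl -> `|J (t + h) - J t| <= e * `|h|.
Proof.
move=> tab e0; have M0 := bound_ge0.
pose e1 := e / (2 * (1 + M)).
have M1 : 0 < 2 * (1 + M) by rewrite mulr_gt0// ltr_pwDl.
have e10 : 0 < e1 by rewrite divr_gt0.
have eE : e = e1 * (1 + M) + e1 * (1 + M).
  by rewrite /e1; field; rewrite gt_eqF// ltr_pwDl.
have [d1 d10 H1] := increment_rate tab e10.
have [d2 d20 H2] := diff_small (hf.1 (Z t)) e10.
have d3 : 0 < d2 / (1 + M) by rewrite divr_gt0// ltr_pwDl.
exists (Num.min d1 (d2 / (1 + M))); first by rewrite lt_min d10.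
move=> h; rewrite lt_min => /andP[h1 h2].
have tt : `|t - t| < d1 by rewrite subrr normr0.
have th : `|t + h - t| < d1 by rewrite addrAC subrr add0r.
pose D := Z (t + h) - Z t.
have DE : D = (h, vint a (t + h) u - vint a t u).
  rewrite (_ : D = (t + h - t, (x + vint a (t + h) u) - (x + vint a t u))) //.
  by rewrite [t + h]addrC addrK opprD addrACA subrr add0r.
have nD : `|D| <= (1 + M) * `|h|.
  by rewrite (le_trans (curve_dist _ _))// addrAC subrr add0r.
have := H2 D; rewrite (le_lt_trans nD); last by rewrite mulrC -ltr_pdivlMr// ltr_pwDl.
move=> /(_ isT); rewrite {1}/D [Z t + _]addrC subrK => K2.
have {K2} K2 : `|f (Z (t + h)) - f (Z t) - (h * tder f (Z t) +
    dotv (xder f (Z t)) (vint a (t + h) u - vint a t u))| <= e1 * (1 + M) * `|h|.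
  rewrite -(diff_coordE _ _ (hf.1 (Z t))) -DE (le_trans K2)// -mulrA ler_wpM2l//; exact: ltW.
have K1 : `|\int[leb]_(s in `[a, t + h]) g s - \int[leb]_(s in `[a, t]) g s -
   (h * tder f (Z t) + dotv (xder f (Z t)) (vint a (t + h) u - vint a t u))| <= e1 * (1 + M) * `|h|.
  have [h0|h0] := leP 0 h.
    have [at_ K1] := H1 t (t + h) (ltac:(by rewrite lerDl)) tt th.
    rewrite (vint_split hu at_) ?lerDl//.
    rewrite (@Rintegral_itv_split _ a t (t + h) g at_) ?lerDl//; last exact: rate_integrable.
    by rewrite [X in X - _ - _]addrC addrK; move: K1; rewrite [t + h - t]addrAC subrr add0r (ger0_norm h0).
  have [at_ K1] := H1 (t + h) t (ltac:(by rewrite gerDl ltW)) th tt.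
  have tht : t + h <= t by rewrite gerDl ltW.
  have e2 : t - (t + h) = - h by ring.
  rewrite -[vint a (t + h) u - vint a t u]opprB (vint_split hu at_)//.
  rewrite (@Rintegral_itv_split _ a (t + h) t g at_)//; last exact: rate_integrable.
  rewrite e2 in K1; rewrite (ltr0_norm h0) [dotv _ (- _)]dotvC dotvNl [dotv (vint _ _ _) _]dotvC.
  apply: le_trans K1; rewrite -normrN le_eqVlt; apply/orP; left; apply/eqP; congr (`| _ |).
  by ring.
rewrite eE mulrDl (le_trans _ (lerD K2 K1))// (le_trans _ (ler_normB _ _))//.
rewrite le_eqVlt; apply/orP; left; apply/eqP; congr (`| _ |).
rewrite /J; ring.
Qed.

(** The chain rule in integrated form, for curves with a bounded measurable velocity. *)
Lemma transport b : a <= b ->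
  f (b, x + vint a b u) - f (a, x) = \int[leb]_(s in `[a, b]) g s.
Proof.
move=> ab; have : J b = J a.
  apply: zero_derivative_cst => //; first by move=> t tab e; exact: zero_rate tab.
  apply: (@within_continuousB _ _ _ _).
    by apply: continuous_subspaceT => s; apply: continuous_comp; [exact: continuous_curve|exact: continuous_C1].
  exact: (parameterized_integral_continuous ab (rate_integrable (lexx a) (lexx b))).
rewrite /J /Z vint_self addr0 set_itv1 Rintegral_set1 subr0 => <-.
by rewrite opprB addrC subrK.
Qed.

End along_curve.
End transport.

(** * From labels to positions: the Eulerian field *)

Section swap.
Context {R : realType} {dY} {Y : measurableType dY}.
Local Notation leb := (@lebesgue_measure R).

Lemma Rintegral_subitv (a b c d' : R) (f : R -> R) : a <= c -> d' <= b ->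
  \int[leb]_(t in `[a, b]) (if t \in `[c, d'] then f t else 0) = \int[leb]_(t in `[c, d']) f t.
Proof.
move=> ac db; rewrite /Rintegral; congr fine.
rewrite (_ : `[c, d']%classic = `[a, b]%classic `&` `[c, d']%classic); last first.
  by rewrite setIidr//; exact: subset_itvScc.
rewrite integral_mkcondr; apply: eq_integral => t _; rewrite patchE.
have -> : (t \in `[c, d']%classic) = (t \in `[c, d']) by apply/idP/idP => [/set_mem|/mem_set].
by case: ifP.
Qed.

Lemma Rintegral_swap (a b : R) (mu : probability Y R) (f : R * Y -> R) B :
  a <= b -> measurable_fun setT f -> (forall t y, t \in `[a, b] -> `|f (t, y)| <= B) ->
  \int[leb]_(t in `[a, b]) \int[mu]_y f (t, y) = \int[mu]_y \int[leb]_(t in `[a, b]) f (t, y).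
Proof.
rewrite le_eqVlt => /predU1P[<- _ _|ab mf fB].
  rewrite set_itv1 Rintegral_set1; under [RHS]eq_Rintegral do rewrite Rintegral_set1.
  by rewrite Rintegral_cst// mul0r.
pose g (z : R * Y) := if z.1 \in `[a, b] then f z else 0.
have mg : measurable_fun setT g.
  apply: measurable_fun_ifT => //.
  have mt : measurable_fun setT (fun t : R => t \in `[a, b]).
    apply: (measurable_fun_bool true); rewrite setTI.
    by rewrite (_ : _ @^-1` _ = `[a, b]%classic).
  exact: (measurableT_comp mt measurable_fst).
have gB z : `|g z| <= `|B|.
  rewrite /g; case: ifPn => [h|_]; last by rewrite normr0.
  by case: z h => t y /= h; rewrite (le_trans (fB _ _ h))// ler_norm.
have gE t y : t \in `[a, b] -> g (t, y) = f (t, y) by rewrite /g /= => ->.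
transitivity (\int[leb]_(t in `[a, b]) \int[mu]_y g (t, y)).
  by apply: eq_Rintegral => t /set_mem tab; apply: eq_Rintegral => y _; rewrite gE.
transitivity (\int[mu]_y \int[leb]_(t in `[a, b]) g (t, y)); last first.
  by apply: eq_Rintegral => y _; apply: eq_Rintegral => t /set_mem tab; rewrite gE.
have mg1 : measurable_fun setT (fun t => \int[mu]_y g (t, y)) by exact: measurable_Rintegral_param.
have mg1t t : measurable_fun setT (fun y => g (t, y)) by exact: measurable_sect1.
have mg2t y : measurable_fun setT (fun t => g (t, y)) by exact: measurable_sect2.
have gB1 t : `|\int[mu]_y g (t, y)| <= `|B| by exact: prob_Rintegral_le.
have mg2 : measurable_fun setT (fun y => \int[unif ab]_t g (t, y)).
  have ms : measurable_fun setT (fun z : Y * R => g (z.2, z.1)).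
    by apply: (measurableT_comp mg); apply: measurable_fun_pair.
  exact: (measurable_Rintegral_param (unif ab) ms).
have h1 := Rintegral_uniform ab mg1 gB1.
have h2 y := Rintegral_uniform ab (mg2t y) (fun t => gB (t, y)).
have ba : (b - a)^-1 != 0 by rewrite invr_eq0 subr_eq0 gt_eqF.
apply: (mulfI ba); rewrite -h1.
transitivity (\int[mu]_y \int[unif ab]_t g (t, y)); last first.
  under eq_Rintegral do rewrite h2.
  rewrite RintegralZl//.
  have : mu.-integrable setT (EFin \o (fun y => (b - a) * \int[unif ab]_t g (t, y))).
    apply: (@prob_integrable _ _ _ _ _ ((b - a) * `|B|)).
      by apply: measurable_funM => //; exact: measurable_cst.
    move=> y; rewrite normrM ger0_norm ?subr_ge0 ?(ltW ab)// ler_wpM2l ?subr_ge0 ?(ltW ab)//.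
    by apply: prob_Rintegral_le => //; exact: mg2t.
  apply: eq_integrable => // y _; rewrite /= h2 mulrA divff ?mul1r//.
  by rewrite subr_eq0 gt_eqF.
have gi : (unif ab \x mu)%E.-integrable setT (EFin \o g) by exact: (@prob_integrable _ _ _ _ _ `|B|).
rewrite /Rintegral; congr fine.
have i1 t : mu.-integrable setT (EFin \o (fun y => g (t, y))).
  by apply: (@prob_integrable _ _ _ _ _ `|B|) => // y; exact: gB.
have i2 y : (unif ab).-integrable setT (EFin \o (fun t => g (t, y))).
  by apply: (@prob_integrable _ _ _ _ _ `|B|) => // t; exact: gB.
transitivity (\int[unif ab]_t \int[mu]_y (g (t, y))%:E)%E.
  by apply: eq_integral => t _; rewrite fineK//; apply: integrable_fin_num => //; exact: i1.
rewrite (Fubini gi); apply: eq_integral => y _; rewrite fineK//.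
by apply: integrable_fin_num => //; exact: i2.
Qed.

End swap.

Section eulerian.
Context {R : realType} {d : nat}.
Local Notation leb := (@lebesgue_measure R).
Local Notation Rd := 'rV[R]_d.
Local Notation T := (torus R d).
Local Notation P := (prob_torus R d).
Variables (a b M : R) (mu0 : P) (U : R -> T -> Rd) (C : R -> T -> set Rd).
Hypotheses (ab : a < b) (hU : velocity M U).
Hypothesis mC : setvalued_measurable (X := (R * T)%type) (`[a, b] `*` setT) (fun z => C z.1 z.2).
Hypothesis nC : forall t y, t \in `[a, b] -> nonempty_compact_convex (C t y).
Hypothesis CM : forall t y u, t \in `[a, b] -> C t y u -> enorm u <= M.
Hypothesis UC : forall t y, t \in `[a, b] -> C t (flow a U t y) (U t y).

Lemma ncc_set1 (u : Rd) : nonempty_compact_convex [set u].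
Proof.
split; [by exists u|exact: compact_set1|].
move=> x y t; rewrite !inE => -> ->.
by rewrite /= convmm.
Qed.

Let C' (z : R * T) : set Rd := if z.1 \in `[a, b] then C z.1 z.2 else [set 0].
Let U' (z : R * T) : Rd := if z.1 \in `[a, b] then U z.1 z.2 else 0.

Lemma measurable_C' : setvalued_measurable setT C'.
Proof.
move=> O oO; rewrite setTI.
have mD : measurable (`[a, b] `*` setT : set (R * T)) by exact: measurableX.
rewrite (_ : [set _ | _] = ((`[a, b] `*` setT) `&` [set z | C z.1 z.2 `&` O !=set0]) `|`
  (~` (`[a, b] `*` setT) `&` (if 0 \in O then setT else set0))).
  apply: measurableU; first exact: mC.
  by apply: measurableI; [exact: measurableC|case: ifP].
apply/seteqP; split => -[t y] /=; rewrite /C' /=.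
  case: ifPn => [tab h|tab [u [/= -> Ou]]]; first by left.
  right; split; first by move=> [/= h _]; rewrite h in tab.
  by rewrite mem_set.
move=> [[[/= tab _] h]|[tab]]; first by rewrite tab.
case: (boolP (t \in `[a, b])) => tab'; first by exfalso; exact: tab (conj tab' Logic.I).
by case: ifPn => // /set_mem O0 _; exists 0.
Qed.

Lemma vmeasurable_U' : vmeasurable setT U'.
Proof.
have [mU _] := hU; move=> i.
rewrite (_ : (fun z => _) = (fun z : R * T => if z.1 \in `[a, b] then U z.1 z.2 0 i else 0)); last first.
  by apply/funext => z; rewrite /U'; case: ifP => //; rewrite mxE.
apply: measurable_fun_ifT; [|exact: mU|exact: measurable_cst].
have mt : measurable_fun setT (fun t : R => t \in `[a, b]).
  apply: (measurable_fun_bool true); rewrite setTI.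
  by rewrite (_ : _ @^-1` _ = `[a, b]%classic).
exact: (measurableT_comp mt measurable_fst).
Qed.

(** Condition the velocity on (t, X_t) with t uniform on [a, b]. Outside of [a, b] the field
    C is completed by {0}, which keeps all hypotheses for every time. *)
Lemma eulerian_ex : exists p : R -> T -> Rd,
  [/\ vmeasurable setT (fun z : R * T => p z.1 z.2), forall t y, enorm (p t y) <= M,
      forall t y, t \in `[a, b] -> C t y (p t y) &
      forall (g : R * T -> Rd) B, vmeasurable setT g -> (forall z, enorm (g z) <= B) ->
        \int[leb]_(t in `[a, b]) \int[law a mu0 U t]_y dotv (g (t, y)) (p t y) =
        \int[leb]_(t in `[a, b]) \int[mu0]_y dotv (g (t, flow a U t y)) (U t y)].
Proof.
have M0 : 0 <= M := velocity_ge0 hU.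
have [PP hPP] := time_prob_ex mu0 ab.
pose phi (z : R * T) : R * T := (z.1, flow a U z.1 z.2).
have mphi : measurable_fun setT phi.
  by apply: measurable_fun_pair; [exact: measurable_fst|exact: measurable_flow hU].
have nC' z : nonempty_compact_convex (C' z).
  by rewrite /C'; case: ifP => [h|_]; [exact: nC|exact: ncc_set1].
have CM' z u : C' z u -> enorm u <= M.
  by rewrite /C'; case: ifP => [h|_ /= ->]; [exact: CM|rewrite enorm0].
have UC' z : C' (phi z) (U' z).
  by rewrite /C' /U' /=; case: ifP => [h|_] //; exact: UC.
have [p [mp pC hp]] := convex_condexp PP mphi vmeasurable_U' measurable_C' nC' CM' UC'.
have pM z : enorm (p z) <= M by exact: CM' (pC z).
have UM z : enorm (U' z) <= M by exact: CM' (UC' z).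
exists (fun t y => p (t, y)); split.
- by move=> i; have := mp i; apply: eq_measurable_fun => -[].
- by move=> t y.
- by move=> t y tab; have := pC (t, y); rewrite /C' /= tab.
move=> g B mg gB.
have mgphi : vmeasurable setT (fun z => g (phi z)) by exact: vmeasurable_comp.
have mpphi : vmeasurable setT (fun z => p (phi z)) by exact: vmeasurable_comp.
have bound (u v : Rd) : enorm u <= B -> enorm v <= M -> `|dotv u v| <= B * M.
  by move=> hu hv; rewrite (le_trans (normr_dotv_le _ _))// ler_pM// enorm_ge0.
have := hp g B mg gB; rewrite Rintegral_push; last exact: measurable_dotv.
rewrite (hPP (fun z => dotv (g (phi z)) (p (phi z))) (B * M)) ; first last.
- by move=> z; exact: bound.
- exact: measurable_dotv.
rewrite (hPP (fun z => dotv (g (phi z)) (U' z)) (B * M)) ; first last.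
- by move=> z; exact: bound.
- by apply: measurable_dotv => //; exact: vmeasurable_U'.
have ba : (b - a)^-1 != 0 by rewrite invr_eq0 subr_eq0 gt_eqF.
move=> /(mulfI ba) h.
transitivity (\int[leb]_(t in `[a, b]) \int[mu0]_y dotv (g (phi (t, y))) (p (phi (t, y)))).
  apply: eq_Rintegral => t _; rewrite (lawE _ _ hU) Rintegral_push//.
  have h1 := measurable_dotv mg mp.
  exact: (measurable_sect1 t h1).
rewrite h; apply: eq_Rintegral => t /set_mem tab; apply: eq_Rintegral => y _.
by rewrite /U' /= tab.
Qed.

End eulerian.

Section boundary.
Context {R : realType} {d : nat}.
Local Notation leb := (@lebesgue_measure R).
Local Notation Rd := 'rV[R]_d.
Local Notation T := (torus R d).
Local Notation P := (prob_torus R d).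
Local Notation E := (R^o * Rd)%type.

Lemma periodic_periodization (phi : R -> T -> R) : zperiodic (periodization phi).
Proof. by move=> t x y xy; rewrite /periodization /= (zcongr_tproj xy). Qed.

Section test.
Variable (phi : R -> T -> R).
Hypothesis hphi : C1 (periodization phi).
Let f := periodization phi.
Let pf : zperiodic f := periodic_periodization phi.

Lemma phiE t y : phi t y = f (t, tlift y).
Proof. by rewrite /f /periodization /= tliftK. Qed.

Lemma measurable_phi {dX} {X : measurableType dX} (r : X -> R) (y : X -> T) :
  measurable_fun setT r -> measurable_fun setT y -> measurable_fun setT (fun o => phi (r o) (y o)).
Proof.
move=> mr my; under eq_fun do rewrite phiE.
by apply: periodic_measurable => //; exact: (continuous_C1 hphi).
Qed.

Lemma measurable_dt {dX} {X : measurableType dX} (r : X -> R) (y : X -> T) :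
  measurable_fun setT r -> measurable_fun setT y -> measurable_fun setT (fun o => dt phi (r o) (y o)).
Proof.
move=> mr my; apply: (@periodic_measurable _ _ _ _ (fun z => 'D_((1, 0) : E) f z)) => //.
  exact: hphi.2.
exact: periodic_derive.
Qed.

Lemma measurable_gradx {dX} {X : measurableType dX} (r : X -> R) (y : X -> T) :
  measurable_fun setT r -> measurable_fun setT y ->
  vmeasurable setT (fun o => gradx phi (r o) (y o)).
Proof.
move=> mr my i; rewrite (_ : (fun o => _) =
   (fun o => (fun z => 'D_((0, delta_mx 0 i) : E) f z) (r o, tlift (y o)))); last first.
  by apply/funext => o; rewrite mxE.
apply: (@periodic_measurable _ _ _ _ (fun z => 'D_((0, delta_mx 0 i) : E) f z)) => //.
  exact: hphi.2.
exact: periodic_derive.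
Qed.

Lemma test_bounded a b : exists2 K : R, 0 <= K & forall t y, t \in `[a, b] ->
  [/\ `|phi t y| <= K, `|dt phi t y| <= K & enorm (gradx phi t y) <= K].
Proof.
have [K K0 hK] := der_bounded a b hphi pf.
have [K' K'0 hK'] := periodic_bounded a b (continuous_C1 hphi) pf.
exists (K + K'); first exact: addr_ge0.
move=> t y tab; have [h1 h2] := hK t (tlift y) tab.
split; [by rewrite phiE (le_trans (hK' _ _ tab))// lerDr| |].
  by rewrite (le_trans h1)// lerDl.
by rewrite (le_trans h2)// lerDl.
Qed.

Section along_flow.
Variables (a M : R) (mu0 : P) (U : R -> T -> Rd).
Hypothesis hU : velocity M U.

Let rate s y := dt phi s (flow a U s y) + dotv (gradx phi s (flow a U s y)) (U s y).

Lemma flow_transport b y : a <= b ->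
  phi b (flow a U b y) - phi a y = \int[leb]_(s in `[a, b]) rate s y.
Proof.
move=> ab; have := transport (tlift y) hphi pf (velocity_vbounded y hU) ab.
rewrite /periodization /= tliftK => ->; apply: eq_Rintegral => s _.
have e v : 'D_v f (s, tlift y + vint a s (U ^~ y)) = 'D_v f (s, tlift (flow a U s y)).
  by apply: (periodic_derive v pf); apply: tproj_zcongr; rewrite tliftK.
congr (_ + _); first exact: e.
by congr (dotv _ _); apply/rowP => i; rewrite !mxE; exact: e.
Qed.

Lemma measurable_rate_flow : measurable_fun setT (fun z : R * T => rate z.1 z.2).
Proof.
have [mU _] := hU; have mf := measurable_flow a hU.
apply: measurable_funD; first by apply: measurable_dt => //; exact: measurable_fst.
by apply: measurable_dotv => //; apply: measurable_gradx => //; exact: measurable_fst.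
Qed.

Lemma rate_flow_bounded b : exists2 K : R, 0 <= K & forall t y, t \in `[a, b] -> `|rate t y| <= K.
Proof.
have M0 := velocity_ge0 hU; have [_ hM] := hU.
have [K K0 hK] := test_bounded a b; exists (K + K * M); first by rewrite addr_ge0// mulr_ge0.
move=> t y tab; have [_ h1 h2] := hK t (flow a U t y) tab.
rewrite (le_trans (ler_normD _ _))// lerD// (le_trans (normr_dotv_le _ _))//.
by rewrite ler_pM// enorm_ge0.
Qed.

Lemma law_transport b : a <= b ->
  \int[law a mu0 U b]_y phi b y - \int[mu0]_y phi a y =
  \int[leb]_(s in `[a, b]) \int[mu0]_y rate s y.
Proof.
move=> ab; have [K K0 hK] := rate_flow_bounded b.
rewrite (Rintegral_swap mu0 ab measurable_rate_flow hK).
have mb : measurable_fun setT (phi b).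
  by apply: (@measurable_phi _ T (fun=> b) id) => //; exact: measurable_cst.
have ma : measurable_fun setT (phi a).
  by apply: (@measurable_phi _ T (fun=> a) id) => //; exact: measurable_cst.
rewrite (lawE _ _ hU) Rintegral_push//.
have [K1 K10 hK1] := test_bounded a b.
have aab : a \in `[a, b] by rewrite in_itv/= lexx.
have bab : b \in `[a, b] by rewrite in_itv/= lexx andbT.
rewrite -RintegralB//; first last.
- by apply: (@prob_integrable _ _ _ _ _ K1) => // y; have [] := hK1 a y aab.
- apply: (@prob_integrable _ _ _ _ _ K1); first exact: (measurableT_comp mb (measurable_flowt a hU b)).
  by move=> y; have [] := hK1 b (flow a U b y) bab.
by apply: eq_Rintegral => y _; rewrite flow_transport.
Qed.

(** The continuity equation with its boundary terms: the velocity is paired with gradients at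
    (t, X_t) only, hence the labelled and the positional fields give the same equation. *)
Lemma law_boundary b c p : a <= c -> c <= b ->
  vmeasurable setT (fun z : R * T => p z.1 z.2) -> (forall t y, enorm (p t y) <= M) ->
  (forall (g : R * T -> Rd) B, vmeasurable setT g -> (forall z, enorm (g z) <= B) ->
    \int[leb]_(t in `[a, b]) \int[law a mu0 U t]_y dotv (g (t, y)) (p t y) =
    \int[leb]_(t in `[a, b]) \int[mu0]_y dotv (g (t, flow a U t y)) (U t y)) ->
  \int[leb]_(t in `[a, c]) \int[law a mu0 U t]_y (dt phi t y + dotv (gradx phi t y) (p t y)) =
  \int[law a mu0 U c]_y phi c y - \int[mu0]_y phi a y.
Proof.
move=> ac cb mp pM hp; rewrite law_transport//.
have M0 := velocity_ge0 hU; have [mU hM] := hU.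
have [K K0 hK] := test_bounded a c.
pose g (z : R * T) : Rd := if z.1 \in `[a, c] then gradx phi z.1 z.2 else 0.
have mg : vmeasurable setT g.
  move=> i; rewrite (_ : (fun z => _) = (fun z : R * T => if z.1 \in `[a, c] then gradx phi z.1 z.2 0 i else 0)); last first.
    by apply/funext => z; rewrite /g; case: ifP => //; rewrite mxE.
  apply: measurable_fun_ifT; [|exact: (@measurable_gradx _ _ fst snd)|exact: measurable_cst].
  have mt : measurable_fun setT (fun t : R => t \in `[a, c]).
    apply: (measurable_fun_bool true); rewrite setTI.
    by rewrite (_ : _ @^-1` _ = `[a, c]%classic).
  exact: (measurableT_comp mt measurable_fst).
have gK z : enorm (g z) <= K.
  by rewrite /g; case: ifP => [h|_]; [have [] := hK _ z.2 h|rewrite enorm0].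
have := hp g K mg gK.
have cut (F : R -> R) : \int[leb]_(t in `[a, b]) (if t \in `[a, c] then F t else 0) =
    \int[leb]_(t in `[a, c]) F t by exact: Rintegral_subitv.
have -> : \int[leb]_(t in `[a, b]) \int[law a mu0 U t]_y dotv (g (t, y)) (p t y) =
    \int[leb]_(t in `[a, c]) \int[law a mu0 U t]_y dotv (gradx phi t y) (p t y).
  rewrite -cut; apply: eq_Rintegral => t _; rewrite /g /=; case: ifP => // _.
  under eq_Rintegral do rewrite dotv0l; by rewrite Rintegral_cst// mul0r.
have -> : \int[leb]_(t in `[a, b]) \int[mu0]_y dotv (g (t, flow a U t y)) (U t y) =
    \int[leb]_(t in `[a, c]) \int[mu0]_y dotv (gradx phi t (flow a U t y)) (U t y).
  rewrite -cut; apply: eq_Rintegral => t _; rewrite /g /=; case: ifP => // _.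
  under eq_Rintegral do rewrite dotv0l; by rewrite Rintegral_cst// mul0r.
have mf := measurable_flow a hU.
have mdt2 : measurable_fun setT (fun z : R * T => dt phi z.1 z.2) by exact: measurable_dt.
have mgr2 : vmeasurable setT (fun z : R * T => gradx phi z.1 z.2) by exact: measurable_gradx.
have mdtf : measurable_fun setT (fun z : R * T => dt phi z.1 (flow a U z.1 z.2)) by exact: measurable_dt.
have mgrf : vmeasurable setT (fun z : R * T => gradx phi z.1 (flow a U z.1 z.2)) by exact: measurable_gradx.
have mgp := measurable_dotv mgr2 mp; have mgU := measurable_dotv mgrf mU.
have mgpf : measurable_fun setT (fun z : R * T => dotv (gradx phi z.1 (flow a U z.1 z.2)) (p z.1 (flow a U z.1 z.2))).
  by apply: (measurableT_comp mgp (_ : measurable_fun setT (fun z : R * T => (z.1, flow a U z.1 z.2)))); exact: measurable_fun_pair.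
have bound (u v : Rd) : enorm u <= K -> enorm v <= M -> `|dotv u v| <= K * M.
  by move=> hu hv; rewrite (le_trans (normr_dotv_le _ _))// ler_pM// enorm_ge0.
have split1 t : t \in `[a, c] ->
    \int[law a mu0 U t]_y (dt phi t y + dotv (gradx phi t y) (p t y)) =
    \int[mu0]_y dt phi t (flow a U t y) + \int[law a mu0 U t]_y dotv (gradx phi t y) (p t y).
  move=> tac; rewrite RintegralD//.
  - by rewrite (lawE _ _ hU) Rintegral_push//; exact: (measurable_sect1 t mdt2).
  - apply: (@prob_integrable _ _ _ _ _ K); first exact: (measurable_sect1 t mdt2).
    by move=> y; have [] := hK t y tac.
  - apply: (@prob_integrable _ _ _ _ _ (K * M)); first exact: (measurable_sect1 t mgp).
    by move=> y; apply: bound => //; have [] := hK t y tac.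
have split2 t : t \in `[a, c] ->
    \int[mu0]_y rate t y =
    \int[mu0]_y dt phi t (flow a U t y) + \int[mu0]_y dotv (gradx phi t (flow a U t y)) (U t y).
  move=> tac; rewrite RintegralD//.
  - apply: (@prob_integrable _ _ _ _ _ K); first exact: (measurable_sect1 t mdtf).
    by move=> y; have [] := hK t (flow a U t y) tac.
  - apply: (@prob_integrable _ _ _ _ _ (K * M)); first exact: (measurable_sect1 t mgU).
    by move=> y; apply: bound => //; have [] := hK t (flow a U t y) tac.
have lawE' t : \int[law a mu0 U t]_y dotv (gradx phi t y) (p t y) =
    \int[mu0]_y dotv (gradx phi t (flow a U t y)) (p t (flow a U t y)).
  by rewrite (lawE _ _ hU) Rintegral_push//; exact: (measurable_sect1 t mgp).
have i1 : leb.-integrable `[a, c] (EFin \o (fun t => \int[mu0]_y dt phi t (flow a U t y))).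
  apply: (@itv_integrable _ _ _ _ K); first exact: (measurable_Rintegral_param (mu0) mdtf).
  move=> t tac; apply: prob_Rintegral_le; first exact: (measurable_sect1 t mdtf).
  by move=> y; have [] := hK t (flow a U t y) tac.
have i2 : leb.-integrable `[a, c] (EFin \o (fun t => \int[law a mu0 U t]_y dotv (gradx phi t y) (p t y))).
  rewrite (_ : (fun t => _) = (fun t => \int[mu0]_y dotv (gradx phi t (flow a U t y)) (p t (flow a U t y)))); last first.
    by apply/funext => t; exact: lawE'.
  apply: (@itv_integrable _ _ _ _ (K * M)); first exact: (measurable_Rintegral_param (mu0) mgpf).
  move=> t tac; apply: prob_Rintegral_le; first exact: (measurable_sect1 t mgpf).
  by move=> y; apply: bound => //; have [] := hK t (flow a U t y) tac.
have i3 : leb.-integrable `[a, c] (EFin \o (fun t => \int[mu0]_y dotv (gradx phi t (flow a U t y)) (U t y))).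
  apply: (@itv_integrable _ _ _ _ (K * M)); first exact: (measurable_Rintegral_param (mu0) mgU).
  move=> t tac; apply: prob_Rintegral_le; first exact: (measurable_sect1 t mgU).
  by move=> y; apply: bound => //; have [] := hK t (flow a U t y) tac.
move=> h.
transitivity (\int[leb]_(t in `[a, c]) (\int[mu0]_y dt phi t (flow a U t y) + \int[law a mu0 U t]_y dotv (gradx phi t y) (p t y))).
  by apply: eq_Rintegral => t /set_mem tac; rewrite split1.
transitivity (\int[leb]_(t in `[a, c]) (\int[mu0]_y dt phi t (flow a U t y) + \int[mu0]_y dotv (gradx phi t (flow a U t y)) (U t y))); last first.
  by apply: eq_Rintegral => t /set_mem tac; rewrite split2.
by rewrite [LHS]RintegralD// [RHS]RintegralD// h.
Qed.

End along_flow.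
End test.
End boundary.

(** * Integration along continuous curves of measures *)

Section lipschitz.
Context {R : realType} {d : nat}.
Local Notation Rd := 'rV[R]_d.
Local Notation T := (torus R d).
Local Notation P := (prob_torus R d).

Lemma lipschitz_continuous_tproj (f : T -> R) K : 0 <= K ->
  (forall x y, `|f x - f y| <= K * tdist x y) -> continuous (fun u : Rd => f (tproj u)).
Proof.
move=> K0 hf u; apply/(@cvgrPdist_le R R^o _ (nbhs u)) => e e0.
have e1 : 0 < e / (K + 1) by rewrite divr_gt0// ltr_wpDl.
have ed : 0 < e / (K + 1) / (d%:R + 1) by rewrite divr_gt0// ltr_wpDl.
apply: filterS (@cvgr_dist_le _ _ _ (nbhs u) _ id _ cvg_id _ ed) => v /= h0.
have h : enorm (u - v) <= e / (K + 1).
  rewrite (le_trans (enorm_le_norm _))// (@le_trans _ _ ((d%:R + 1) * `|u - v|))// ?ler_wpM2r ?lerDl//.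
  by rewrite mulrC -ler_pdivlMr ?ltr_wpDl.
rewrite (le_trans (hf _ _))// (le_trans (ler_wpM2l K0 (tdist_tproj _ _)))//.
rewrite (le_trans (ler_wpM2l K0 h))// mulrCA ler_piMr ?(ltW e0)//.
by rewrite ler_pdivrMr ?ltr_wpDl// mul1r lerDl.
Qed.

Lemma lipschitz_measurable (f : T -> R) K : 0 <= K ->
  (forall x y, `|f x - f y| <= K * tdist x y) -> measurable_fun setT f.
Proof.
move=> K0 hf; have cf := lipschitz_continuous_tproj K0 hf.
have mt : bmeas (tsec : T -> Rd) by apply/bmeas_rV; exact: measurable_tsec.
have /bmeas_measurable := bmeas_comp mt cf.
by apply: eq_measurable_fun => x _; rewrite /= tsecK.
Qed.

Definition setdist (A : set T) x : R := inf [set tdist x y | y in A].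

Lemma setdist_lbound (A : set T) (x : T) : lbound [set tdist x y | y in A] 0.
Proof. by move=> _ [y _ <-]; exact: tdist_ge0. Qed.

Lemma setdist_ge0 A x : A !=set0 -> 0 <= setdist A x.
Proof.
move=> [y Ay]; apply: lb_le_inf; last exact: setdist_lbound.
by exists (tdist x y), y.
Qed.

Lemma setdist_le A x y : A y -> setdist A x <= tdist x y.
Proof.
by move=> Ay; apply: ge_inf; [exists 0; exact: setdist_lbound|exists y].
Qed.

Lemma setdist_lip A x y : A !=set0 -> `|setdist A x - setdist A y| <= tdist x y.
Proof.
move=> A0; wlog h : x y / setdist A x <= setdist A y.
  by move=> H; have [h|/ltW h] := leP (setdist A x) (setdist A y); [exact: H|rewrite distrC tdistC; exact: H].
rewrite ler0_norm ?subr_le0// opprB lerBlDr -lerBlDl.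
have [y0 Ay0] := A0; apply: lb_le_inf; first by exists (tdist x y0), y0.
move=> _ [z Az <-]; rewrite lerBlDl (le_trans (setdist_le y Az))//.
by rewrite (tdistC x y); exact: tdist_triangle.
Qed.

Lemma setdist_gt0 O x : open O -> O x -> (~` O) !=set0 -> 0 < setdist (~` O) x.
Proof.
move=> oO Ox cO; have [r r0 hr] := tdist_ball oO Ox.
rewrite (lt_le_trans r0)//; have [y0 Oy0] := cO.
apply: lb_le_inf; first by exists (tdist x y0), y0.
by move=> _ [y Oy <-]; rewrite leNgt; apply/negP => /hr.
Qed.

(** Lipschitz functions that increase to the indicator function of the open set O. *)
Definition plateau (O : set T) n x : R := Num.min 1 (n%:R * setdist (~` O) x).

Lemma plateau_lip O n x y : (~` O) !=set0 ->
  `|plateau O n x - plateau O n y| <= n%:R * tdist x y.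
Proof.
move=> cO; have h : `|n%:R * setdist (~` O) x - n%:R * setdist (~` O) y| <= n%:R * tdist x y.
  by rewrite -mulrBr normrM ger0_norm// ler_wpM2l// setdist_lip.
apply: le_trans h; rewrite /plateau.
set p := _ * _; set q := _ * _.
have [p1|p1] := leP 1 p; have [q1|q1] := leP 1 q; rewrite ?subrr ?normr0//.
- by rewrite !ger0_norm ?subr_ge0 ?(ltW q1) ?(le_trans (ltW q1))// lerB.
- rewrite distrC [leRHS]distrC !ger0_norm ?subr_ge0 ?(ltW p1) ?(le_trans (ltW p1))//.
  by rewrite lerB.
Qed.

Lemma plateau_itv O n x : (~` O) !=set0 -> 0 <= plateau O n x <= 1.
Proof.
move=> cO; rewrite /plateau le_min ler01 mulr_ge0 ?setdist_ge0//=.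
by rewrite ge_min lexx.
Qed.

Lemma plateau_cvg O x : open O -> (~` O) !=set0 -> (fun n => plateau O n x) @ \oo --> (\1_O x : R).
Proof.
move=> oO cO; rewrite indicE; case: (boolP (x \in O)) => [/set_mem Ox|/negP Ox].
  have h0 := setdist_gt0 oO Ox cO.
  apply: (@cvg_near_cst _ R^o); near=> n; rewrite /plateau; apply/min_idPl.
  rewrite -ler_pdivrMr// mul1r; near: n; exact: nbhs_infty_ger.
have Ox' : (~` O) x by move=> h; apply: Ox; exact: mem_set.
rewrite (_ : (fun n => _) = (fun=> 0)); first exact: cvg_cst.
apply/funext => n; rewrite /plateau; have -> : setdist (~` O) x = 0.
  apply/eqP; rewrite eq_le setdist_ge0// andbT -(tdistxx x); exact: setdist_le.
by rewrite mulr0; apply/min_idPr.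
Unshelve. all: by end_near. Qed.

End lipschitz.

Section kernel.
Context {R : realType} {d : nat}.
Local Notation leb := (@lebesgue_measure R).
Local Notation Rd := 'rV[R]_d.
Local Notation T := (torus R d).
Local Notation P := (prob_torus R d).

Definition clamp (c b t : R) : R := Num.max c (Num.min b t).

Lemma clamp_itv c b t : c <= b -> clamp c b t \in `[c, b].
Proof. by move=> cb; rewrite in_itv/= /clamp le_max lexx ge_max cb ge_min lexx. Qed.

Lemma clamp_id c b t : t \in `[c, b] -> clamp c b t = t.
Proof. by rewrite in_itv/= => /andP[ct tb]; rewrite /clamp (min_idPr tb) (max_idPr ct). Qed.

Lemma clamp_lip c b s t : `|clamp c b s - clamp c b t| <= `|s - t|.
Proof.
wlog st : s t / s <= t.
  by move=> H; have [h|/ltW h] := leP s t; [exact: H|rewrite distrC [leRHS]distrC; exact: H].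
rewrite [leRHS]distrC (ger0_norm (_ : 0 <= t - s)) ?subr_ge0//.
rewrite /clamp /Num.max /Num.min.
by rewrite ler_norml; case: (ltP b s); case: (ltP b t) => ? ?; do 2 case: ltP => ?; lra.
Qed.

(** The curve frozen outside of [c, b], so that it is defined and continuous for all times. *)
Definition clamped c b (mu : R -> P) (cb : c <= b) (hmu : W2_continuous c b mu) (t : R) : P :=
  mu (clamp c b t).

Section clamped.
Variables (c b : R) (mu : R -> P) (cb : c <= b) (hmu : W2_continuous c b mu).
Local Notation kap := (clamped cb hmu).

Lemma W2_near t e : 0 < e -> exists2 dl : R, 0 < dl & forall s, `|s - t| < dl -> W2 (kap t) (kap s) < e.
Proof.
move=> e0; have /(@cvgrPdist_lt _ R^o)/(_ e e0) := hmu (clamp_itv t cb).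
rewrite near_withinE => /near_delta[dl dl0 hd]; exists dl => // s st.
have := hd (clamp c b s) (le_lt_trans (clamp_lip _ _ _ _) st) (clamp_itv s cb).
by rewrite sub0r normrN ger0_norm ?W2_ge0.
Qed.

Lemma continuous_kap f K : 0 <= K -> (forall x y, `|f x - f y| <= K * tdist x y) ->
  continuous (fun t => \int[kap t]_y f y).
Proof.
move=> K0 hf t; have mf := lipschitz_measurable K0 hf.
apply/(@cvgrPdist_le _ R^o) => e e0.
have e1 : 0 < e / (K + 1) by rewrite divr_gt0// ltr_wpDl.
have [dl dl0 hd] := W2_near t e1.
apply/nbhs_ballP; exists dl => //= s; rewrite /ball/= distrC => st.
rewrite (le_trans (W2_lipschitz (hd s st) mf hf K0))//.
by rewrite mulrCA ler_piMr ?(ltW e0)// ler_pdivrMr ?ltr_wpDl// mul1r lerDl.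
Qed.

(** A W2-continuous curve is a probability kernel: integrals of Lipschitz functions are
    continuous in time, indicators of open sets are their limits, and open sets generate. *)
Lemma measurable_kap A : measurable A -> measurable_fun setT (fun t => kap t A).
Proof.
move=> mA; move: A mA; apply: (@dynkin_induction _ T (@open T)) => //.
- exact: openI.
- rewrite (_ : (fun t => _) = (fun=> 1%E)); first exact: measurable_cst.
  by apply/funext => t; exact: probability_setT.
- move=> O oO; have mO : measurable O by exact: sub_sigma_algebra.
  have [h|/set0P cO] := eqVneq (~` O) set0.
    rewrite (_ : (fun t => _) = (fun=> 1%E)); first exact: measurable_cst.
    apply/funext => t; rewrite (_ : O = setT); first exact: probability_setT.
    by rewrite -(setCK O) h setC0.
  pose f n t := (\int[kap t]_y plateau O n y)%:E.
  have lipn n x y := plateau_lip n x y cO.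
  have mf n : measurable_fun setT (f n).
    apply/measurable_EFinP; apply: continuous_measurable_fun.
    exact: (continuous_kap (ler0n _ n) (lipn n)).
  apply: (emeasurable_fun_cvg f (fun t => kap t O) mf) => t _.
  have -> : kap t O = (\int[kap t]_y (\1_O y : R))%:E.
    rewrite /Rintegral fineK; first by rewrite integral_indic// setIT.
    by rewrite integral_indic// setIT fin_num_measure.
  apply: cvg_EFin; first by apply: nearW.
  apply: (@Rdominated_cvg _ _ _ (kap t) setT (plateau O) _ (fun=> 1)) => //.
  + by move=> n; exact: (lipschitz_measurable (ler0n _ n) (lipn n)).
  + by move=> x _; exact: plateau_cvg.
  + exact: (@prob_integrable _ _ _ _ _ `|1|).
  + by move=> n x _; have /andP[h1 h2] := plateau_itv n x cO; rewrite ger0_norm.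
- move=> S mS hS; rewrite (_ : (fun t => _) = (fun t => 1 - kap t S)%E); last first.
    by apply/funext => t; rewrite probability_setC.
  by apply: emeasurable_funB => //; exact: measurable_cst.
- move=> F mF tF hF; rewrite (_ : (fun t => _) = (fun t => \sum_(0 <= k <oo) kap t (F k))%E).
    exact: ge0_emeasurable_sum.
  by apply/funext => t; rewrite measure_semi_bigcup//; exact: bigcup_measurable.
Qed.

End clamped.

Definition clamped_kernel c b mu (cb : c <= b) (hmu : W2_continuous c b mu) :
  R -> {measure set T -> \bar R} := clamped cb hmu.

HB.instance Definition _ c b mu (cb : c <= b) (hmu : W2_continuous c b mu) :=
  isKernel.Build _ _ R T R (clamped_kernel cb hmu) (@measurable_kap c b mu cb hmu).
HB.instance Definition _ c b mu (cb : c <= b) (hmu : W2_continuous c b mu) :=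
  Kernel_isProbability.Build _ _ R T R (clamped_kernel cb hmu) (fun t => probability_setT (clamped cb hmu t)).

Lemma measurable_clamped_integral c b mu (cb : c <= b) (hmu : W2_continuous c b mu)
    (h : R * T -> R) : measurable_fun setT h ->
  measurable_fun setT (fun t => \int[clamped cb hmu t]_y h (t, y)).
Proof.
move=> /measurable_EFinP mh; apply: (measurableT_comp (@fine_measurable R setT _)) => //.
rewrite (_ : (fun t => _) = (fun t => \int[clamped cb hmu t]_y (EFin \o h)^\+ (t, y) -
   \int[clamped cb hmu t]_y (EFin \o h)^\- (t, y))%E); last first.
  by apply/funext => t; rewrite integralE; congr (_ - _)%E; apply: eq_integral => y _;
    rewrite ?funeposE ?funenegE.
apply: emeasurable_funB.
  apply: (@measurable_fun_integral_finite_kernel _ _ R T R _ (clamped_kernel cb hmu)) => //.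
  exact: measurable_funepos.
apply: (@measurable_fun_integral_finite_kernel _ _ R T R _ (clamped_kernel cb hmu)) => //.
exact: measurable_funeneg.
Qed.

End kernel.

(** * Smooth cutoffs in time *)

Section flat.
Context {R : realType}.

(** The functions t^(-m) exp (- 1 / t), extended by 0 to t <= 0: their span contains
    exp (- 1 / t) and is closed under differentiation, which gives smoothness by induction. *)
Definition flat (m : nat) (t : R) : R := if 0 < t then (t^-1) ^+ m * expR (- t^-1) else 0.

Lemma flat_gt0 m t : 0 < t -> flat m t = (t^-1) ^+ m * expR (- t^-1).
Proof. by rewrite /flat => ->. Qed.

Lemma flat_le0 m t : t <= 0 -> flat m t = 0.
Proof. by rewrite /flat ltNge => ->. Qed.

Lemma flat_ge0 m t : 0 <= flat m t.
Proof.
rewrite /flat; case: ifPn => // t0.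
by rewrite mulr_ge0 ?expR_ge0// exprn_ge0// invr_ge0 ltW.
Qed.

(** From the term of degree m + 2 in the exponential series at 1 / t. The quadratic bound gives
    the derivative 0 at the origin. *)
Lemma flat_quad m t : `|flat m t| <= (m.+2)`!%:R * t ^+ 2.
Proof.
rewrite ger0_norm ?flat_ge0// /flat; case: ifPn => t0; last by rewrite mulr_ge0// sqr_ge0.
have x0 : 0 < t^-1 by rewrite invr_gt0.
rewrite expRN ler_pdivrMr ?expR_gt0//.
have F0 : 0 < (m.+2)`!%:R :> R by rewrite ltr0n fact_gt0.
have h := expR_ge1Dxn m.+1 (ltW x0).
have {}h : (t^-1) ^+ m.+2 / (m.+2)`!%:R <= expR t^-1 by apply: le_trans h; rewrite lerDr.
rewrite ler_pdivrMr// in h.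
have -> : (t^-1) ^+ m = (t^-1) ^+ m.+2 * t ^+ 2.
  by rewrite -addn2 exprD -mulrA -exprMn mulVf ?gt_eqF// expr1n mulr1.
rewrite (le_trans (ler_wpM2r (sqr_ge0 t) h))// le_eqVlt; apply/orP; left; apply/eqP; ring.
Qed.

Lemma is_derive_flat m (t : R) : is_derive t 1 (flat m) (flat m.+2 t - m%:R * flat m.+1 t).
Proof.
have [t0|t0|t0] := ltgtP t 0.
- rewrite !flat_le0 ?(ltW t0)// mulr0 subr0.
  apply: (@near_eq_is_derive R R^o R^o (cst 0) (flat m) t 1 0).
  near=> s; rewrite flat_le0//; apply: ltW; near: s; exact: lt_nbhsl.
- rewrite !flat_gt0//.
  apply: (@near_eq_is_derive _ _ _ (fun s : R => (s^-1) ^+ m * expR (- s^-1))).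
    near=> s; rewrite flat_gt0//; near: s; exact: lt_nbhsr.
  have dV : is_derive t 1 (fun s : R => s^-1) (- (t^-1) ^+ 2).
    have := @is_deriveV R id t 1 1 (lt0r_neq0 t0) (is_derive_id t 1).
    by move=> h; apply: (is_derive_eq h); rewrite exprVn [LHS]mulr1.
  have dX := is_deriveX m dV.
  have dN := is_deriveN dV.
  have dE := @is_derive1_comp R expR _ t _ _ (is_derive_expR _) dN.
  rewrite (_ : (fun s : R => _) = ((fun s : R => s^-1) ^+ m) * (expR \o - (fun s : R => s^-1))); last first.
    by apply/funext => s; rewrite /= !fctE.
  apply: (is_derive_eq (is_deriveM dX dE)).
  rewrite !fctE /= /GRing.scale/=; set e := expR _; set x := t^-1.
  case: (m) => [|m'].
    by rewrite !mul0r mulr0 addr0 subr0 expr0 mul1r mulrC; ring.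
  by rewrite /= !exprS; ring.
- rewrite t0 !flat_le0// mulr0 subr0.
  apply: zero_derivativeP => e e0.
  have F0 : 0 < (m.+2)`!%:R :> R by rewrite ltr0n fact_gt0.
  exists (e / (m.+2)`!%:R) => [|h hh]; first by rewrite divr_gt0.
  rewrite add0r (flat_le0 m (lexx 0)) subr0 (le_trans (flat_quad _ _))//.
  rewrite -real_normK ?num_real// expr2 mulrA ler_wpM2r//.
  by rewrite mulrC -ler_pdivlMr// ltW.
Unshelve. all: by end_near. Qed.

End flat.

Section Ck.
Context {R : realType} {d : nat}.
Local Notation Rd := 'rV[R]_d.
Local Notation E := (R^o * Rd)%type.
Implicit Types (f g : E -> R^o).

Lemma Ck_lin k (a : R) f g : Ck k f -> Ck k g -> Ck k (fun z => a * f z + g z).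
Proof.
elim: k f g => [|k IH] f g /=.
  move=> cf cg z; apply: cvgD; last exact: cg.
  by apply: cvgM; [exact: cvg_cst|exact: cf].
move=> [df kf] [dg kg].
have daf z : differentiable (fun z => a * f z : R^o) z by apply: differentiableM => //.
split=> [z|v]; first by apply: differentiableD.
rewrite (_ : (fun z => _) = (fun z => a * 'D_v f z + 'D_v g z)); first by apply: IH.
apply/funext => z; rewrite deriveD; [|exact: diff_derivable|exact: diff_derivable].
by congr (_ + _); apply: (@deriveZ _ _ _ f a); exact: diff_derivable.
Qed.

Section scaled.
Variables (N c : R).
Let l t := N * (t - c) - 1.

Lemma is_derive_scaled m (t : R) :
  is_derive t 1 (fun s => flat m (l s)) (N * (flat m.+2 (l t) - m%:R * flat m.+1 (l t))).
Proof.
have dl : is_derive t 1 l N.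
  apply: is_derive_eq.
  by rewrite !subr0 [LHS]mulr1.

have := @is_derive1_comp R (flat m) l t _ _ (is_derive_flat m _) dl.
by rewrite mulrC.
Qed.

Lemma diff_scaled m (z : E) : differentiable (fun z : E => flat m (l z.1) : R^o) z.
Proof.
apply: (@differentiable_comp _ _ _ _ (fst : E -> R^o) (fun s : R^o => flat m (l s) : R^o)).
  apply: (@linear_differentiable R E R^o (fst : {linear E -> R^o}) z).
  by move=> w; exact: cvg_fst.
by apply/derivable1_diffP; case: (is_derive_scaled m z.1).
Qed.

Lemma derive_scaled m (z v : E) :
  'D_v (fun z : E => flat m (l z.1) : R^o) z =
  v.1 * (N * (flat m.+2 (l z.1) - m%:R * flat m.+1 (l z.1))).
Proof.
have -> : 'D_v (fun z : E => flat m (l z.1) : R^o) z = 'D_(v.1) (fun s : R^o => flat m (l s) : R^o) z.1 by [].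
have [dv ev] := is_derive_scaled m z.1.
have df : differentiable (fun s : R^o => flat m (l s) : R^o) z.1 by exact/derivable1_diffP.
rewrite deriveE// -ev deriveE// -{1}[v.1]mulr1.
exact: linearZ.
Qed.

Lemma derive_scaledM m f (z v : E) : differentiable f z ->
  'D_v (fun z => flat m (l z.1) * f z : R^o) z =
  flat m (l z.1) * 'D_v f z + f z * (v.1 * (N * (flat m.+2 (l z.1) - m%:R * flat m.+1 (l z.1)))).
Proof.
move=> df; rewrite (@deriveM _ _ (fun z => flat m (l z.1)) f); first by rewrite derive_scaled.
  exact/diff_derivable/diff_scaled.
exact: diff_derivable.
Qed.

(** The derivative of a product flat m * f is a combination of such products, with
    larger m or with f replaced by its derivative, so that the induction is on k alone. *)
Lemma Ck_scaledM k m f : (forall j, Ck j f) -> Ck k (fun z => flat m (l z.1) * f z).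
Proof.
elim: k m f => [|k IH] m f cf /=.
  move=> z; apply: cvgM; last exact: (cf 0%N).
  exact: (differentiable_continuous (diff_scaled m z)).
have df z : differentiable f z by have [] := cf 1%N.
split=> [z|v]; first by apply: differentiableM => //; exact: diff_scaled.
have cDf j : Ck j (fun z => 'D_v f z) by have [_] := cf j.+1; exact.
rewrite (_ : (fun z => _) = (fun z : E => (v.1 * N) * (flat m.+2 (l z.1) * f z) +
   ((- (v.1 * N * m%:R)) * (flat m.+1 (l z.1) * f z) + flat m (l z.1) * 'D_v f z))).
  by apply: Ck_lin; [exact: IH|apply: Ck_lin; exact: IH].
apply/funext => z; rewrite derive_scaledM//; ring.
Qed.

End scaled.
End Ck.

Section mean_value.
Context {R : realType} {d : nat}.
Local Notation leb := (@lebesgue_measure R).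
Local Notation Rd := 'rV[R]_d.
Local Notation T := (torus R d).
Local Notation P := (prob_torus R d).
Local Notation E := (R^o * Rd)%type.

Lemma segment_is_derive (f : E -> R^o) (z w : E) (s : R) : differentiable f (s *: w + z) ->
  is_derive s 1 (fun r : R => f (r *: w + z) : R) ('D_w f (s *: w + z)).
Proof.
move=> df.
have e : (fun h : R => h^-1 *: (((fun r : R => f (r *: w + z)) \o shift s) (h *: (1 : R^o)) - f (s *: w + z))) =
         (fun h : R => h^-1 *: ((f \o shift (s *: w + z)) (h *: w) - f (s *: w + z))).
  apply/funext => h; congr (_ *: (f _ - _)).
  by rewrite /shift [h *: (1 : R^o)]mulr1 scalerDl addrA.
have dv : derivable f (s *: w + z) w by exact: diff_derivable.
by apply: DeriveDef; rewrite /derivable /derive e.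
Qed.

Lemma segment_bound (f : E -> R^o) (z w : E) (B : R) : (forall z, differentiable f z) ->
  (forall s : R, s \in `[0, 1] -> `|'D_w f (s *: w + z)| <= B) -> `|f (w + z) - f z| <= B.
Proof.
move=> df hB.
have dg (s : R) : s \in `]0, 1[ -> is_derive s 1 (fun r : R => f (r *: w + z) : R) ('D_w f (s *: w + z)).
  by move=> _; exact: segment_is_derive.
have cg : {within `[0, 1], continuous (fun r : R => f (r *: w + z) : R)}.
  apply: continuous_subspaceT => s; apply: differentiable_continuous.
  by apply/derivable1_diffP; case: (segment_is_derive (df (s *: w + z))).
have [s s01] := MVT ltr01 dg cg.
rewrite scale1r scale0r add0r subr0 mulr1 => ->; apply: hB.
exact: subset_itv_oo_cc.
Qed.

Variable (phi : R -> T -> R).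
Hypothesis hphi : C1 (periodization phi).

Lemma test_lip (a b : R) : exists2 K : R, 0 <= K &
  (forall t x y, t \in `[a, b] -> `|phi t x - phi t y| <= K * tdist x y) /\
  (forall s t y, s \in `[a, b] -> t \in `[a, b] -> `|phi s y - phi t y| <= K * `|s - t|).
Proof.
have pf := periodic_periodization phi.
have [K K0 hK] := der_bounded a b hphi pf; have [df _] := hphi.
exists K => //; split=> [t x y tab|s t y sab tab].
  rewrite distrC -{1}(tdispK x y) /tshift (phiE phi t x).
  have -> : phi t (tproj (tlift x + tdisp x y)) =
      periodization phi (((0, tdisp x y) : E) + (t, tlift x)).
    by rewrite /periodization /= add0r addrC.
  apply: segment_bound => // r _; rewrite deriveE//.
  have -> : r *: ((0, tdisp x y) : E) + (t, tlift x) = (t, r *: tdisp x y + tlift x).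
    by congr pair; rewrite /= scaler0 add0r.
  rewrite diff_coordE// mul0r add0r (le_trans (normr_dotv_le _ _))// ler_wpM2r ?enorm_ge0//.
  by have [] := hK t (r *: tdisp x y + tlift x) tab.
rewrite (phiE phi s) (phiE phi t).
have -> : (s, tlift y) = ((s - t, 0) : E) + (t, tlift y).
  by congr pair; rewrite /= ?subrK ?add0r.
apply: segment_bound => // r r01; rewrite deriveE//.
have -> : r *: ((s - t, 0) : E) + (t, tlift y) = (r * (s - t) + t, tlift y).
  by congr pair; rewrite /= scaler0 add0r.
rewrite diff_coordE// dotvC dotv0l addr0 normrM mulrC ler_wpM2r//.
have rab : r * (s - t) + t \in `[a, b].
  move: r01 sab tab; rewrite !in_itv/= => /andP[r0 r1] /andP[as_ sb] /andP[at_ tb].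
  have -> : r * (s - t) + t = r * s + (1 - r) * t by ring.
  apply/andP; split.
    have -> : a = r * a + (1 - r) * a by ring.
    by rewrite lerD// ler_wpM2l// subr_ge0.
  have -> : b = r * b + (1 - r) * b by ring.
  by rewrite lerD// ler_wpM2l// subr_ge0.
by have [] := hK (r * (s - t) + t) (tlift y) rab.
Qed.

End mean_value.

Section cutoff.
Context {R : realType}.
Local Notation leb := (@lebesgue_measure R).
Variable (c : R).

(** A smooth cutoff that vanishes up to c + 1 / (n + 1), hence near c; its values at each
    t > c tend to 1 as n grows. *)
Definition ramp (n : nat) (t : R) : R := flat 0 (n.+1%:R * (t - c) - 1).
Definition dramp (n : nat) (t : R) : R := n.+1%:R * flat 2 (n.+1%:R * (t - c) - 1).

Lemma is_derive_ramp n (t : R) : is_derive t 1 (ramp n) (dramp n t).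
Proof. by apply: (is_derive_eq (is_derive_scaled _ _ 0 t)); rewrite mul0r subr0. Qed.

Lemma continuous_flat m : continuous (flat m : R -> R).
Proof.
move=> t; apply: differentiable_continuous; apply/derivable1_diffP.
by case: (is_derive_flat m t).
Qed.

Lemma continuous_scale n : continuous (fun t : R => n.+1%:R * (t - c) - 1).
Proof.
move=> t; apply: cvgB; last exact: cvg_cst.
by apply: cvgM; [exact: cvg_cst|apply: cvgB; [exact: cvg_id|exact: cvg_cst]].
Qed.

Lemma continuous_ramp n : continuous (ramp n).
Proof.
by move=> t; apply: (@continuous_comp _ _ _ (fun t : R => n.+1%:R * (t - c) - 1) (flat 0));
  [exact: continuous_scale|exact: continuous_flat].
Qed.

Lemma continuous_dramp n : continuous (dramp n).
Proof.
move=> t; apply: cvgM; first exact: cvg_cst.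
by apply: (@continuous_comp _ _ _ (fun t : R => n.+1%:R * (t - c) - 1) (flat 2));
  [exact: continuous_scale|exact: continuous_flat].
Qed.

Lemma dramp_ge0 n t : 0 <= dramp n t.
Proof. by rewrite mulr_ge0// flat_ge0. Qed.

Lemma ramp_itv n t : 0 <= ramp n t <= 1.
Proof.
rewrite flat_ge0/= /ramp; set x := _ - 1; have [x0|x0] := leP x 0; first by rewrite flat_le0.
by rewrite flat_gt0// expr0 mul1r expR_le1 oppr_le0 invr_ge0 ltW.
Qed.

Lemma ramp_eq0 n t : n.+1%:R * (t - c) <= 1 -> ramp n t = 0.
Proof. by move=> h; rewrite /ramp flat_le0// subr_le0. Qed.

Lemma ramp_cvg t : c < t -> (fun n => ramp n t) @ \oo --> (1 : R).
Proof.
move=> ct; have ct0 : 0 < t - c by rewrite subr_gt0.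
apply/(@cvgrPdist_le _ R^o) => e e0; near=> n.
have : (1 + e^-1) / (t - c) <= n%:R by near: n; exact: nbhs_infty_ger.
rewrite ler_pdivrMr// => hn.
have x0 : e^-1 <= n.+1%:R * (t - c) - 1.
  rewrite lerBrDl (le_trans hn)// ler_wpM2r ?(ltW ct0)// ler_nat//.
have e1 : 0 < e^-1 by rewrite invr_gt0.
have x1 := lt_le_trans e1 x0.
rewrite /ramp flat_gt0// expr0 mul1r ger0_norm; last first.
  by rewrite subr_ge0 expR_le1 oppr_le0 invr_ge0 ltW.
rewrite (@le_trans _ _ (n.+1%:R * (t - c) - 1)^-1)//.
  by rewrite lerBlDr -lerBlDl expR_ge1Dx.
by rewrite -[leRHS]invrK lef_pV2.
Unshelve. all: by end_near. Qed.

Lemma integral_dramp n s t : s <= t ->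
  \int[leb]_(x in `[s, t]) dramp n x = ramp n t - ramp n s.
Proof.
rewrite le_eqVlt => /predU1P[<-|st]; first by rewrite set_itv1 Rintegral_set1 subrr.
rewrite /Rintegral (@continuous_FTC2 _ _ (ramp n))//.
- by apply: continuous_subspaceT; exact: continuous_dramp.
- split; first by move=> x _; case: (is_derive_ramp n x).
    by apply: cvg_at_right_filter; exact: continuous_ramp.
  by apply: cvg_at_left_filter; exact: continuous_ramp.
- by move=> x _; rewrite derive1E; case: (is_derive_ramp n x).
Qed.

Lemma dramp_integrable n s t : leb.-integrable `[s, t] (EFin \o dramp n).
Proof.
have [st|ts] := leP s t; last first.
  rewrite set_itv_ge; first exact: integrable_set0.
  by rewrite bnd_simp -ltNge.
apply: continuous_compact_integrable; first exact: segment_compact.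
by apply: continuous_subspaceT; exact: continuous_dramp.
Qed.

(** The derivatives of the cutoffs are nonnegative, have total mass tending to 1, and
    concentrate at c. *)
Lemma dramp_cvg (b K : R) (m : R -> R) : c < b -> measurable_fun setT m ->
  (forall t, t \in `[c, b] -> `|m t| <= K) ->
  (forall e : R, 0 < e -> exists2 dl : R, 0 < dl &
     forall t, t \in `[c, b] -> t <= c + dl -> `|m t - m c| <= e) ->
  (fun n => \int[leb]_(t in `[c, b]) (dramp n t * m t)) @ \oo --> m c.
Proof.
move=> cb mm mK cm.
have cc : c \in `[c, b] by rewrite in_itv/= lexx ltW.
have K0 : 0 <= K by rewrite (le_trans _ (mK _ cc)).
have rc n : ramp n c = 0 by rewrite ramp_eq0// subrr mulr0.
have idm n s t : c <= s -> t <= b -> leb.-integrable `[s, t] (EFin \o (fun t => dramp n t * m t)).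
  move=> cs tb; apply: (@itv_integrableM _ _ _ _ _ K); first exact: dramp_integrable.
    exact: measurable_funTS.
  move=> r; rewrite in_itv/= => /andP[sr rt]; apply: mK.
  by rewrite in_itv/= (le_trans cs)// (le_trans rt).
have e1 n : \int[leb]_(t in `[c, b]) (dramp n t * m t) =
    \int[leb]_(t in `[c, b]) (dramp n t * (m t - m c)) + ramp n b * m c.
  have -> : ramp n b * m c = \int[leb]_(t in `[c, b]) (dramp n t * m c).
    by rewrite RintegralZr//; [rewrite integral_dramp ?rc ?subr0// ltW|exact: dramp_integrable].
  rewrite -RintegralD//.
  - by apply: eq_Rintegral => t _; ring.
  - apply: (@itv_integrableM _ _ _ _ _ (K + K)); first exact: dramp_integrable.
      by apply: measurable_funTS; apply: measurable_funB => //; exact: measurable_cst.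
    by move=> t tcb; rewrite (le_trans (ler_normB _ _))// lerD// mK.
  - apply: (@itv_integrableM _ _ _ _ (fun=> m c) K); first exact: dramp_integrable.
      exact: measurable_cst.
    by move=> t tcb; exact: mK.
rewrite (funext e1) -[X in _ --> X]add0r -[X in _ --> _ + X]mul1r.
apply: (@cvgD _ R^o); last first.
  by apply: cvgM; [exact: ramp_cvg|exact: cvg_cst].
apply/(@cvgrPdist_le _ R^o) => e e0.
have e2 : 0 < e / 2 by rewrite divr_gt0.
have [dl dl0 hdl] := cm _ e2.
pose s := Num.min b (c + dl).
have cs : c < s by rewrite lt_min cb ltrDl.
have sb : s <= b by rewrite ge_min lexx.
have h1 := @ramp_cvg s cs; have h2 := @ramp_cvg b cb.
have e3 : 0 < e / 2 / (2 * (K + K + 1)) by rewrite !divr_gt0// mulr_gt0// ltr_wpDl// addr_ge0.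
near=> n; rewrite sub0r normrN.
have idm' p q : c <= p -> q <= b -> leb.-integrable `[p, q] (EFin \o (fun t => dramp n t * (m t - m c))).
  move=> cp qb; apply: (@itv_integrableM _ _ _ _ _ (K + K)); first exact: dramp_integrable.
    by apply: measurable_funTS; apply: measurable_funB => //; exact: measurable_cst.
  move=> r; rewrite in_itv/= => /andP[sr rt].
  have rcb : r \in `[c, b] by rewrite in_itv/= (le_trans cp)// (le_trans rt).
  by rewrite (le_trans (ler_normB _ _))// lerD// mK.
have bnd p q B : c <= p -> p <= q -> q <= b -> (forall t, t \in `[p, q] -> `|m t - m c| <= B) ->
    `|\int[leb]_(t in `[p, q]) (dramp n t * (m t - m c))| <= B * (ramp n q - ramp n p).
  move=> cp pq qb hB.
  rewrite -(integral_dramp n pq) mulrC -RintegralZr//; last exact: dramp_integrable.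
  rewrite (le_trans (le_normr_Rintegral _ _))//; first exact: idm'.
  apply: le_Rintegral_itv.
  - have := idm' p q cp qb; move=> /integrable_abse; apply: eq_integrable => // t _.
  - apply: (@itv_integrableM _ _ _ _ (fun=> B) `|B|); first exact: dramp_integrable.
      exact: measurable_cst.
    by move=> t _.
  - by move=> t tpq; rewrite normrM (ger0_norm (dramp_ge0 n t)) ler_wpM2l ?dramp_ge0// hB.
rewrite (@Rintegral_itv_split _ c s b)//; [|exact: ltW|exact: idm'].
rewrite (le_trans (ler_normD _ _))// [leRHS](splitr e) lerD//.
  rewrite (le_trans (bnd c s (e / 2) (lexx _) (ltW cs) sb _))//.
    move=> t; rewrite in_itv/= => /andP[ct ts]; apply: hdl.
      by rewrite in_itv/= ct (le_trans ts).
    by rewrite (le_trans ts)// ge_min lexx orbT.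
  rewrite rc subr0 ler_piMr ?(ltW e2)//; by have /andP[] := ramp_itv n s.
rewrite (le_trans (bnd s b (K + K) (ltW cs) sb (lexx _) _))//.
  move=> t; rewrite in_itv/= => /andP[st tb]; rewrite (le_trans (ler_normB _ _))// lerD// mK//.
  by rewrite in_itv/= tb (le_trans (ltW cs)).
have r1 : `|1 - ramp n s| <= e / 2 / (2 * (K + K + 1)).
  near: n; exact: (@cvgrPdist_le _ R^o _ _ _ _ _).1 h1 _ e3.
have /andP[_ rb] := ramp_itv n b.
have K1 : 0 < 2 * (K + K + 1) by rewrite mulr_gt0// ltr_wpDl// addr_ge0.
rewrite (@le_trans _ _ ((K + K) * (e / 2 / (2 * (K + K + 1)))))//.
  rewrite ler_wpM2l ?addr_ge0// (le_trans _ r1)// (le_trans _ (ler_norm _))// lerD2r//.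
rewrite mulrCA ler_piMr ?(ltW e2)// ler_pdivrMr// mul1r; lra.
Unshelve. all: by end_near. Qed.

End cutoff.

(** * Initial traces of weak solutions *)

Section weak_boundary.
Context {R : realType} {d : nat}.
Local Notation leb := (@lebesgue_measure R).
Local Notation Rd := 'rV[R]_d.
Local Notation T := (torus R d).
Local Notation P := (prob_torus R d).
Local Notation E := (R^o * Rd)%type.

Lemma Ck_C1 (f : E -> R^o) : (forall k, Ck k f) -> C1 f.
Proof.
move=> cf; split; first by have [] := cf 1%N.
by move=> v; have [_ h] := cf 1%N; exact: (h v).
Qed.

Section cutoff_test.
Variables (c : R) (phi : R -> T -> R).
Hypothesis cphi : forall k, Ck k (periodization phi).

Definition cut n (t : R) (y : T) : R := ramp c n t * phi t y.

Lemma cutE n : periodization (cut n) =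
  (fun z : E => flat 0 (n.+1%:R * (z.1 - c) - 1) * periodization phi z).
Proof. by []. Qed.

Lemma Ck_cut n k : Ck k (periodization (cut n)).
Proof. by rewrite cutE; exact: Ck_scaledM. Qed.

Let dphi z : differentiable (periodization phi) z.
Proof. by have [] := cphi 1%N. Qed.

Lemma dt_cut n t y : dt (cut n) t y = dramp c n t * phi t y + ramp c n t * dt phi t y.
Proof.
rewrite /dt cutE derive_scaledM// addrC; congr (_ + _).
by rewrite /= mul1r mul0r subr0 mulrC (phiE phi).
Qed.

Lemma gradx_cut n t y : gradx (cut n) t y = ramp c n t *: gradx phi t y.
Proof.
apply/rowP => i; rewrite !mxE cutE derive_scaledM//=.
by rewrite mul0r mulr0 addr0.
Qed.

Lemma test_cut n b b' : b' < b -> (forall t y, b' < t -> phi t y = 0) ->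
  test_function c b (cut n).
Proof.
move=> bb hphi; split; first by move=> k; exact: Ck_cut.
have n0 : 0 < n.+1%:R^-1 :> R by rewrite invr_gt0 ltr0n.
exists (c + n.+1%:R^-1), b'; split => //; first by rewrite ltrDl.
move=> t y; rewrite in_itv/= negb_and -!ltNge => /orP[h|h]; last by rewrite /cut hphi// mulr0.
rewrite /cut ramp_eq0 ?mul0r// -ler_pdivlMl ?ltr0n// mulr1 lerBlDl.
exact: ltW.
Qed.

End cutoff_test.

(** Test the equation with the cutoffs of phi near c. The terms containing the derivative of
    the cutoff converge to the value at c of the continuous function t |-> int phi(t) d mu_t,
    and the others to the integral without cutoff. *)
Lemma weak_boundary (c b b' M : R) (mu : R -> P) (v : R -> T -> Rd) (phi : R -> T -> R) :
  c < b -> W2_continuous c b mu ->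
  vmeasurable (`[c, b] `*` setT) (fun z : R * T => v z.1 z.2) ->
  (forall t y, t \in `[c, b] -> enorm (v t y) <= M) ->
  continuity_equation c b mu v ->
  (forall k, Ck k (periodization phi)) -> b' < b -> (forall t y, b' < t -> phi t y = 0) ->
  \int[leb]_(t in `[c, b]) (\int[mu t]_y (dt phi t y + dotv (gradx phi t y) (v t y))) =
  - \int[mu c]_y phi c y.
Proof.
move=> cb hmu mv vM hv cphi bb phi0.
have hphi := Ck_C1 cphi.
pose kap := clamped (ltW cb) hmu.
have kapE t : t \in `[c, b] -> kap t = mu t by move=> h; rewrite /kap /clamped clamp_id.
have cc : c \in `[c, b] by rewrite in_itv/= lexx ltW.
have M0 : 0 <= M by rewrite (le_trans (enorm_ge0 _) (vM c (tproj 0) cc)).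
pose D : set (R * T) := `[c, b] `*` setT.
have mD : measurable D by exact: measurableX.
pose V (z : R * T) : Rd := if z.1 \in `[c, b] then v z.1 z.2 else 0.
have mV : vmeasurable setT V.
  move=> i; have := (measurable_restrictT (fun z : R * T => v z.1 z.2 0 i) mD).1 (mv i).
  apply: eq_measurable_fun => z _; rewrite patchE /V.
  have -> : (z \in D) = (z.1 \in `[c, b]).
    by apply/idP/idP => [/set_mem[]//|h]; apply/mem_set.
  by case: ifP => // _; rewrite mxE.
have VM z : enorm (V z) <= M by rewrite /V; case: ifP => [h|_]; [exact: vM|rewrite enorm0].
have [K K0 hK] := test_bounded hphi c b.
have [K1 K10 [lipx lipt]] := test_lip hphi c b.
pose psi (z : R * T) := dt phi z.1 z.2 + dotv (gradx phi z.1 z.2) (V z).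
have mphi2 : measurable_fun setT (fun z : R * T => phi z.1 z.2) by exact: measurable_phi.
have mdt2 : measurable_fun setT (fun z : R * T => dt phi z.1 z.2) by exact: measurable_dt.
have mgr2 : vmeasurable setT (fun z : R * T => gradx phi z.1 z.2) by exact: measurable_gradx.
have mpsi : measurable_fun setT psi by apply: measurable_funD => //; exact: measurable_dotv.
have psiB t y : t \in `[c, b] -> `|psi (t, y)| <= K + K * M.
  move=> tcb; have [_ h1 h2] := hK t y tcb.
  rewrite (le_trans (ler_normD _ _))// lerD// (le_trans (normr_dotv_le _ _))//.
  by rewrite ler_pM// enorm_ge0.
pose H t := \int[kap t]_y psi (t, y).
pose m t := \int[kap t]_y phi t y.
have mH : measurable_fun setT H by exact: measurable_clamped_integral.
have mm : measurable_fun setT m.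
  exact: (measurable_clamped_integral (ltW cb) hmu mphi2).
have mpsit t : measurable_fun setT (fun y => psi (t, y)) by exact: measurable_sect1.
have mphit t : measurable_fun setT (phi t) by exact: (measurable_sect1 t mphi2).
have mK t : t \in `[c, b] -> `|m t| <= K.
  by move=> tcb; apply: prob_Rintegral_le => // y; have [] := hK t y tcb.
have HB t : t \in `[c, b] -> `|H t| <= K + K * M.
  by move=> tcb; apply: prob_Rintegral_le => // y; exact: psiB.
have eqn n : \int[leb]_(t in `[c, b]) (dramp c n t * m t) +
    \int[leb]_(t in `[c, b]) (ramp c n t * H t) = 0.
  rewrite -(hv _ (test_cut c cphi n bb phi0)) -RintegralD//; first last.
  - apply: (@itv_integrable _ _ _ _ (K + K * M)).
      by apply: measurable_funM => //; exact: continuous_measurable_fun (@continuous_ramp _ c n).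
    move=> t tcb; rewrite normrM -[leRHS]mul1r ler_pM ?HB//.
    by have /andP[r0 r1] := ramp_itv c n t; rewrite ger0_norm.
  - apply: (@itv_integrableM _ _ _ _ _ K); first exact: dramp_integrable.
      exact: measurable_funTS.
    exact: mK.
  apply: eq_Rintegral => t /set_mem tcb; rewrite -(kapE _ tcb).
  transitivity (\int[kap t]_y (dramp c n t * phi t y + ramp c n t * psi (t, y))); last first.
    apply: eq_Rintegral => y _; rewrite dt_cut// gradx_cut// dotvZl /psi /V /= tcb; ring.
  have i1 : (kap t).-integrable setT (EFin \o phi t).
    by apply: (@prob_integrable _ _ _ _ _ K) => // y; have [] := hK t y tcb.
  have i2 : (kap t).-integrable setT (EFin \o (fun y => psi (t, y))).
    by apply: (@prob_integrable _ _ _ _ _ (K + K * M)) => // y; exact: psiB.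
  have j1 : (kap t).-integrable setT (EFin \o (fun y => dramp c n t * phi t y)).
    apply: (@prob_integrable _ _ _ _ _ (dramp c n t * K)).
      by apply: measurable_funM => //; exact: measurable_cst.
    move=> y; rewrite normrM (ger0_norm (dramp_ge0 _ _ _)) ler_wpM2l ?dramp_ge0//.
    by have [] := hK t y tcb.
  have j2 : (kap t).-integrable setT (EFin \o (fun y => ramp c n t * psi (t, y))).
    apply: (@prob_integrable _ _ _ _ _ (K + K * M)).
      by apply: measurable_funM => //; exact: measurable_cst.
    move=> y; rewrite normrM -[leRHS]mul1r ler_pM ?psiB//.
    by have /andP[r0 r1] := ramp_itv c n t; rewrite ger0_norm.
  by rewrite RintegralD// !RintegralZl.
(* t |-> int phi(t) d mu_t is continuous at c: phi is Lipschitz in both variables *)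
have cm (e : R) : 0 < e -> exists2 dl : R, 0 < dl &
     forall t, t \in `[c, b] -> t <= c + dl -> `|m t - m c| <= e.
  move=> e0; have e2 : 0 < e / 2 by rewrite divr_gt0.
  have ck := @continuous_kap _ _ c b mu (ltW cb) hmu (phi c) K1 K10 (fun x y => lipx c x y cc).
  have [dl dl0 hdl] := near_delta (cont_near c ck e2).
  have K2 : 0 < K1 + 1 by rewrite ltr_wpDl.
  exists (Num.min (dl / 2) (e / 2 / (K1 + 1))); first by rewrite lt_min !divr_gt0.
  move=> t tcb htc; have [ct tb] : c <= t /\ t <= b by move: tcb; rewrite in_itv/= => /andP.
  have tc1 : `|t - c| <= dl / 2.
    by rewrite ger0_norm ?subr_ge0// lerBlDl (le_trans htc)// lerD2l ge_min lexx.
  have tc2 : `|t - c| <= e / 2 / (K1 + 1).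
    by rewrite ger0_norm ?subr_ge0// lerBlDl (le_trans htc)// lerD2l ge_min lexx orbT.
  have h1 := hdl t; rewrite (le_lt_trans tc1) in h1; last by rewrite ltr_pdivrMr// ltr_pMr// ltr1n.
  have -> : m t - m c = \int[kap t]_y (phi t y - phi c y) + (\int[kap t]_y phi c y - m c).
    rewrite RintegralB//; first by rewrite addrA subrK.
    - by apply: (@prob_integrable _ _ _ _ _ K) => // y; have [] := hK t y tcb.
    - by apply: (@prob_integrable _ _ _ _ _ K) => // y; have [] := hK c y cc.
  rewrite (le_trans (ler_normD _ _))// [leRHS](splitr e) lerD//; last exact: h1.
  rewrite (@le_trans _ _ (K1 * `|t - c|))//.
    by apply: prob_Rintegral_le => [|y]; [exact: measurable_funB|exact: lipt].
  rewrite (le_trans (ler_wpM2l K10 tc2))// mulrCA ler_piMr ?(ltW e2)//.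
  by rewrite ler_pdivrMr// mul1r lerDl.
have lim1 := dramp_cvg cb mm mK cm.
(* the cutoffs vanish at c itself, so the pointwise limit is cut there *)
pose H0 t := if c < t then H t else 0.
have mH0 : measurable_fun setT H0.
  apply: measurable_fun_ifT => //.
  exact: measurable_fun_ltr.
have lim2 : (fun n => \int[leb]_(t in `[c, b]) (ramp c n t * H t)) @ \oo -->
    \int[leb]_(t in `[c, b]) H0 t.
  apply: (@itv_dominated_cvg _ c b _ H0 (fun=> K + K * M)).
  - move=> n; apply: measurable_funTS; apply: measurable_funM => //.
    exact: continuous_measurable_fun (@continuous_ramp _ c n).
  - exact: measurable_funTS.
  - move=> t tcb; rewrite /H0; case: ifPn => [ct|].
      rewrite -[X in _ --> X]mul1r; apply: cvgM; [exact: ramp_cvg|exact: cvg_cst].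
    rewrite -leNgt => tc; rewrite (_ : (fun n => _) = (fun=> 0)); first exact: cvg_cst.
    apply/funext => n; rewrite ramp_eq0 ?mul0r// (@le_trans _ _ 0)//.
    by rewrite mulr_ge0_le0// subr_le0.
  - by apply: (@itv_integrable _ _ _ _ `|K + K * M|).
  - move=> n t tcb; rewrite normrM -[leRHS]mul1r ler_pM ?HB//.
    by have /andP[r0 r1] := ramp_itv c n t; rewrite ger0_norm.
have H0H : \int[leb]_(t in `[c, b]) H0 t = \int[leb]_(t in `[c, b]) H t.
  have iH : leb.-integrable `[c, b] (EFin \o H) by exact: (itv_integrable mH HB).
  have iH0 : leb.-integrable `[c, b] (EFin \o H0).
    apply: (itv_integrable mH0 (M := K + K * M)) => t tcb; rewrite /H0; case: ifP => [_|_]; first exact: HB.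
    by rewrite normr0 addr_ge0// mulr_ge0.
  rewrite -Rintegral_itv_obnd_cbnd; last first.
    by apply: integrableS iH0 => //; exact: subset_itv_oc_cc.
  rewrite -[RHS]Rintegral_itv_obnd_cbnd; last first.
    by apply: integrableS iH => //; exact: subset_itv_oc_cc.
  by apply: eq_Rintegral => t /set_mem; rewrite /= in_itv/= /H0 => /andP[-> _].
have : m c + \int[leb]_(t in `[c, b]) H0 t = 0.
  have lim3 : (fun n => \int[leb]_(t in `[c, b]) (dramp c n t * m t) +
      \int[leb]_(t in `[c, b]) (ramp c n t * H t)) @ \oo --> m c + \int[leb]_(t in `[c, b]) H0 t.
    exact: (@cvgD _ R^o _ \oo _ _ _ _ _ lim1 lim2).
  rewrite (funext eqn) in lim3.
  by rewrite -(cvg_lim (@Rhausdorff R) lim3) lim_cst.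
rewrite H0H => h.
have -> : \int[mu c]_y phi c y = m c by rewrite /m kapE.
have -> : - m c = \int[leb]_(t in `[c, b]) H t by apply/eqP; rewrite eq_sym -addr_eq0 addrC h.
apply: eq_Rintegral => t /set_mem tcb; rewrite /H kapE//.
by apply: eq_Rintegral => y _; rewrite /psi /V /= tcb.
Qed.

End weak_boundary.

(** * Concatenation of trajectories *)

Section velocity_of_path.
Context {R : realType} {d : nat}.
Local Notation leb := (@lebesgue_measure R).
Local Notation Rd := 'rV[R]_d.
Local Notation T := (torus R d).
Local Notation P := (prob_torus R d).

Lemma bounded_lebesgue_pt (f : R -> R) M : measurable_fun setT f -> (forall t, `|f t| <= M) ->
  {ae leb, forall t, lebesgue_pt f t}.
Proof.
move=> mf fM; apply: lebesgue_differentiation; split => //; first exact: openT.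
move=> K _ cK; have [m [_ hm]] := compact_bounded cK.
have mK : measurable K by exact: compact_measurable.
have Kfin : (leb K < +oo)%E by exact: compact_finite_measure.
have := @integrable_bounded _ _ _ leb K f M mK Kfin (measurable_funTS mf) (fun t _ => fM t).
by move=> /integrableP[_].
Qed.

Lemma coord_cvg (G : set_system R) (FG : Filter G) (f : R -> Rd) (l : Rd) :
  (forall i, (fun h => f h 0 i) @ G --> l 0 i) -> f @ G --> l.
Proof.
move=> hf; apply/cvgrPdist_le => e e0.
have d0 : 0 < d%:R + 1 :> R by rewrite ltr_wpDl.
have e1 : 0 < e / (d%:R + 1) by rewrite divr_gt0.
have : \forall h \near G, forall i, `|l 0 i - f h 0 i| <= e / (d%:R + 1).
  by apply: filter_forall => i; exact: (@cvgrPdist_le _ R^o _ _ _ _ _).1 (hf i) _ e1.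
apply: filterS => h hh; rewrite (le_trans (le_norm_enorm _))// (le_trans (enorm_le_sum _))//.
rewrite (le_trans (ler_sum _ (G := fun=> e / (d%:R + 1)) _))//.
  by move=> i _; rewrite coordB.
rewrite sumr_const card_ord -[_ *+ d]mulr_natl mulrCA ler_piMr ?(ltW e0)//.
by rewrite ler_pdivrMr// mul1r lerDl.
Qed.

(** Almost every time is a Lebesgue point of all coordinates of u; there the difference
    quotients converge, and small displacements on the torus coincide with their lifts. *)
Lemma path_velocity (a M : R) (x0 : T) (u : R -> Rd) : vbounded M u ->
  {ae leb, forall t, a < t -> has_velocity (agent_path a x0 u) t (u t)}.
Proof.
move=> hu; have [mu hM] := hu.
have M0 : 0 <= M by rewrite (le_trans (enorm_ge0 _) (hM 0)).
have H : {ae leb, forall t, forall i : 'I_d, lebesgue_pt (fun s => u s 0 i) t}.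
  apply: filter_forall => i; apply: (bounded_lebesgue_pt (M := M)); first exact: mu.
  by move=> t; rewrite (le_trans (le_coord_enorm _ _)).
apply: (@filterS _ _ (ae_filter_ringOfSetsType leb)) H => t ht at_; rewrite /has_velocity.
have lip s : enorm (vint a s u - vint a t u) <= M * `|s - t| by exact: vint_lip.
have small : \forall h \near 0^', tdisp (agent_path a x0 u t) (agent_path a x0 u (t + h)) =
    vint a (t + h) u - vint a t u.
  have e0 : 0 < (4 * (M + 1))^-1 by rewrite invr_gt0 mulr_gt0// ltr_wpDl.
  near=> h; apply: tdisp_tshift => i; rewrite -coordB.
  have h1 : `|h| < (4 * (M + 1))^-1 by near: h; exact: dnbhs0_lt.
  have h2 : `|(vint a (t + h) u - vint a t u) 0 i| <= 4^-1.
    rewrite (le_trans (le_coord_enorm _ _))// (le_trans (lip _))// addrAC subrr add0r.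
    rewrite (le_trans (ler_wpM2l M0 (ltW h1)))// invfM mulrCA ler_piMr ?invr_ge0//.
    by rewrite ler_pdivrMr ?ltr_wpDl// mul1r lerDl.
  by move: h2; rewrite ler_norml => /andP[]; lra.
have cv : (fun h : R => h^-1 *: (vint a (t + h) u - vint a t u)) @ 0^' --> u t.
  apply: coord_cvg => i.
  have tt : t < t + 1 by rewrite ltrDl.
  have ii : leb.-integrable [set` Interval (BLeft a) (BRight (t + 1))] (EFin \o (fun s => u s 0 i)).
    exact: vbounded_integrable hu.
  have ab : (BLeft a < BRight t)%E by rewrite lte_fin.
  have [dF eF] := @FTC1_lebesgue_pt R (fun s => u s 0 i) (BLeft a) t (t + 1) tt ii ab (ht i).
  set I := (fun y : R => _) in dF eF; have VE y : vint a y u 0 i = I y by rewrite mxE.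
  have c : (fun h : R => h^-1 *: ((I \o shift t) (h *: (1 : R^o)) - I t)) @ 0^' --> u t 0 i.
    by rewrite -eF derive1E; exact: dF.
  apply: cvg_trans c; apply: near_eq_cvg; apply: nearW => h /=.
  have -> : h%:A + t = t + h by rewrite [h%:A]mulr1 addrC.
  by rewrite -!VE -coordB; rewrite [RHS]mxE.
apply: cvg_trans cv; apply: near_eq_cvg.
by apply: filterS small => h /= ->.
Unshelve. all: by end_near. Qed.

End velocity_of_path.

Section glue.
Context {R : realType} {d : nat}.
Local Notation leb := (@lebesgue_measure R).
Local Notation Rd := 'rV[R]_d.
Local Notation T := (torus R d).
Local Notation P := (prob_torus R d).

Lemma aeS (A B : R -> Prop) : {ae leb, forall t, A t} -> (forall t, A t -> B t) ->
  {ae leb, forall t, B t}.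
Proof. by move=> hA AB; apply: (@filterS _ _ (ae_filter_ringOfSetsType leb) A). Qed.

Lemma aeI (A B : R -> Prop) : {ae leb, forall t, A t} -> {ae leb, forall t, B t} ->
  {ae leb, forall t, A t /\ B t}.
Proof. exact: (@filterI _ _ (ae_filter_ringOfSetsType leb)). Qed.

Lemma ae_neq (c : R) : {ae leb, forall t, t != c}.
Proof.
exists [set c]; split => //; first exact: lebesgue_measure_set1.
by move=> t /= /negP; rewrite negbK => /eqP.
Qed.

Lemma weak_integrable (c b M : R) (mu : R -> P) (v : R -> T -> Rd) (phi : R -> T -> R) :
  c <= b -> W2_continuous c b mu ->
  vmeasurable (`[c, b] `*` setT) (fun z : R * T => v z.1 z.2) ->
  (forall t y, t \in `[c, b] -> enorm (v t y) <= M) ->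
  C1 (periodization phi) ->
  leb.-integrable `[c, b] (EFin \o (fun t => \int[mu t]_y (dt phi t y + dotv (gradx phi t y) (v t y)))).
Proof.
move=> cb hmu mv vM hphi.
have kapE t : t \in `[c, b] -> clamped cb hmu t = mu t by move=> h; rewrite /clamped clamp_id.
have cc : c \in `[c, b] by rewrite in_itv/= lexx.
have M0 : 0 <= M by rewrite (le_trans (enorm_ge0 _) (vM c (tproj 0) cc)).
pose D : set (R * T) := `[c, b] `*` setT.
have mD : measurable D by exact: measurableX.
pose V (z : R * T) : Rd := if z.1 \in `[c, b] then v z.1 z.2 else 0.
have mV : vmeasurable setT V.
  move=> i; have := (measurable_restrictT (fun z : R * T => v z.1 z.2 0 i) mD).1 (mv i).
  apply: eq_measurable_fun => z _; rewrite patchE /V.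
  have -> : (z \in D) = (z.1 \in `[c, b]).
    by apply/idP/idP => [/set_mem[]//|h]; apply/mem_set.
  by case: ifP => // _; rewrite mxE.
have VM z : enorm (V z) <= M by rewrite /V; case: ifP => [h|_]; [exact: vM|rewrite enorm0].
have [K K0 hK] := test_bounded hphi c b.
pose psi (z : R * T) := dt phi z.1 z.2 + dotv (gradx phi z.1 z.2) (V z).
have mpsi : measurable_fun setT psi.
  apply: measurable_funD; first exact: measurable_dt.
  by apply: measurable_dotv => //; exact: measurable_gradx.
have iH : leb.-integrable `[c, b] (EFin \o (fun t => \int[clamped cb hmu t]_y psi (t, y))).
  apply: (@itv_integrable _ _ _ _ (K + K * M)); first exact: measurable_clamped_integral.
  move=> t tcb; apply: prob_Rintegral_le; first exact: measurable_sect1.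
  move=> y; have [_ h1 h2] := hK t y tcb.
  rewrite (le_trans (ler_normD _ _))// lerD// (le_trans (normr_dotv_le _ _))//.
  by rewrite ler_pM// enorm_ge0.
apply: eq_integrable iH => // t /set_mem tcb; rewrite /= kapE//; congr (_%:E).
by apply: eq_Rintegral => y _; rewrite /psi /V /= tcb.
Qed.

(** The part of an interval after the time c. Clipping the intervals in this way separates the
    contributions of the two pieces to the total variation of the concatenated curve. *)
Definition beyond (c : R) (J : R * R) : R * R := (Num.max c J.1, Num.max c J.2).

Lemma pairwise_beyond c (s : seq (R * R)) :
  pairwise (fun J K => (J.2 <= K.1) || (K.2 <= J.1)) s ->
  pairwise (fun J K => (J.2 <= K.1) || (K.2 <= J.1)) (map (beyond c) s).
Proof.
rewrite pairwise_map; apply: sub_pairwise => J K /= /orP[h|h]; apply/orP; [left|right].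
  by rewrite ge_max !le_max lexx h orbT.
by rewrite ge_max !le_max lexx h orbT.
Qed.

Lemma max_sub_le (c x y : R) : x <= y -> Num.max c y - Num.max c x <= y - x.
Proof. by move=> xy; have [?|?] := ltP c y; have [?|?] := ltP c x; lra. Qed.

Section glued.
Variables (a c b M : R) (x0 : T) (u : R -> Rd) (mu0 : P) (U : R -> T -> Rd) (p : R -> T -> Rd).
Variables (F : R -> T -> P -> set Rd) (G : R -> T -> T -> P -> set Rd).
Hypotheses (ac : a < c) (cb : c <= b) (hu : vbounded M u) (hU : velocity M U).
Hypotheses (mp : vmeasurable setT (fun z : R * T => p z.1 z.2)) (pM : forall t y, enorm (p t y) <= M).
Hypothesis Fu : forall t, t \in `[a, b] -> F t (agent_path a x0 u t) (law a mu0 U t) (u t).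
Hypothesis Gp : forall t y, t \in `[a, b] -> G t (agent_path a x0 u t) y (law a mu0 U t) (p t y).
Hypothesis hp : forall (g : R * T -> Rd) B, vmeasurable setT g -> (forall z, enorm (g z) <= B) ->
  \int[leb]_(t in `[a, b]) \int[law a mu0 U t]_y dotv (g (t, y)) (p t y) =
  \int[leb]_(t in `[a, b]) \int[mu0]_y dotv (g (t, flow a U t y)) (U t y).
Hypothesis leG : forall t x y th q, t \in `[a, b] -> G t x y th q -> enorm q <= M.
Variables (xi : R -> T) (mu : R -> P).
Hypothesis tr2 : trajectories b F G c (agent_path a x0 u c) (law a mu0 U c) (xi, mu).

Definition glue_xi t := if t < c then agent_path a x0 u t else xi t.
Definition glue_mu t := if t < c then law a mu0 U t else mu t.

Let M0 : 0 <= M := velocity_ge0 hU.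

Lemma xi_c : xi c = agent_path a x0 u c.
Proof. by have [_ _ []] := tr2. Qed.

Lemma mu_c : same_meas (mu c) (law a mu0 U c).
Proof. by have [_ _ []] := tr2. Qed.

Lemma glue_xi_le t : t <= c -> glue_xi t = agent_path a x0 u t.
Proof. by rewrite /glue_xi le_eqVlt => /predU1P[->|->//]; rewrite ltxx xi_c. Qed.

Lemma glue_mu_le t : t <= c -> same_meas (glue_mu t) (law a mu0 U t).
Proof.
by rewrite /glue_mu le_eqVlt => /predU1P[->|->//]; rewrite ltxx; exact: mu_c.
Qed.

Lemma glue_xi_ge t : c <= t -> glue_xi t = xi t.
Proof. by rewrite /glue_xi ltNge => ->. Qed.

Lemma glue_mu_ge t : c <= t -> glue_mu t = mu t.
Proof. by rewrite /glue_mu ltNge => ->. Qed.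

Lemma W2_glue_le s t : s <= c -> t <= c -> W2 (glue_mu s) (glue_mu t) <= M * `|t - s|.
Proof.
move=> sc tc; rewrite (W2_same_meas (glue_mu_le sc) (glue_mu_le tc)).
exact: (W2_law a mu0 hU s t).
Qed.

Lemma W2_continuous_glue : W2_continuous a b glue_mu.
Proof.
have [_ c2 _ _ _] := tr2.
move=> t; rewrite in_itv/= => /andP[at_ tb].
apply/(@cvgrPdist_lt _ R^o) => e e0; rewrite near_withinE.
have M1 : 0 < M + 1 by rewrite ltr_wpDl.
have H1 : \forall s \near t, s <= c -> t <= c -> W2 (glue_mu t) (glue_mu s) < e.
  near=> s => sc tc; rewrite (le_lt_trans (W2_glue_le tc sc))//.
  rewrite (@le_lt_trans _ _ ((M + 1) * `|s - t|))//; first by rewrite ler_wpM2r// lerDl.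
  rewrite mulrC -ltr_pdivlMr// (@le_lt_trans _ _ (e / (M + 1) / 2))//.
    by near: s; apply: near_id_le; rewrite !divr_gt0.
  by rewrite ltr_pdivrMr// ltr_pMr ?ltr1n// divr_gt0.
have H2 : \forall s \near t, s \in `[c, b] -> c <= t -> W2 (glue_mu t) (glue_mu s) < e.
  have [ct|tc] := leP c t; last first.
    by near=> s; move=> _.
  have tcb : t \in `[c, b] by rewrite in_itv/= ct.
  have /(@cvgrPdist_lt _ R^o)/(_ e e0) := c2 t tcb.
  rewrite near_withinE; apply: filterS => s hs scb _.
  have := hs scb; rewrite sub0r normrN ger0_norm ?W2_ge0// !glue_mu_ge//.
  by move: scb; rewrite in_itv/= => /andP[].
have H3 : t < c -> \forall s \near t, s < c by exact: lt_nbhsl.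
have H4 : c < t -> \forall s \near t, c < s by exact: lt_nbhsr.
have [tc|ct|tc] := ltgtP t c.
- near=> s => sab; rewrite sub0r normrN ger0_norm ?W2_ge0//.
  have sc : s <= c by apply: ltW; near: s; exact: H3.
  by move: sc (ltW tc); near: s; exact: H1.
- near=> s => sab; rewrite sub0r normrN ger0_norm ?W2_ge0//.
  have sc : c <= s by apply: ltW; near: s; exact: H4.
  have scb : s \in `[c, b] by move: sab; rewrite /= !in_itv/= sc => /andP[].
  by move: scb (ltW ct); near: s; exact: H2.
- near=> s => sab; rewrite sub0r normrN ger0_norm ?W2_ge0//.
  have [sc|cs] := leP s c.
    have tc' : t <= c by rewrite tc.
    by move: sc tc'; near: s; exact: H1.
  have scb : s \in `[c, b] by move: sab; rewrite /= !in_itv/= (ltW cs) => /andP[].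
  have tc' : c <= t by rewrite tc.
  by move: scb tc'; near: s; exact: H2.
Unshelve. all: by end_near. Qed.

Lemma continuous_path : continuous (agent_path a x0 u).
Proof.
move=> t O; rewrite nbhsE => -[B [oB Bt] BO]; have [r r0 hr] := tdist_ball oB Bt.
have M1 : 0 < M + 1 by rewrite ltr_wpDl.
apply/nbhs_ballP; exists (r / (M + 1)) => /=; first by rewrite divr_gt0.
move=> s; rewrite /ball/= distrC => hs; apply: BO; apply: hr.
rewrite (le_lt_trans (tdist_path _ _ hu _ _))// (@le_lt_trans _ _ ((M + 1) * `|s - t|))//.
  by rewrite ler_wpM2r// lerDl.
by rewrite mulrC -ltr_pdivlMr.
Qed.

Lemma continuous_glue : {within `[a, b], continuous glue_xi}.
Proof.
have [c2 _ _ _ _] := tr2.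
have -> : `[a, b]%classic = `[a, c]%classic `|` `[c, b]%classic.
  apply/seteqP; split => t /=; rewrite !in_itv/=.
    by move=> /andP[-> ->]; have [tc|ct] := leP t c; [left|right; rewrite ltW].
  move=> [/andP[-> tc]|/andP[ct ->]]; first by rewrite (le_trans tc).
  by rewrite (le_trans (ltW ac)).
apply: withinU_continuous; [exact: itv_closed|exact: itv_closed| |].
  apply: (@subspace_eq_continuous _ _ _ (agent_path a x0 u)); last first.
    by apply: continuous_subspaceT; exact: continuous_path.
  by move=> t /set_mem; rewrite /= in_itv/= => /andP[_ tc]; exact/esym/glue_xi_le.
apply: (@subspace_eq_continuous _ _ _ xi) => //.
by move=> t /set_mem; rewrite /= in_itv/= => /andP[ct _]; exact/esym/glue_xi_ge.
Qed.

Lemma tdist_glue s t : s <= t -> tdist (glue_xi s) (glue_xi t) <=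
  M * (t - s) + tdist (xi (Num.max c s)) (xi (Num.max c t)).
Proof.
move=> st; have [tc|ct] := leP t c.
  rewrite !glue_xi_le ?(le_trans st)// (le_trans (tdist_path _ _ hu _ _))//.
  by rewrite ger0_norm ?subr_ge0// lerDl tdist_ge0.
have [sc|cs] := leP s c; last first.
  by rewrite (glue_xi_ge (ltW cs)) (glue_xi_ge (ltW ct)) lerDr mulr_ge0// subr_ge0.
rewrite (le_trans (tdist_triangle (xi c) _ _))//.
rewrite (glue_xi_ge (ltW ct)) lerD// glue_xi_le// xi_c (le_trans (tdist_path _ _ hu _ _))//.
by rewrite ger0_norm ?subr_ge0// ler_wpM2l// lerD2r ltW.
Qed.

Lemma abs_continuous_glue : abs_continuous a b glue_xi.
Proof.
have [_ _ _ [ac2 _] _] := tr2.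
move=> e e0; have e2 : 0 < e / 2 by rewrite divr_gt0.
have M1 : 0 < M + 1 by rewrite ltr_wpDl.
have [dl dl0 hdl] := ac2 _ e2.
exists (Num.min dl (e / 2 / (M + 1))) => [|s sab ps]; first by rewrite lt_min dl0 divr_gt0.
rewrite lt_min => /andP[l1 l2].
(* the second piece only sees the clipped intervals, the first is Lipschitz *)
have h2 := hdl (map (beyond c) s).
have sle J : J \in s -> J.1 <= J.2 by move=> /(allP sab)/andP[/andP[]].
have {}h2 : \sum_(J <- s) tdist (xi (Num.max c J.1)) (xi (Num.max c J.2)) < e / 2.
  have := h2 _ (pairwise_beyond c ps); rewrite !big_map; apply.
    rewrite all_map; apply: sub_all sab => J /= /andP[/andP[J1 J2] J3].
    rewrite le_max lexx /= [X in _ && X]ge_max cb J3 andbT.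
    by rewrite ge_max !le_max lexx J2 orbT.
  apply: le_lt_trans l1; rewrite big_seq [leRHS]big_seq; apply: ler_sum => J /sle.
  exact: max_sub_le.
apply: (@le_lt_trans _ _ (M * (\sum_(J <- s) (J.2 - J.1)) +
   \sum_(J <- s) tdist (xi (Num.max c J.1)) (xi (Num.max c J.2)))).
  rewrite mulr_sumr -big_split /= big_seq [leRHS]big_seq; apply: ler_sum => J /sle.
  exact: tdist_glue.
rewrite [ltRHS](splitr e) ler_ltD// (@le_trans _ _ ((M + 1) * \sum_(J <- s) (J.2 - J.1)))//.
  rewrite ler_wpM2r ?lerDl//; rewrite big_seq; apply: sumr_ge0 => J /sle; by rewrite subr_ge0.
by rewrite mulrC -ler_pdivlMr// ltW.
Qed.

Lemma has_velocity_near (x1 x2 : R -> T) t w : (\forall s \near t, x1 s = x2 s) ->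
  has_velocity x1 t w -> has_velocity x2 t w.
Proof.
move=> h; rewrite /has_velocity => hv; apply: cvg_trans hv; apply: near_eq_cvg.
have [dl dl0 hd] := near_delta h.
near=> s; rewrite -(hd t) ?subrr ?normr0// -(hd (t + s))// addrAC subrr add0r.
near: s; exact: dnbhs0_lt.
Unshelve. all: by end_near. Qed.

Lemma velocity_glue : {ae leb, forall t, t \in `[a, b] ->
  exists2 w, has_velocity glue_xi t w & F t (glue_xi t) (glue_mu t) w}.
Proof.
have [_ _ _ [_ h2] _] := tr2.
have h1 := path_velocity a x0 hu.
apply: (aeS (aeI (aeI (ae_neq a) (ae_neq c)) (aeI h1 h2))) => t [[ta tc] [v1 v2]] tab.
have [at_ tb] : a <= t /\ t <= b by move: tab; rewrite in_itv/= => /andP.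
have [tc'|ct|tc'] := ltgtP t c; last by rewrite tc' eqxx in tc.
  exists (u t); last by rewrite /glue_xi /glue_mu tc'; exact: Fu.
  apply: has_velocity_near (v1 _); last by rewrite lt_neqAle eq_sym ta.
  by apply: filterS (lt_nbhsl tc') => s sc; rewrite /glue_xi sc.
have [|w hw Fw] := v2; first by rewrite in_itv/= (ltW ct).
exists w; last by rewrite (glue_xi_ge (ltW ct)) (glue_mu_ge (ltW ct)).
apply: has_velocity_near hw.
by apply: filterS (lt_nbhsr ct) => s sc; rewrite (glue_xi_ge (ltW sc)).
Qed.

(** The boundary terms at the junction c of the two pieces cancel, and those at the ends
    vanish with the test function. *)
Lemma glue_trajectory : trajectories b F G a x0 mu0 (glue_xi, glue_mu).
Proof.
have [_ c2 _ [_ h2] [v2 [mv2 Gv2 ce2]]] := tr2.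
have ab : a < b by exact: lt_le_trans cb.
split => /=.
- exact: continuous_glue.
- exact: W2_continuous_glue.
- split; first by rewrite glue_xi_le ?(ltW ac)// /agent_path vint_self tshift0.
  move=> A mA; rewrite (glue_mu_le (ltW ac) mA) (lawE _ _ hU) pushE; congr (_ _).
  by apply/seteqP; split => y /=; rewrite /flow /disp vint_self tshift0.
- by split; [exact: abs_continuous_glue|exact: velocity_glue].
pose v t y := if t < c then p t y else v2 t y.
have Gv t y : t \in `[a, b] -> G t (glue_xi t) y (glue_mu t) (v t y).
  move=> tab; rewrite /glue_xi /glue_mu /v; case: ifPn => [_|]; first exact: Gp.
  rewrite -leNgt => ct; apply: Gv2; move: tab; rewrite !in_itv/= ct => /andP[]//.
have mab : measurable (`[a, b] `*` setT : set (R * T)) by exact: measurableX.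
have mv : vmeasurable (`[a, b] `*` setT) (fun z : R * T => v z.1 z.2).
  move=> i.
  rewrite (_ : (fun z => _) = (fun z : R * T => if z.1 < c then p z.1 z.2 0 i else v2 z.1 z.2 0 i)); last first.
    by apply/funext => z; rewrite /v; case: ifP.
  apply: measurable_fun_if => //.
  - by apply: measurable_funTS; apply: measurable_fun_ltr => //; exact: measurable_fst.
  - by apply: measurable_funTS; exact: mp.
  apply: measurable_funS (mv2 i); first exact: measurableX.
  move=> [t y] [[/= tab _] /= /negbT]; rewrite -leNgt => ct; split => //=.
  by move: tab; rewrite !in_itv/= ct => /andP[].
exists v; split => // phi tphi.
have [cphi [a' [b' [aa bb phi0]]]] := tphi.
have hphi := Ck_C1 cphi.
have vM t y : t \in `[a, b] -> enorm (v t y) <= M by move=> tab; exact: leG (Gv t y tab).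
have iK := weak_integrable (ltW ab) W2_continuous_glue mv vM hphi.
rewrite (@Rintegral_itv_split _ a c b)//; last exact: ltW.
pose K t := \int[law a mu0 U t]_y (dt phi t y + dotv (gradx phi t y) (p t y)).
have -> : \int[leb]_(t in `[a, c]) \int[glue_mu t]_y (dt phi t y + dotv (gradx phi t y) (v t y)) =
    \int[leb]_(t in `[a, c]) K t.
  have i1 : leb.-integrable `[a, c[ (EFin \o (fun t => \int[glue_mu t]_y (dt phi t y + dotv (gradx phi t y) (v t y)))).
    apply: integrableS iK => //; apply: subset_trans (@subset_itv_co_cc _ _ a c) _.
    exact: subset_itvScc.
  rewrite -Rintegral_itv_bndo_bndc//.
  have e t : t \in `[a, c[%classic -> \int[glue_mu t]_y (dt phi t y + dotv (gradx phi t y) (v t y)) = K t.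
    move=> /set_mem; rewrite /= in_itv/= => /andP[_ tc].
    by rewrite /glue_mu tc; apply: eq_Rintegral => y _; rewrite /v tc.
  rewrite -[RHS]Rintegral_itv_bndo_bndc; first exact: eq_Rintegral.
  by apply: eq_integrable i1 => // t tac; rewrite /= e.
rewrite (law_boundary hphi hU (ltW ac) cb mp pM hp).
have -> : \int[mu0]_y phi a y = 0.
  under eq_Rintegral do rewrite phi0 ?in_itv/= ?negb_and -?ltNge ?aa//.
  by rewrite Rintegral_cst// mul0r.
have -> : \int[leb]_(t in `[c, b]) \int[glue_mu t]_y (dt phi t y + dotv (gradx phi t y) (v t y)) =
    \int[leb]_(t in `[c, b]) \int[mu t]_y (dt phi t y + dotv (gradx phi t y) (v2 t y)).
  apply: eq_Rintegral => t /set_mem; rewrite /= in_itv/= => /andP[ct _].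
  by rewrite glue_mu_ge//; apply: eq_Rintegral => y _; rewrite /v ltNge ct.
have -> : \int[leb]_(t in `[c, b]) \int[mu t]_y (dt phi t y + dotv (gradx phi t y) (v2 t y)) =
    - \int[mu c]_y phi c y.
  move: cb; rewrite le_eqVlt => /predU1P[cb'|cb'].
    rewrite cb' set_itv1 Rintegral_set1.
    under eq_Rintegral do rewrite phi0 ?in_itv/= ?negb_and -?ltNge ?bb ?orbT//.
    by rewrite Rintegral_cst// mul0r oppr0.
  apply: (weak_boundary (b' := b') (M := M)) => //.
  - move=> t y tcb; apply: leG (Gv2 t y tcb).
    by move: tcb; rewrite !in_itv/= => /andP[ct ->]; rewrite (le_trans (ltW ac)).
  - by move=> t y bt; rewrite phi0// in_itv/= negb_and -!ltNge bt orbT.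
by rewrite subr0 (same_meas_Rintegral _ _ mu_c) subrr.
Qed.

End glued.
End glue.

(** * Dynamic programming *)

Section dynamic_programming.
Context {R : realType} {d : nat}.
Local Notation leb := (@lebesgue_measure R).
Local Notation Rd := 'rV[R]_d.
Local Notation T := (torus R d).
Local Notation P := (prob_torus R d).
Variables (Tf : R) (k : R -> R).
Variables (F : R -> T -> P -> set Rd) (G : R -> T -> T -> P -> set Rd).
Variables (L Gf : T -> P -> R).
Hypothesis k_ge0 : forall t, t \in `[0, Tf] -> 0 <= k t.
Hypothesis k_L1 : leb.-integrable `[0, Tf] (EFin \o k).
Hypothesis hF : F_assumptions Tf F k.
Hypothesis hG : G_assumptions Tf G k.
Hypothesis hL : cost_assumptions L.
Hypothesis hGf : cost_assumptions Gf.
Variable (M : R).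
Hypothesis M0 : 0 <= M.
Hypothesis leF : forall t x th p, t \in `[0, Tf] -> F t x th p -> enorm p <= M.
Hypothesis leG : forall t x y th p, t \in `[0, Tf] -> G t x y th p -> enorm p <= M.

Lemma vmeasurable_nproj_G t x th (w : T -> Rd) : t \in `[0, Tf] -> vmeasurable setT w ->
  vmeasurable setT (fun y => nproj (G t x y th) (w y)).
Proof.
move=> tT mw; have [bG nG _] := hG.
apply: vmeasurable_nproj; [exact: measurableT|move=> O oO|by move=> y _; exact: nG|exact: mw].
have m1 : measurable_fun setT (fun y : T => (t, x, y, th : prob_borel R d)).
  by repeat apply: measurable_fun_pair => //.
have := m1 measurableT _ (bG O oO); rewrite !setTI.
congr measurable; apply/seteqP; split => y /=.
- by move=> [_ h].
- by move=> h; split.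
Qed.

(** [lagrangian_ex] and [eulerian_ex] combined: the field p stands for U in the continuity
    equation, and the second-order estimates are kept in terms of u and U. *)
Lemma control_ex a x0 mu0 v w : 0 <= a < Tf -> F a x0 mu0 v -> vmeasurable setT w ->
  (forall y, G a x0 y mu0 (w y)) -> exists u U p,
  [/\ [/\ vbounded M u, velocity M U, vmeasurable setT (fun z : R * T => p z.1 z.2) &
         forall t y, enorm (p t y) <= M],
      forall t, t \in `[a, Tf] -> F t (agent_path a x0 u t) (law a mu0 U t) (u t),
      forall t y, t \in `[a, Tf] -> G t (agent_path a x0 u t) y (law a mu0 U t) (p t y),
      (forall (g : R * T -> Rd) B, vmeasurable setT g -> (forall z, enorm (g z) <= B) ->
        \int[leb]_(t in `[a, Tf]) \int[law a mu0 U t]_y dotv (g (t, y)) (p t y) =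
        \int[leb]_(t in `[a, Tf]) \int[mu0]_y dotv (g (t, flow a U t y)) (U t y)) &
      exists C : R, forall t, t \in `[a, Tf] ->
        enorm (vint a t u - (t - a) *: v) <= C * (t - a) ^+ 2 /\
        forall y, enorm (disp a U t y - (t - a) *: w y) <= C * (t - a) ^+ 2].
Proof.
move=> /andP[a0 aT] Fv mw Gw; have aT' : 0 <= a <= Tf by rewrite a0 ltW.
have [u [U [hu hU Fu GU hC]]] := lagrangian_ex k_ge0 k_L1 hF hG aT' M0 leF leG Fv mw Gw.
have sub t : t \in `[a, Tf] -> t \in `[0, Tf].
  by rewrite !in_itv/= => /andP[at_ ->]; rewrite (le_trans a0).
have [bG nG _] := hG.
have mC : setvalued_measurable (X := (R * T)%type) (`[a, Tf] `*` setT)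
    (fun z => G z.1 (agent_path a x0 u z.1) z.2 (law a mu0 U z.1)).
  move=> O oO.
  have mpsi : measurable_fun setT (fun z : R * T =>
      (z.1, agent_path a x0 u z.1, z.2, law a mu0 U z.1 : prob_borel R d)).
    apply: measurable_fun_pair; last exact: (measurableT_comp (measurable_law a mu0 hU) measurable_fst).
    apply: measurable_fun_pair; last exact: measurable_snd.
    by apply: measurable_fun_pair => //; exact: (measurableT_comp (measurable_path a x0 hu) measurable_fst).
  have h := mpsi measurableT _ (bG O oO); rewrite setTI in h.
  have mD : measurable (`[a, Tf] `*` setT : set (R * T)) by exact: measurableX.
  have := measurableI _ _ mD h; congr measurable; apply/seteqP; split => -[t y] /=.
  - by move=> [[tab _] [_ ?]].
  - by move=> [[tab _] ?]; split => //; split => //; split => //; split => //; split => //; exact: sub.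
have [p [mp pM pG hp]] := @eulerian_ex _ _ a Tf M mu0 U
  (fun t y => G t (agent_path a x0 u t) y (law a mu0 U t)) aT hU mC
  (fun t y tab => nG _ _ _ _ (sub _ tab)) (fun t y q tab => leG (sub _ tab)) GU.
by exists u, U, p.
Qed.

(** On a degenerate interval the constant curves are trajectories: all differential
    conditions concern a negligible set of times. *)
Lemma trajectories_last x0 mu0 : 0 <= Tf -> trajectories Tf F G Tf x0 mu0 !=set0.
Proof.
move=> T0; have TT : Tf \in `[0, Tf] by rewrite in_itv/= T0 lexx.
have [_ nG _] := hG.
have eqT t : t \in `[Tf, Tf] -> t = Tf.
  by rewrite in_itv/= -eq_le => /eqP.
exists (fun=> x0, fun=> mu0); split => /=.
- by apply: continuous_subspaceT; exact: cst_continuous.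
- move=> t _; rewrite (_ : (fun s => _) = (fun=> 0)); first exact: cvg_cst.
  by apply/funext => s; rewrite W2_same0.
- by split.
- split.
    move=> e e0; exists 1 => // s _ _ _; rewrite big1// => J _; exact: tdistxx.
  by apply: (aeS (ae_neq Tf)) => t tT /eqT h; rewrite h eqxx in tT.
exists (fun t y => nproj (G Tf x0 y mu0) 0); split.
- move=> i; apply: measurable_funTS.
  have h := @vmeasurable_nproj_G Tf x0 mu0 (fun=> 0) TT.
  apply: (measurableT_comp (h _ i) measurable_snd) => j; exact: measurable_cst.
- by move=> t y /eqT ->; apply: nproj_in; exact: nG.
- by move=> phi _; rewrite set_itv1 Rintegral_set1.
Qed.

Lemma selection_ex a x0 mu0 : a \in `[0, Tf] -> exists w, vmeasurable setT w /\
  forall y, G a x0 y mu0 (w y).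
Proof.
move=> aT; have [_ nG _] := hG.
exists (fun y => nproj (G a x0 y mu0) 0); split.
  by apply: vmeasurable_nproj_G => // i; exact: measurable_cst.
by move=> y; apply: nproj_in; exact: nG.
Qed.

(** A solution of the inclusions on the whole interval, glued at the final time to a
    trajectory on a degenerate interval. Nonemptiness makes the infimum in the value
    function a genuine one. *)
Lemma trajectories_nonempty a x0 mu0 : 0 <= a <= Tf -> trajectories Tf F G a x0 mu0 !=set0.
Proof.
move=> /andP[a0]; rewrite le_eqVlt => /predU1P[aT|aT].
  by rewrite aT; apply: trajectories_last; rewrite -aT.
have aab : a \in `[0, Tf] by rewrite in_itv/= a0 ltW.
have [_ nF _] := hF; have [[v Fv] _ _] := nF a x0 mu0 aab.
have [w [mw Gw]] := @selection_ex a x0 mu0 aab.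
have a0T : 0 <= a < Tf by rewrite a0.
have [u [U [p [[hu hU mp pM] Fu Gp hp _]]]] := control_ex a0T Fv mw Gw.
have [[xi mu] tr2] := @trajectories_last (agent_path a x0 u Tf) (law a mu0 U Tf) (le_trans a0 (ltW aT)).
have leG' t x y th q : t \in `[a, Tf] -> G t x y th q -> enorm q <= M.
  by rewrite in_itv/= => /andP[at_ tT]; apply: leG; rewrite in_itv/= tT (le_trans a0).
eexists; exact: (glue_trajectory aT (lexx Tf) hu hU mp pM Fu Gp hp leG' tr2).
Qed.

Lemma trajectories_same_meas (a : R) (x0 : T) (mu0 mu0' : P) : same_meas mu0 mu0' ->
  trajectories Tf F G a x0 mu0 = trajectories Tf F G a x0 mu0'.
Proof.
move=> h; apply/seteqP; split => -[xi mu] [/= h1 h2 [h3 h4] h5 h6]; split => //=; split => //.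
- by move=> A mA; rewrite h4// h.
- by move=> A mA; rewrite h4// h.
Qed.

Lemma value_same_meas (a : R) (x0 : T) (mu0 mu0' : P) : same_meas mu0 mu0' ->
  value_function Tf F G L Gf a x0 mu0 = value_function Tf F G L Gf a x0 mu0'.
Proof. by move=> h; rewrite /value_function (trajectories_same_meas _ _ h). Qed.

Lemma cost_lip (c : T -> P -> R) : cost_assumptions c -> exists2 K : R, 0 <= K &
  forall x1 x2 th1 th2, `|c x1 th1 - c x2 th2| <= K * (tdist x1 x2 + W2 th1 th2).
Proof.
move=> [_ _ [K hK]]; exists `|K| => // x1 x2 th1 th2.
rewrite (le_trans (hK _ _ _ _))// ler_wpM2r ?ler_norm// addr_ge0 ?tdist_ge0 ?W2_ge0//.
Qed.

Lemma cost_same_meas (c : T -> P -> R) (x : T) (th th' : P) : cost_assumptions c -> same_meas th th' ->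
  c x th = c x th'.
Proof.
move=> hc h; have [K K0 hK] := cost_lip hc.
have := hK x x th th'; rewrite tdistxx (W2_same0 h) addr0 mulr0 normr_le0 subr_eq0.
by move/eqP.
Qed.

Lemma cost_integrable c x0 mu0 (z : (R -> T) * (R -> P)) :
  trajectories Tf F G c x0 mu0 z ->
  leb.-integrable `[c, Tf] (EFin \o (fun t => L (z.1 t) (z.2 t))).
Proof.
move=> [_ hmu _ [acx _] _]; have [L0 [ML hML] _] := hL.
have [K K0 hK] := cost_lip hL.
have cont : {within `[c, Tf], continuous (fun t => L (z.1 t) (z.2 t))}.
  apply/subspace_continuousP => t tab; apply/(@cvgrPdist_le _ R^o) => e e0.
  have e1 : 0 < e / 2 / (K + 1) by rewrite !divr_gt0// ltr_wpDl.
  have [dl dl0 hd] := acx _ e1.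
  have /(@cvgrPdist_lt _ R^o)/(_ _ e1) := hmu t tab.
  rewrite !near_withinE => hW; near=> s => sab.
  rewrite (le_trans (hK _ _ _ _))//.
  have st : `|s - t| < dl.
    by apply: (@le_lt_trans _ _ (dl / 2)); [near: s; apply: near_id_le; rewrite divr_gt0|rewrite ltr_pdivrMr// ltr_pMr// ltr1n].
  have h1 : tdist (z.1 t) (z.1 s) < e / 2 / (K + 1).
    move: tab sab; rewrite /= !in_itv/= => /andP[t1 t2] /andP[s1 s2].
    have [ts|st'] := leP t s.
      have := hd [:: (t, s)]; rewrite /= t1 ts s2 !big_seq1/=; apply => //.
      by move: st; rewrite ger0_norm// subr_ge0.
    have := hd [:: (s, t)]; rewrite /= s1 (ltW st') t2 !big_seq1/= tdistC; apply => //.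
    by move: st; rewrite distrC ger0_norm// subr_ge0 ltW.
  have h2 : W2 (z.2 t) (z.2 s) < e / 2 / (K + 1).
    have : `|0 - W2 (z.2 t) (z.2 s)| < e / 2 / (K + 1) by move: sab; near: s.
    by rewrite sub0r normrN ger0_norm ?W2_ge0.
  rewrite (@le_trans _ _ (K * (e / (K + 1))))//.
    rewrite ler_wpM2l// (le_trans (lerD (ltW h1) (ltW h2)))//.
    by rewrite -mulrDl -splitr.
  by rewrite mulrCA ler_piMr ?(ltW e0)// ler_pdivrMr ?ltr_wpDl// mul1r lerDl.
apply: (@integrable_bounded _ _ _ leb _ _ ML) => //; first exact: leb_itv_lty.
  exact: (subspace_continuous_measurable_fun (measurable_itv _) cont).
by move=> t _; rewrite ger0_norm.
Unshelve. all: by end_near. Qed.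

Lemma total_cost_ge0 c (z : (R -> T) * (R -> P)) : 0 <= total_cost Tf L Gf c z.1 z.2.
Proof.
have [L0 _ _] := hL; have [G0 _ _] := hGf.
by rewrite /total_cost addr_ge0//; apply: Rintegral_ge0.
Qed.

(** Following a control on [a, c] and then any trajectory from c is admissible from a; the
    infimum is taken over the second piece only. *)
Lemma dynamic_programming a c x0 mu0 u U p : 0 <= a -> a < c -> c <= Tf ->
  vbounded M u -> velocity M U -> vmeasurable setT (fun z : R * T => p z.1 z.2) ->
  (forall t y, enorm (p t y) <= M) ->
  (forall t, t \in `[a, Tf] -> F t (agent_path a x0 u t) (law a mu0 U t) (u t)) ->
  (forall t y, t \in `[a, Tf] -> G t (agent_path a x0 u t) y (law a mu0 U t) (p t y)) ->
  (forall (g : R * T -> Rd) B, vmeasurable setT g -> (forall z, enorm (g z) <= B) ->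
    \int[leb]_(t in `[a, Tf]) \int[law a mu0 U t]_y dotv (g (t, y)) (p t y) =
    \int[leb]_(t in `[a, Tf]) \int[mu0]_y dotv (g (t, flow a U t y)) (U t y)) ->
  value_function Tf F G L Gf a x0 mu0 <=
  \int[leb]_(t in `[a, c]) L (agent_path a x0 u t) (law a mu0 U t) +
  value_function Tf F G L Gf c (agent_path a x0 u c) (law a mu0 U c).
Proof.
move=> a0 ac cT hu hU mp pM Fu Gp hp; rewrite -lerBlDl.
have c0T : 0 <= c <= Tf by rewrite cT (le_trans a0 (ltW ac)).
apply: lb_le_inf.
  have [z hz] := trajectories_nonempty (agent_path a x0 u c) (law a mu0 U c) c0T.
  by exists (total_cost Tf L Gf c z.1 z.2), z.
move=> _ [[xi mu] tr2 <-]; rewrite lerBlDl.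
have leG' t x y th q : t \in `[a, Tf] -> G t x y th q -> enorm q <= M.
  by rewrite in_itv/= => /andP[at_ tT]; apply: leG; rewrite in_itv/= tT (le_trans a0).
have tr := glue_trajectory ac cT hu hU mp pM Fu Gp hp leG' tr2.
have iL := cost_integrable tr.
apply: (@le_trans _ _ (total_cost Tf L Gf a (glue_xi a c x0 u xi) (glue_mu a c mu0 U mu))).
  apply: ge_inf; last by exists (glue_xi a c x0 u xi, glue_mu a c mu0 U mu).
  by exists 0 => _ [z _ <-]; exact: total_cost_ge0.
rewrite le_eqVlt; apply/orP; left; apply/eqP.
rewrite /total_cost /= (@Rintegral_itv_split _ a c Tf)//; last exact: ltW.
rewrite -addrA; congr (_ + (_ + _)).
- apply: eq_Rintegral => t /set_mem; rewrite /= in_itv/= => /andP[_ tc].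
  by rewrite (glue_xi_le tr2 tc); apply: cost_same_meas => //; exact: (glue_mu_le tr2 tc).
- apply: eq_Rintegral => t /set_mem; rewrite /= in_itv/= => /andP[ct _].
  by rewrite glue_xi_ge// glue_mu_ge.
- by rewrite glue_xi_ge// glue_mu_ge.
Qed.

End dynamic_programming.

(** * The subsolution property *)

Section limits.
Context {R : realType}.

Lemma limf_esup_le {X : choiceType} {Y : filteredType X} (f : Y -> \bar R) (F : set_system Y) (c : \bar R) :
  (\forall z \near F, (f z <= c)%E) -> (limf_esup f F <= c)%E.
Proof.
move=> h; apply: (@le_trans _ _ (ereal_sup (f @` [set z | (f z <= c)%E]))).
  by apply: ereal_inf_lbound; exists [set z | (f z <= c)%E].
by apply: ge_ereal_sup => _ [z hz <-].
Qed.

Lemma near_limf_esup {X : choiceType} {Y : filteredType X} (f : Y -> \bar R) (F : set_system Y) (c e : \bar R) :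
  Filter F -> (limf_esup f F <= c)%E -> (c < e)%E -> \forall z \near F, (f z <= e)%E.
Proof.
move=> FF h ce; have /ereal_inf_lt[_ [V FV <-] hV] := le_lt_trans h ce.
apply: (filterS _ FV) => z Vz; apply: le_trans (ltW hV).
by apply: ereal_sup_ubound; exists z.
Qed.

Lemma near_right0 (Q : R -> Prop) : (\forall h \near (0 : R)^'+, Q h) ->
  exists2 dl : R, 0 < dl & forall h, 0 < h -> h < dl -> Q h.
Proof.
move=> /nbhs_ballP[dl /= dl0 hd]; exists dl => // h h0 hdl; apply: hd => //.
by rewrite /ball/= sub0r normrN gtr0_norm.
Qed.

Lemma near_right0_prod d (Q : R * 'rV[R]_d -> Prop) :
  (\forall q \near filter_prod (0 : R)^'+ (nbhs (0 : 'rV[R]_d)), Q q) ->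
  exists2 dl : R, 0 < dl & forall h y, 0 < h -> h < dl -> enorm y < dl -> Q (h, y).
Proof.
move=> [[Q1 Q2] /= [h1 h2] sub].
have [d1 d10 hd1] := near_right0 h1.
have /nbhs_ballP[d2 /= d20 hd2] := h2.
exists (Num.min d1 d2); first by rewrite lt_min d10 d20.
move=> h y h0; rewrite !lt_min => /andP[hh1 _] /andP[_ y2].
apply: sub; split => /=; first exact: hd1.
apply: hd2; rewrite -ball_normE /ball_/= sub0r normrN.
by rewrite (le_lt_trans (le_norm_enorm y)).
Qed.

(** If X < 0, then e with e K <= |X| / 4 and h with D h <= |X| / 4 violate the bound. *)
Lemma slope_ge0 (X D K : R) : 0 <= D -> 0 <= K ->
  (forall e, 0 < e -> exists2 dl : R, 0 < dl & forall h, 0 < h -> h < dl ->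
     - (X * h) - D * h ^+ 2 <= e * K * h) -> 0 <= X.
Proof.
move=> D0 K0 hX; rewrite leNgt; apply/negP => X0.
have e0 : 0 < - X / (4 * (K + 1)) by rewrite divr_gt0 ?oppr_gt0// mulr_gt0// ltr_wpDl.
have [dl dl0 hd] := hX _ e0.
have p1 : 0 < - X / (4 * (D + 1)) by rewrite divr_gt0 ?oppr_gt0// mulr_gt0// ltr_wpDl.
pose h := Num.min (dl / 2) (- X / (4 * (D + 1))).
have h0 : 0 < h by rewrite lt_min p1 divr_gt0.
have h1 : h < dl by rewrite (@le_lt_trans _ _ (dl / 2)) ?ge_min ?lexx// ltr_pdivrMr// ltr_pMr// ltr1n.
have h2 : h * (D + 1) <= - X / 4.
  have : h <= - X / (4 * (D + 1)) by rewrite ge_min lexx orbT.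
  by rewrite ler_pdivlMr ?mulr_gt0 ?ltr_wpDl// => ?; lra.
have := hd _ h0 h1.
have -> : - (X * h) - D * h ^+ 2 = (- X - D * h) * h by ring.
rewrite ler_pM2r// => h3.
have h4 : - X / (4 * (K + 1)) * K <= - X / 4.
  rewrite invfM mulrA -mulrA ler_piMr ?divr_ge0 ?oppr_ge0 ?(ltW X0)//.
  by rewrite mulrC ler_pdivrMr ?ltr_wpDl// mul1r lerDl.
by lra.
Qed.

End limits.

Section variation.
Context {R : realType} {d : nat}.
Local Notation leb := (@lebesgue_measure R).
Local Notation Rd := 'rV[R]_d.
Local Notation T := (torus R d).
Local Notation P := (prob_torus R d).
Variables (a M : R) (mu0 : P) (U : R -> T -> Rd).
Hypothesis hU : velocity M U.

Definition variation (h : R) : prob_torus2 R d :=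
  push2 mu0 (@measurable_id _ T setT) (measurable_flowt a hU (a + h)).

Lemma flow_start y : flow a U a y = y.
Proof. by rewrite /flow /disp vint_self tshift0. Qed.

Lemma continuous_flow y : continuous (fun t => flow a U t y).
Proof. by move=> t; exact: (continuous_path (velocity_vbounded y hU) hU). Qed.

Lemma tdist_flow_start h y : 0 <= h -> tdist y (flow a U (a + h) y) <= M * h.
Proof.
move=> h0; have := tdist_flow a hU a (a + h) y.
by rewrite flow_start (addrC a) addrK (ger0_norm h0).
Qed.

(** The flow is jointly measurable, so variation h B is the measure of a section of a Borel
    subset of R * T. *)
Lemma borel_family_variation : borel_family variation.
Proof.
move=> B mB; apply: measurable_funTS.
pose g (z : R * T) := (z.2, flow a U (a + z.1) z.2).
have mg : measurable_fun setT g.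
  apply: measurable_fun_pair; first exact: measurable_snd.
  have m1 : measurable_fun setT (fun z : R * T => (a + z.1, z.2)).
    apply: measurable_fun_pair; last exact: measurable_snd.
    by apply: measurable_funD; [exact: measurable_cst|exact: measurable_fst].
  exact: (measurableT_comp (measurable_flow a hU) m1).
have mA : measurable (g @^-1` B) by have := mg measurableT B mB; rewrite setTI.
have := measurable_fun_xsection mu0 mA; apply: eq_measurable_fun => h _ /=.
change (mu0 (xsection (g @^-1` B) h) = mu0 [set y | B (y, flow a U (a + h) y)]).
congr (mu0 _).
by apply/seteqP; split => y; rewrite /xsection /= inE.
Qed.

Lemma variation_rate h : 0 < h ->
  h^-1 * Num.sqrt (transport_cost (variation h)) <= M.
Proof.
move=> h0; have M0 := velocity_ge0 hU.
rewrite mulrC ler_pdivrMr//.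
rewrite -[leRHS]ger0_norm ?mulr_ge0 ?(ltW h0)// -sqrtr_sqr ler_sqrt ?sqr_ge0//.
rewrite /variation push2_cost (le_trans (ler_norm _))//.
apply: prob_Rintegral_le.
  by apply: measurable_funX; apply: measurable_tdist => //; exact: measurable_flowt hU _.
move=> y; rewrite ger0_norm ?sqr_ge0// lerXn2r ?nnegrE ?tdist_ge0 ?mulr_ge0 ?(ltW h0)//.
exact: tdist_flow_start (ltW h0).
Qed.

Lemma narrow_cvg_variation : narrow_cvg variation 0^'+ (diag_push mu0).
Proof.
move=> f cf bf; have mf := measurable_continuous_torus2 cf.
have [B hB] : exists B : R, forall z, `|f z| <= B.
  by have [B [_ hB]] := bf; exists (B + 1) => z; apply: hB => //; rewrite ltrDl.
apply/cvg_at_rightP => s [s0 s_cvg].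
rewrite /diag_push Rintegral_distribution//.
under eq_fun do rewrite /variation /push2 Rintegral_push//.
apply: (@Rdominated_cvg _ _ _ mu0 setT _ _ (fun=> B)) => //.
- move=> n; apply: (measurableT_comp mf).
  by apply: measurable_fun_pair => //; exact: measurable_flowt hU _.
- by apply: (measurableT_comp mf); exact: measurable_diagt.
- move=> y _.
  have cg : {for (0 : R), continuous (fun h => f (y, flow a U (a + h) y))}.
    have c1 : {for (0 : R), continuous (fun h => (y, flow a U (a + h) y))}.
      have c2 : {for (0 : R), continuous (fun h : R => a + h)}.
        by apply: cvgD; [exact: cvg_cst|exact: cvg_id].
      exact: (cvg_pair (@cvg_cst _ y _ (nbhs (0 : R)) _) (continuous_comp c2 (@continuous_flow y _))).
    exact: (continuous_comp c1 (cf _)).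
  have := cvg_comp _ _ s_cvg cg; rewrite /= addr0 flow_start; exact.
- by apply: (@prob_integrable _ _ _ _ _ B) => // x; rewrite ger0_norm// (le_trans _ (hB (x, x))).
Qed.

Lemma admissible_variation_flow : admissible_variation mu0 variation.
Proof.
split; [exact: borel_family_variation| |exact: narrow_cvg_variation|].
  by move=> h _ A mA.
exists (M + 1); first by rewrite ltr_wpDl// (velocity_ge0 hU).
apply: limf_esup_le; near=> h; rewrite lee_fin.
have h0 : 0 < h by near: h; exact: nbhs_right_gt.
by rewrite (le_trans (variation_rate h0))// lerDl.
Unshelve. all: by end_near. Qed.

Lemma pr2_variation h : same_meas (pr2_push (variation h)) (law a mu0 U (a + h)).
Proof. by move=> A mA; rewrite (lawE a mu0 hU). Qed.

(** For small h the displacement on the torus is the integral of the velocity, as it stays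
    within the range where shortest vectors are unique. *)
Lemma Rintegral_variation (p : T -> Rd) h : vmeasurable setT p -> 0 < h -> M * h < 2^-1 ->
  \int[variation h]_z dotv (p z.1) (tdisp z.1 z.2) =
  \int[mu0]_y dotv (p y) (disp a U (a + h) y).
Proof.
move=> mp h0 hM; rewrite /variation /push2 Rintegral_push; last first.
  apply: measurable_dotv; last by apply: vmeasurable_tdisp; [exact: measurable_fst|exact: measurable_snd].
  exact: vmeasurable_comp.
congr (Rintegral _ _ _); apply/funext => y /=; congr dotv.
rewrite -{1}(tshift0 y) /flow tdisp_tshift ?subr0// => i.
have -> : (0 : Rd) 0 i = 0 by rewrite mxE.
rewrite subr0; have : `|disp a U (a + h) y 0 i| < 2^-1.
  rewrite (le_lt_trans (le_coord_enorm _ _))// (le_lt_trans _ hM)//.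
  have := disp_lip a hU a (a + h) y.
  by rewrite {2}/disp vint_self subr0 (addrC a) addrK (gtr0_norm h0).
by rewrite ltr_norml => /andP[/ltW -> ->].
Qed.

End variation.

Section estimates.
Context {R : realType} {d : nat}.
Local Notation leb := (@lebesgue_measure R).
Local Notation Rd := 'rV[R]_d.
Local Notation T := (torus R d).
Local Notation P := (prob_torus R d).

Lemma running_cost_le (L : T -> P -> R) (a M h K : R) (x0 : T) (mu0 : P) (u : R -> Rd) (U : R -> T -> Rd) :
  cost_assumptions L -> vbounded M u -> velocity M U -> 0 <= h -> 0 <= K ->
  (forall x1 x2 th1 th2, `|L x1 th1 - L x2 th2| <= K * (tdist x1 x2 + W2 th1 th2)) ->
  \int[leb]_(t in `[a, a + h]) L (agent_path a x0 u t) (law a mu0 U t) <=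
  h * L x0 mu0 + 2 * K * M * h ^+ 2.
Proof.
move=> hL hu hU h0 K0 hK.
pose l t := L (agent_path a x0 u t) (law a mu0 U t).
have M0 := velocity_ge0 hU.
have lip s t : `|l s - l t| <= 2 * K * M * `|s - t|.
  rewrite (le_trans (hK _ _ _ _))//.
  have := lerD (tdist_path a x0 hu s t) (W2_law a mu0 hU s t).
  rewrite (distrC s t) => /(ler_wpM2l K0); lra.
have cl : continuous l.
  move=> t; apply/(@cvgrPdist_le _ R^o) => e e0.
  have e1 : 0 < e / (2 * K * M + 1) by rewrite divr_gt0// ltr_wpDl// !mulr_ge0.
  near=> s; rewrite (le_trans (lip _ _))//.
  have st : `|t - s| <= e / (2 * K * M + 1) by rewrite distrC; near: s; exact: near_id_le.
  rewrite (le_trans (ler_wpM2l _ st)) ?mulr_ge0//.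
  by rewrite mulrCA ler_piMr ?(ltW e0)// ler_pdivrMr ?ltr_wpDl ?mulr_ge0// mul1r lerDl.
have la : l a = L x0 mu0.
  rewrite /l /agent_path vint_self tshift0; apply: (cost_same_meas _ hL) => A mA.
  by rewrite (lawE a mu0 hU) pushE; congr (mu0 _); apply/seteqP; split => y; rewrite /= flow_start.
have ml := continuous_measurable_fun cl.
have lle t : t \in `[a, a + h] -> `|l t - l a| <= 2 * K * M * h.
  rewrite in_itv/= => /andP[at_ th]; rewrite (le_trans (lip _ _))// ler_wpM2l ?mulr_ge0//.
  by rewrite ger0_norm ?subr_ge0// lerBlDl.
have il : leb.-integrable `[a, a + h] (EFin \o l).
  apply: (@itv_integrable _ _ _ _ (`|l a| + 2 * K * M * h)) => // t th.
  by rewrite -{1}(subrK (l a) (l t)) addrC (le_trans (ler_normD _ _))// lerD2l lle.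
have ic : leb.-integrable `[a, a + h] (EFin \o (fun=> l a + 2 * K * M * h)).
  by apply: (@itv_integrable _ _ _ _ `|l a + 2 * K * M * h|).
rewrite (le_trans (le_Rintegral_itv il ic _))//.
  by move=> t /lle; rewrite ler_norml lerBlDl => /andP[].
rewrite Rintegral_cst// fine_leb_itv ?lerDl// la (addrC a) addrK.
by rewrite le_eqVlt; apply/orP; left; apply/eqP; ring.
Unshelve. all: by end_near. Qed.

Lemma pairing_le (mu0 : P) (p D w : T -> Rd) (h c B : R) :
  vmeasurable setT p -> mu0.-integrable setT (EFin \o (fun y => enorm (p y))) ->
  vmeasurable setT D -> vmeasurable setT w ->
  (forall y, enorm (D y) <= B) -> (forall y, enorm (w y) <= B) ->
  (forall y, enorm (D y - h *: w y) <= c) ->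
  \int[mu0]_y dotv (p y) (D y) <=
  h * \int[mu0]_y dotv (p y) (w y) + c * \int[mu0]_y enorm (p y).
Proof.
move=> mp ip mD mw DB wB Dw.
have ids (v : T -> Rd) : vmeasurable setT v -> (forall y, enorm (v y) <= B) ->
    mu0.-integrable setT (EFin \o (fun y => dotv (p y) (v y))).
  move=> mv vB.
  apply: (@integrable_le _ _ _ mu0 setT _ (fun y => B * enorm (p y))) => //.
  - exact: measurable_dotv.
  - move=> y _; rewrite (le_trans (normr_dotv_le _ _))// mulrC ler_wpM2r ?enorm_ge0//.
  - exact: (integrableZl measurableT B ip).
have i1 := integrableZl measurableT h (ids w mw wB).
have i2 := integrableZl measurableT c ip.
rewrite -(RintegralZl h measurableT (ids w mw wB)) -(RintegralZl c measurableT ip).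
rewrite -(RintegralD measurableT i1 i2).
apply: le_Rintegral => //; [exact: ids|exact: (integrableD measurableT i1 i2)|move=> y _].
rewrite -{1}(subrK (h *: w y) (D y)) dotvDr dotvZr addrC lerD2l.
by rewrite (le_trans (dotv_le _ _))// mulrC ler_wpM2r ?enorm_ge0.
Qed.

Lemma L2_integrable (mu0 : P) (p : T -> Rd) : L2_field mu0 p ->
  mu0.-integrable setT (EFin \o (fun y => enorm (p y))).
Proof.
move=> [mp hp].
have m2 : measurable_fun setT (fun y => enorm (p y) ^+ 2).
  by apply: measurable_funX; exact: measurable_enorm.
have i2 : mu0.-integrable setT (EFin \o (fun y => enorm (p y) ^+ 2)).
  apply/integrableP; split; first exact/measurable_EFinP.
  by under eq_integral do rewrite /= ger0_norm ?sqr_ge0//.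
apply: (@integrable_le _ _ _ mu0 setT _ (fun y => 1 + enorm (p y) ^+ 2)) => //.
- exact: measurable_enorm.
- by move=> y _; rewrite ger0_norm ?enorm_ge0//; nra.
- have i1 : mu0.-integrable setT (EFin \o (fun=> 1 : R)).
    by apply: (@prob_integrable _ _ _ _ _ 1) => // x; rewrite normr1.
  exact: (integrableD measurableT i1 i2).
Qed.

End estimates.

Section subsolution.
Context {R : realType} {d : nat}.
Local Notation leb := (@lebesgue_measure R).
Local Notation Rd := 'rV[R]_d.
Local Notation T := (torus R d).
Local Notation P := (prob_torus R d).
Variables (Tf : R) (k : R -> R).
Variables (F : R -> T -> P -> set Rd) (G : R -> T -> T -> P -> set Rd).
Variables (L Gf : T -> P -> R).
Hypothesis k_ge0 : forall t, t \in `[0, Tf] -> 0 <= k t.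
Hypothesis k_L1 : leb.-integrable `[0, Tf] (EFin \o k).
Hypothesis hF : F_assumptions Tf F k.
Hypothesis hG : G_assumptions Tf G k.
Hypothesis hL : cost_assumptions L.
Hypothesis hGf : cost_assumptions Gf.
Variable (M : R).
Hypothesis M0 : 0 <= M.
Hypothesis leF : forall t x th p, t \in `[0, Tf] -> F t x th p -> enorm p <= M.
Hypothesis leG : forall t x y th p, t \in `[0, Tf] -> G t x y th p -> enorm p <= M.

(** The quotient in the definition of the superdifferential is evaluated along the variation
    of the crowd and the displacement of the agent; every error term is of order h^2. *)
Lemma hamiltonian_step (a : R) (x0 : T) (mu0 : P) (pt : R) (px : Rd) (pmu : T -> Rd) (v : Rd) (w : T -> Rd) :
  0 <= a < Tf ->
  superdifferential (value_function Tf F G L Gf) a x0 mu0 pt px pmu ->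
  F a x0 mu0 v -> vmeasurable setT w -> (forall y, G a x0 y mu0 (w y)) ->
  0 <= pt + (L x0 mu0 + dotv v px + \int[mu0]_y dotv (pmu y) (w y)).
Proof.
move=> aT [L2p hsup] Fv mw Gw; have /andP[a0 aT'] := aT.
have [u [U [p [[hu hU mp pM] Fu Gp hp [C hC]]]]] :=
  control_ex k_ge0 k_L1 hF hG M0 leF leG aT Fv mw Gw.
have [mpmu _] := L2p; have ip := L2_integrable L2p.
have [K K0 hK] := cost_lip hL.
have aab : a \in `[0, Tf] by rewrite in_itv/= a0 ltW.
have wM y : enorm (w y) <= M by exact: leG aab (Gw y).
pose N := \int[mu0]_y enorm (pmu y).
have N0 : 0 <= N by apply: Rintegral_ge0 => y _; exact: enorm_ge0.
pose C' := `|C|.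
have hC' t : t \in `[a, Tf] -> enorm (vint a t u - (t - a) *: v) <= C' * (t - a) ^+ 2 /\
    forall y, enorm (disp a U t y - (t - a) *: w y) <= C' * (t - a) ^+ 2.
  move=> tab; have [h1 h2] := hC t tab.
  have CC' : C * (t - a) ^+ 2 <= C' * (t - a) ^+ 2 by rewrite ler_wpM2r ?sqr_ge0// ler_norm.
  by split => [|y]; [exact: le_trans h1 CC'|exact: le_trans (h2 y) CC'].
have C0 : 0 <= C' by exact: normr_ge0.
pose D := 2 * K * M + enorm px * C' + C' * N.
apply: (@slope_ge0 _ _ D (1 + M)); first by rewrite /D !addr_ge0 ?mulr_ge0 ?enorm_ge0.
  by rewrite addr_ge0.
move=> e e0.
have e0' : (0 < e%:E :> \bar R)%E by rewrite lte_fin.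
have [dl dl0 hdl] := near_right0_prod
  (near_limf_esup _ (hsup _ (admissible_variation_flow a mu0 hU)) e0').
have M1 : 0 < M + 1 by rewrite ltr_wpDl.
(* h is small enough for the agent to stay within dl of its starting point, for the
   displacements to stay below 1/2, and for a + h to stay below Tf *)
exists (Num.min (Num.min (dl / (M + 1)) dl) (Num.min (2^-1 / (M + 1)) (Tf - a))).
  by rewrite !lt_min dl0 subr_gt0 aT' !divr_gt0// invr_gt0.
move=> h h0; rewrite !lt_min => /andP[/andP[h1 h2] /andP[h3 h4]].
have Mh c : h < c / (M + 1) -> M * h < c.
  rewrite ltr_pdivlMr// => hc; apply: (@le_lt_trans _ _ (h * (M + 1))) => //.
  by rewrite mulrDr mulr1 mulrC lerDl ltW.
have ahab : a + h \in `[a, Tf].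
  by rewrite in_itv/= lerDl (ltW h0)/= -lerBrDl ltW.
have hh : a + h - a = h by rewrite addrC addKr.
have [hv hw] := hC' _ ahab; rewrite hh in hv hw.
have uh : enorm (vint a (a + h) u) <= M * h.
  by have := enorm_vint_itv hu (_ : a <= a + h); rewrite hh; apply; rewrite lerDl ltW.
have Uh y : enorm (disp a U (a + h) y) <= M * h.
  by have := enorm_vint_itv (velocity_vbounded y hU) (_ : a <= a + h); rewrite hh; apply; rewrite lerDl ltW.
have := hdl h (vint a (a + h) u) h0 h2 (le_lt_trans uh (Mh _ h1)).
rewrite lee_fin /=.
have Dpos : 0 < h + enorm (vint a (a + h) u) by rewrite ltr_pwDl// enorm_ge0.
rewrite ler_pdivrMr//.
have vE : value_function Tf F G L Gf (a + h) (agent_path a x0 u (a + h)) (pr2_push (variation a mu0 hU h)) =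
    value_function Tf F G L Gf (a + h) (agent_path a x0 u (a + h)) (law a mu0 U (a + h)).
  by apply: value_same_meas; exact: pr2_variation.
rewrite -/(agent_path a x0 u (a + h)) vE.
rewrite (Rintegral_variation a mu0 hU mpmu h0 (Mh _ h3)).
have ahT : a + h <= Tf by move: ahab; rewrite in_itv/= => /andP[].
have ah : a < a + h by rewrite ltrDl.
have dpp := dynamic_programming k_ge0 k_L1 hF hG hL hGf M0 leF leG a0 ah ahT hu hU mp pM Fu Gp hp.
have rc := running_cost_le a x0 mu0 hL hu hU (ltW h0) K0 hK.
have mD : vmeasurable setT (disp a U (a + h)).
  move=> i; exact: (measurableT_comp (measurable_disp a hU i) (pair1_measurable (a + h))).
have B1 y : enorm (disp a U (a + h) y) <= M * h + M by rewrite (le_trans (Uh y))// lerDl.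
have B2 y : enorm (w y) <= M * h + M by rewrite (le_trans (wM y))// lerDr mulr_ge0// ltW.
have pl := pairing_le mpmu ip mD mw B1 B2 hw.
have xl : dotv px (vint a (a + h) u) <= h * dotv v px + enorm px * (C' * h ^+ 2).
  rewrite -{1}(subrK (h *: v) (vint a (a + h) u)) dotvDr dotvZr (dotvC px v) addrC lerD2l.
  by rewrite (le_trans (dotv_le _ _))// ler_wpM2l ?enorm_ge0.
have el : e * (h + enorm (vint a (a + h) u)) <= e * (1 + M) * h.
  by rewrite -mulrA ler_wpM2l ?(ltW e0)// mulrDl mul1r lerD2l.
move: dpp rc pl xl el => /= dpp rc pl xl el; move: dpp rc pl xl el; rewrite -/N /D.
set V1 := value_function _ _ _ _ _ a x0 mu0.
set V2 := value_function _ _ _ _ _ (a + h) _ _.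
set I1 := \int[_]_(t in _) _.
set I2 := \int[_]_y dotv (pmu y) (disp _ _ _ _).
set I3 := \int[_]_y dotv (pmu y) (w y).
set d1 := dotv px _; set d2 := dotv v px; set L0 := L x0 mu0.
set E1 := e * (h + _); set E2 := e * (1 + M) * h.
clearbody V1 V2 I1 I2 I3 d1 d2 L0 E1 E2 N C'.
clear; nra.
Qed.

End subsolution.

Theorem proposition5p3 (R : realType) (d : nat) (Tf : R) (hT : 0 < Tf)
    (k : R -> R)
    (k_ge0 : forall t, t \in `[0, Tf] -> 0 <= k t)
    (k_L1 : lebesgue_measure.-integrable `[0, Tf] (EFin \o k))
    (F : R -> torus R d -> prob_torus R d -> set 'rV[R]_d)
    (G : R -> torus R d -> torus R d -> prob_torus R d -> set 'rV[R]_d)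
    (hF : F_assumptions Tf F k)
    (hG : G_assumptions Tf G k)
    (L Gf : torus R d -> prob_torus R d -> R)
    (hL : cost_assumptions L)
    (hGf : cost_assumptions Gf) :
  subsolution Tf (hamiltonian F G L) (value_function Tf F G L Gf).
Proof.
have [M [M0 [leF leG]]] := FG_bounded k_ge0 hF hG (ltW hT).
move=> a x0 mu0 aT pt px pmu hsup; have /andP[a0 aT'] := aT.
have aab : a \in `[0, Tf] by rewrite in_itv/= a0 ltW.
rewrite addeC -leeBlDr// sub0e; apply: le_ereal_inf_tmp => _ [v [w [Fv [mw iw] Gw ->]]].
rewrite lee_fin -subr_ge0 opprK addrC.
have [_ nG _] := hG.
(* w is a selection almost everywhere only; its projection is one everywhere *)
pose w' y := nproj (G a x0 y mu0) (w y).
have mw' : vmeasurable setT w' by exact: (vmeasurable_nproj_G hG).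
have Gw' y : G a x0 y mu0 (w' y) by apply: nproj_in; exact: nG.
have := hamiltonian_step k_ge0 k_L1 hF hG hL hGf M0 leF leG aT hsup Fv mw' Gw'.
have [[mpmu _] _] := hsup.
suff -> : \int[mu0]_y dotv (pmu y) (w' y) = \int[mu0]_y dotv (pmu y) (w y) by [].
apply: ae_eq_Rintegral; [exact: measurable_dotv|exact: measurable_dotv|].
by apply: filterS Gw => y Gy _ /=; rewrite /w' nproj_id//; exact: nG.
Qed.
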